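(* Let $V$ be a complex vector space of finite dimension $d$ and let $\rho:\mathrm{SL}_2(\mathbb{Z})\to\mathrm{GL}(V)$ be a representation with $\rho\begin{pmatrix}-1&0\\0&-1\end{pmatrix}=(-1)^{\epsilon}\,\mathrm{id}_V$, where $\epsilon\in\{0,1\}$. Assume that the graded module $\mathsf{M}(\rho)=\bigoplus_{n}\mathsf{M}_n(\rho)$ of holomorphic vector-valued modular forms with multiplier $\rho$ is a free module of rank $d$ over the graded ring $\mathsf{M}=\mathbb{C}[E_4,E_6]$ of scalar holomorphic modular forms. Let $w_1,\dots,w_d$ be the weights of a set of free (homogeneous) generators of $\mathsf{M}(\rho)$, let $P_\rho(z)=\sum_{i=1}^d z^{w_i}$ denote the Hilbert polynomial of $\mathsf{M}(\rho)$, and let $\zeta=e^{2\pi\mathsf{i}/3}$. Then $$P_\rho(-\mathsf{i})=\mathrm{Tr}\,\rho\begin{pmatrix}0&-1\\1&0\end{pmatrix}$$ and $$P_\rho(\zeta^{\pm1})=\mathrm{Tr}\,\rho\left(\begin{pmatrix}0&-1\\1&-1\end{pmatrix}^{\mp1}\right).$$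
   Context: Let $\mathbf{H}=\{\tau\in\mathbb{C}:\mathrm{Im}\,\tau>0\}$ and $q=\exp(2\pi\mathsf{i}\tau)$. A vector-valued modular form of weight $n\in\mathbb{Z}$ with multiplier $\rho$ is a map $\mathbb{X}:\mathbf{H}\to V$, holomorphic everywhere on $\mathbf{H}$, such that $\mathbb{X}\left(\frac{a\tau+b}{c\tau+d}\right)=(c\tau+d)^n\rho\begin{pmatrix}a&b\\c&d\end{pmatrix}\mathbb{X}(\tau)$ for all $\begin{pmatrix}a&b\\c&d\end{pmatrix}\in\mathrm{SL}_2(\mathbb{Z})$. It is called holomorphic if it is bounded as $\tau\to\mathsf{i}\infty$, i.e. its Puiseux expansion in $q$ contains only non-negative powers of $q$. $\mathsf{M}_n(\rho)$ is the space of holomorphic forms of weight $n$ with multiplier $\rho$. Scalar modular forms are the case where $\rho$ is the trivial one-dimensional representation; the ring of scalar holomorphic forms is $\mathsf{M}=\bigoplus_{k\ge0}\mathsf{M}_{2k}=\mathbb{C}[E_4,E_6]$, with $E_4=1+240\sum_{n\ge1}\sigma_3(n)q^n$ and $E_6=1-504\sum_{n\ge1}\sigma_5(n)q^n$, and $\mathsf{M}(\rho)$ is an $\mathsf{M}$-module by multiplication. The Hilbert polynomial of $\mathsf{M}(\rho)$ is $P_\rho(z)=(1-z^4)(1-z^6)\sum_n\dim\mathsf{M}_n(\rho)\,z^n$, which equals $\sum_i z^{w_i}$. *)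

(* Defs.v *)
(* MathComp / MathComp-Analysis.  The real numbers are Stdlib's [R], which is a
   [realType] through [Rstruct]. *)
From Stdlib Require Import Reals.
From HB Require Import structures.
From mathcomp Require Import all_boot all_order all_algebra.
From mathcomp Require Import ring.
From mathcomp.real_closed Require Import complex.
From mathcomp Require Import boolp classical_sets functions cardinality fsbigop.
From mathcomp Require Import reals topology normedtype derive.
From mathcomp Require Import Rstruct Rstruct_topology.

Set Implicit Arguments.
Unset Strict Implicit.
Unset Printing Implicit Defensive.
Import Order.TTheory GRing.Theory Num.Theory.
Import numFieldNormedType.Exports.

Local Open Scope classical_set_scope.
Local Open Scope ring_scope.

Notation CC := (complex R).

Definition cexp (z : CC) : CC :=
  Complex (exp (complex.Re z) * cos (complex.Im z))
          (exp (complex.Re z) * sin (complex.Im z)).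

Definition iC : CC := Complex 0 1.

Definition zeta : CC := cexp (Complex 0 (2 * PI / 3)).

Record SL2Z := MkSL2Z { SL2Z_mx :> 'M[int]_2 ; _ : \det SL2Z_mx == 1 }.

HB.instance Definition _ := [isSub for SL2Z_mx].
HB.instance Definition _ := [Choice of SL2Z by <:].

Lemma det_SL2Z (g : SL2Z) : \det (g : 'M[int]_2) = 1.
Proof. by case: g => A /= /eqP. Qed.

Lemma unitmx_SL2Z (g : SL2Z) : (g : 'M[int]_2) \in unitmx.
Proof. by rewrite unitmxE det_SL2Z. Qed.

Fact SL2Z_mul_subproof (g h : SL2Z) : \det (g *m h) == 1.
Proof. by rewrite det_mulmx !det_SL2Z mulr1. Qed.
Fact SL2Z_one_subproof : \det (1%:M : 'M[int]_2) == 1.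
Proof. by rewrite det1. Qed.
Fact SL2Z_inv_subproof (g : SL2Z) : \det (invmx g) == 1.
Proof. by rewrite det_inv det_SL2Z invr1. Qed.

Definition SL2Z_mul (g h : SL2Z) : SL2Z := MkSL2Z (SL2Z_mul_subproof g h).
Definition SL2Z_one : SL2Z := MkSL2Z SL2Z_one_subproof.
Definition SL2Z_inv (g : SL2Z) : SL2Z := MkSL2Z (SL2Z_inv_subproof g).

Fact SL2Z_mulA : associative SL2Z_mul.
Proof. by move=> f g h; apply: val_inj; rewrite /= mulmxA. Qed.
Fact SL2Z_mul1g : left_id SL2Z_one SL2Z_mul.
Proof. by move=> g; apply: val_inj; rewrite /= mul1mx. Qed.
Fact SL2Z_mulg1 : right_id SL2Z_one SL2Z_mul.
Proof. by move=> g; apply: val_inj; rewrite /= mulmx1. Qed.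
Fact SL2Z_mulVg : left_inverse SL2Z_one SL2Z_inv SL2Z_mul.
Proof. by move=> g; apply: val_inj; rewrite /= mulVmx ?unitmx_SL2Z. Qed.
Fact SL2Z_mulgV : right_inverse SL2Z_one SL2Z_inv SL2Z_mul.
Proof. by move=> g; apply: val_inj; rewrite /= mulmxV ?unitmx_SL2Z. Qed.

HB.instance Definition _ :=
  isGroup.Build SL2Z SL2Z_mulA SL2Z_mul1g SL2Z_mulg1 SL2Z_mulVg SL2Z_mulgV.

Definition mx22 (a b c d : int) : 'M[int]_2 :=
  \matrix_(i < 2, j < 2)
    if i == 0 then (if j == 0 then a else b) else (if j == 0 then c else d).

Lemma det2 (A : 'M[int]_2) : \det A = A 0 0 * A 1 1 - A 0 1 * A 1 0.
Proof.
rewrite (expand_det_row _ 0) 2!big_ord_recl big_ord0 addr0 /cofactor !det_mx11.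
rewrite !mxE /= expr0 mul1r expr1 mulN1r mulrN.
by congr (A _ _ * A _ _ - A _ _ * A _ _); apply: val_inj.
Qed.

Lemma det_mx22 (a b c d : int) (h : a * d - b * c == 1) :
  \det (mx22 a b c d) == 1.
Proof. by rewrite det2 !mxE. Qed.

Definition SL2Z_of (a b c d : int) (h : a * d - b * c == 1) : SL2Z :=
  MkSL2Z (det_mx22 h).

Definition negI : SL2Z := @SL2Z_of (-1) 0 0 (-1) isT.
Definition matS : SL2Z := @SL2Z_of 0 (-1) 1 0 isT.
Definition matU : SL2Z := @SL2Z_of 0 (-1) 1 (-1) isT.

Record uhp := MkUhp { uhp_val :> CC ; _ : 0 < complex.Im uhp_val }.

HB.instance Definition _ := [isSub for uhp_val].

Definition mob_num (g : SL2Z) (z : CC) : CC := (g 0 0)%:~R * z + (g 0 1)%:~R.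
Definition mob_den (g : SL2Z) (z : CC) : CC := (g 1 0)%:~R * z + (g 1 1)%:~R.

Fact mobius_subproof (g : SL2Z) (tau : uhp) :
  0 < complex.Im (mob_num g tau / mob_den g tau).
Proof.
have intC (n : int) : (n%:~R : CC) = Complex (n%:~R : R) 0.
  by rewrite -[RHS]/(real_complex R n%:~R) rmorph_int.
have := det_SL2Z g; rewrite det2 /mob_num /mob_den !intC.
move: (g 0 0) (g 0 1) (g 1 0) (g 1 1) => a' b' c' d' /(congr1 (fun n : int => n%:~R : R)).
rewrite rmorphB !rmorphM rmorph1 /=.
move: (a'%:~R : R) (b'%:~R : R) (c'%:~R : R) (d'%:~R : R) => a b c d.
case: tau => -[x y] /= y_gt0 detg.
rewrite !mul0r !subr0 !addr0.
set p := c * x + d; set q := c * y.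
have n2_gt0 : 0 < p ^+ 2 + q ^+ 2.
  have [c0|c0] := eqVneq c 0.
    rewrite ltr_wpDr ?sqr_ge0 // /p c0 mul0r add0r exprn_even_gt0 //=.
    by apply/eqP => d0; move/eqP: detg; rewrite c0 d0 !mulr0 subrr eq_sym oner_eq0.
  by rewrite ltr_wpDl ?sqr_ge0 // exprn_even_gt0 //= mulf_neq0 // gt_eqF.
suff -> : (a * x + b) * - (q / (p ^+ 2 + q ^+ 2)) +
          a * y * (p / (p ^+ 2 + q ^+ 2)) = y / (p ^+ 2 + q ^+ 2).
  by rewrite divr_gt0.
rewrite mulrN !mulrA -mulNr -mulrDl; congr (_ / _).
by rewrite -[RHS]mulr1 -detg /p /q; ring.
Qed.

Definition mobius (g : SL2Z) (tau : uhp) : uhp := MkUhp (mobius_subproof g tau).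

Definition extend0 (f : uhp -> CC) (z : CC) : CC :=
  if insub z is Some tau then f tau else 0.

(* Complex differentiability at every point; the extension by 0 is immaterial
   because the half-plane is open. *)
Definition holomorphic (f : uhp -> CC) : Prop :=
  forall tau : uhp, derivable (extend0 f : CC^o -> CC^o) (uhp_val tau : CC^o) 1.

(* tau -> i oo means that Im tau tends to infinity, uniformly in Re tau. *)
Definition bounded_at_ioo (f : uhp -> CC) : Prop :=
  exists y B : R, forall tau : uhp, y < complex.Im tau -> `|f tau| <= real_complex R B.

Section VectorValued.
Variables (V : vectType CC).

(* Values are invertible because SL2Z is a group. *)
Definition representation (rho : SL2Z -> 'End(V)) : Prop :=
  rho 1%g = \1%VF /\ forall g h : SL2Z, rho (g * h)%g = (rho g \o rho h)%VF.

(* V carries no chosen topology or norm: analytic properties of V-valued maps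
   are tested on linear functionals, which in finite dimension amounts to
   testing them on coordinates in any basis. *)
Definition vholomorphic (X : uhp -> V) : Prop :=
  forall phi : 'Hom(V, CC^o), holomorphic (fun tau => phi (X tau)).

Definition vbounded_at_ioo (X : uhp -> V) : Prop :=
  forall phi : 'Hom(V, CC^o), bounded_at_ioo (fun tau => phi (X tau)).

Definition vvmf (rho : SL2Z -> 'End(V)) (n : int) (X : uhp -> V) : Prop :=
  vholomorphic X /\
  forall (g : SL2Z) (tau : uhp),
    X (mobius g tau) = (mob_den g tau) ^ n *: rho g (X tau).

Definition hol_vvmf (rho : SL2Z -> 'End(V)) (n : int) : set (uhp -> V) :=
  [set X | vvmf rho n X /\ vbounded_at_ioo X].

End VectorValued.

Definition triv_rep (g : SL2Z) : 'End(CC^o) := \1%VF.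

(* External direct sum of subsets P i of a group: families of components, all
   but finitely many of them 0. *)
Definition direct_sum (I : Type) (T : zmodType) (P : I -> set T) : set (I -> T) :=
  [set x | (forall i, P i (x i)) /\ finite_set [set i | x i != 0]].

(* Scalar forms are forms for the trivial one-dimensional representation; the
   component of index k has weight 2k. *)
Definition modring : set (nat -> uhp -> CC^o) :=
  direct_sum (fun k : nat => hol_vvmf triv_rep (k.*2%:Z)).

Section GradedModule.
Variables (V : vectType CC) (rho : SL2Z -> 'End(V)).

Definition modmodule : set (int -> uhp -> V) := direct_sum (hol_vvmf rho).

(* The product of f in M and X in M(rho): its weight n component is
   sum_k f_k X_(n - 2k), a sum with finitely many nonzero terms. *)
Definition modact (f : nat -> uhp -> CC^o) (X : int -> uhp -> V) :
    int -> uhp -> V :=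
  fun n => \sum_(k \in [set: nat]) (fun tau => f k tau *: X (n - k.*2%:Z) tau).

Definition homogeneous (n : int) (X : int -> uhp -> V) : Prop :=
  forall m : int, m != n -> X m = 0.

(* The F i form a basis of M(rho) over M; "free of rank d" is carried by the
   index type 'I_d. *)
Definition free_generators (d : nat) (F : 'I_d -> int -> uhp -> V) : Prop :=
  (forall i, modmodule (F i)) /\
  forall X, modmodule X ->
    exists! c : 'I_d -> nat -> uhp -> CC^o,
      (forall i, modring (c i)) /\ X = \sum_(i < d) modact (c i) (F i).

End GradedModule.

Definition lftrace (V : vectType CC) (f : 'End(V)) : CC :=
  \tr (passmx.mxof (vbasis {:V}) (vbasis {:V}) f).

(* Weights may be negative, so this is in general a Laurent polynomial. *)
Definition hilbert_poly (d : nat) (w : 'I_d -> int) (z : CC) : CC :=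
  \sum_(i < d) z ^ w i.

(* Main.v *)
Require Import Defs.
From Stdlib Require Import Reals.
From HB Require Import structures.
From mathcomp Require Import all_boot all_order all_algebra ring lra zify.
From mathcomp.real_closed Require Import complex.
From mathcomp Require Import boolp classical_sets functions cardinality fsbigop.
From mathcomp Require Import reals topology normedtype derive.
From mathcomp Require Import Rstruct Rstruct_topology.
From Coquelicot Require RInt Continuity Hierarchy.

(** Let [t0] be a point of the half-plane fixed by [g], and [j = mob_den g t0]. A form
    [X] of weight [w] satisfies [X t0 = j ^ w *: rho g (X t0)]: its value at [t0] is
    an eigenvector of [rho g] for the eigenvalue [j ^ (- w)]. If the values at [t0] of
    the free generators form a basis of [V], the trace of [rho g] is therefore the sum
    of the [j ^ (- w i)], that is the Hilbert polynomial at [j^-1]. The three formulas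
    are the cases [t0 = i] with [matS], where [j = i], and [t0 = 1 + zeta] with [matU],
    where [j = zeta], and with the inverse of [matU].

    So everything rests on [generators_independent]: the values at [t0] of the [d]
    generators are linearly independent. It comes from freeness, by means of Poincare
    series with poles. Suppose that [\sum_i b_i F_i(t0) = 0]. The function
      [\sum_i b_i ((t0 - cconj t0) / (t - cconj t0)) ^ n_i F_i(t) / (t - t0)]
    has a removable singularity at [t0]. With exponents [n_i] that bring all terms to
    the same weight, the sum of its images under the modular group is a holomorphic
    form [H] ([polar_poincare]). Let [E] be a scalar form with a simple zero at [t0]
    ([form_with_nonzero_derivative], [weight_vanish]). Term by term,
    [E H = \sum_i Q_i F_i], where [Q_i] is the scalar form obtained from [b_i E] in the
    way [H] was obtained from the relation. On the other hand
    [H = \sum_i h_i F_i] for some scalar forms [h_i], by freeness, and uniqueness of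
    coordinates gives [E h_i = Q_i]. At [t0] the left-hand side vanishes. The value
    [Q_i(t0)] is the sum over the stabilizer of [t0] of [b_i E'(t0)] times a power of an
    automorphy factor [j]. Since [j ^+ 12 = 1] ([mob_den_fix12]), all these powers are
    [1] if [12] divides the weight of [Q_i], which can be arranged for any given [i].
    Hence [b_i = 0].

    The form [E] is the Poincare series of [(t - t0) / (t - cconj t0) ^ n]. For [n + 1]
    divisible by [12] its weight forces it to vanish at [t0], where some automorphy
    factor satisfies [j ^+ 2 != 1]. Its derivative at [t0], suitably scaled, is a sum to
    which the stabilizer contributes ones, whereas the other terms tend to [0] as [n]
    grows; so the zero is simple for some [n].

    Holomorphic functions are only assumed to be differentiable in the complex sense.
    The Goursat theorem on rectangles and the Cauchy formula on squares give the two
    facts used about them: a simple pole with residue [0] is removable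
    ([divided_difference_der]), and the Taylor remainder is bounded by the supremum
    ([cauchy_estimate]), so that dominated series are differentiated term by term
    ([weierstrass_sum]). The Poincare series are dominated because the modulus of
    [mob_den g t * (mobius g t - cconj t0)] bounds all entries of [g]
    ([entries_sq_bound]). *)

Set Implicit Arguments.
Unset Strict Implicit.
Unset Printing Implicit Defensive.
Import Order.TTheory GRing.Theory Num.Theory.
Import numFieldNormedType.Exports.
Local Open Scope classical_set_scope.
Local Open Scope ring_scope.
(* Real arguments of functions are read in [ring_scope]. *)
Bind Scope ring_scope with RbaseSymbolsImpl.R.

Local Notation Re := complex.Re.
Local Notation Im := complex.Im.
Local Notation "x %:C" := (real_complex R x).

(** * Modulus and complex differentiability *)

(** The norm of [CC] is itself complex; this is the modulus as a real number. *)
Definition cabs (z : CC) : R := Normc.normc z.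

Lemma cabsE (z : CC) : `|z| = (cabs z)%:C. Proof. by []. Qed.
Lemma cabs_ge0 z : 0 <= cabs z.
Proof. by rewrite -lecR -cabsE normr_ge0. Qed.
Lemma cabsD x y : cabs (x + y) <= cabs x + cabs y. Proof. exact: le_normcD. Qed.
Lemma cabsM x y : cabs (x * y) = cabs x * cabs y. Proof. exact: Normc.normcM. Qed.
Lemma cabsV x : cabs x^-1 = (cabs x)^-1. Proof. exact: Normc.normcV. Qed.
Lemma cabsN x : cabs (- x) = cabs x. Proof. exact: normcN. Qed.
Lemma cabsB x y : cabs (x - y) <= cabs x + cabs y. Proof. by rewrite -(cabsN y) cabsD. Qed.
Lemma cabsC x y : cabs (x - y) = cabs (y - x). Proof. by rewrite -cabsN opprB. Qed.
Lemma cabs0 : cabs 0 = 0. Proof. exact: Normc.normc0. Qed.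
Lemma cabs1 : cabs 1 = 1. Proof. exact: Normc.normc1. Qed.
Lemma cabsX x n : cabs (x ^+ n) = cabs x ^+ n.
Proof. by elim: n => [|n IH]; rewrite ?expr0 ?cabs1 // !exprS cabsM IH. Qed.
Lemma cabs_eq0 x : (cabs x == 0) = (x == 0).
Proof.
apply/eqP/eqP => [/Normc.eq0_normc //|->]; exact: cabs0.
Qed.
Lemma cabs_gt0 x : (0 < cabs x) = (x != 0).
Proof. by rewrite lt_def cabs_eq0 cabs_ge0 andbT. Qed.
Lemma cabs_sqr z : cabs z ^+ 2 = Re z ^+ 2 + Im z ^+ 2.
Proof. by case: z => x y; rewrite /cabs /= sqr_sqrtr ?addr_ge0 ?sqr_ge0. Qed.
Lemma cabs_real x : cabs x%:C = `|x|.
Proof. by rewrite /cabs /= expr0n /= addr0 sqrtr_sqr. Qed.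
Lemma ler_sqr_cabs z (b : R) : 0 <= b -> (cabs z <= b) = (Re z ^+ 2 + Im z ^+ 2 <= b ^+ 2).
Proof. by move=> b0; rewrite -cabs_sqr ler_pXn2r // ?nnegrE ?cabs_ge0. Qed.
Lemma Re_le_cabs z : `|Re z| <= cabs z.
Proof.
rewrite -(@ler_pXn2r _ 2) // ?nnegrE ?cabs_ge0 // cabs_sqr real_normK ?num_real //.
by rewrite lerDl sqr_ge0.
Qed.
Lemma Im_le_cabs z : `|Im z| <= cabs z.
Proof.
rewrite -(@ler_pXn2r _ 2) // ?nnegrE ?cabs_ge0 // cabs_sqr real_normK ?num_real //.
by rewrite lerDr sqr_ge0.
Qed.
Lemma cabs_le_ReIm z : cabs z <= `|Re z| + `|Im z|.
Proof.
rewrite ler_sqr_cabs ?addr_ge0 // sqrrD !real_normK ?num_real // -addrA.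
by rewrite lerD2l lerDr mulrn_wge0 ?mulr_ge0.
Qed.
Lemma cabs_triangle x y z : cabs (x - z) <= cabs (x - y) + cabs (y - z).
Proof. by have := cabsD (x - y) (y - z); rewrite addrA subrK. Qed.
Lemma cabs_sub_ge x y : cabs x - cabs y <= cabs (x - y).
Proof. by rewrite lerBlDr -{1}[x](subrK y) cabsD. Qed.
Lemma cabs_sum I (s : seq I) (f : I -> CC) : cabs (\sum_(i <- s) f i) <= \sum_(i <- s) cabs (f i).
Proof.
elim: s => [|i s IH]; first by rewrite !big_nil cabs0.
by rewrite !big_cons (le_trans (cabsD _ _)) ?lerD2l.
Qed.

Lemma cReD (x y : CC) : Re (x + y) = Re x + Re y. Proof. by case: x; case: y. Qed.
Lemma cImD (x y : CC) : Im (x + y) = Im x + Im y. Proof. by case: x; case: y. Qed.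
Lemma cReN (x : CC) : Re (- x) = - Re x. Proof. by case: x. Qed.
Lemma cImN (x : CC) : Im (- x) = - Im x. Proof. by case: x. Qed.
Lemma cReB (x y : CC) : Re (x - y) = Re x - Re y. Proof. by rewrite cReD cReN. Qed.
Lemma cImB (x y : CC) : Im (x - y) = Im x - Im y. Proof. by rewrite cImD cImN. Qed.
Lemma cReM (x y : CC) : Re (x * y) = Re x * Re y - Im x * Im y.
Proof. by case: x; case: y. Qed.
Lemma cImM (x y : CC) : Im (x * y) = Re x * Im y + Im x * Re y.
Proof. by case: x; case: y. Qed.
Lemma complexP (x y : CC) : Re x = Re y -> Im x = Im y -> x = y.
Proof. by case: x => a b; case: y => c d /= -> ->. Qed.

Lemma cabs_i : cabs iC = 1.
Proof. by rewrite /cabs /iC /= expr0n add0r expr1n sqrtr1. Qed.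

Lemma posC_real (e : CC) : 0 < e -> exists2 r : R, 0 < r & e = r%:C.
Proof. by case: e => a b; rewrite ltcE /= => /andP[/eqP -> h]; exists a. Qed.

Lemma nearC (P : set CC) (z : CC) : (\forall w \near (z : CC^o), P w) <->
  exists2 d : R, 0 < d & forall w, cabs (w - z) < d -> P w.
Proof.
split=> [|[d d0 H]].
  move=> /nbhs_ballP[e /= e0]; have [r r0 ->] := posC_real e0.
  rewrite -ball_normE => H; exists r => // w wz; apply: H => /=.
  by rewrite distrC cabsE ltcR.
apply/nbhs_ballP; exists d%:C; first by rewrite /= ltcR.
by rewrite -ball_normE => w /=; rewrite distrC cabsE ltcR => /H.
Qed.

Lemma contP (f : CC^o -> CC^o) (z : CC) : {for (z : CC^o), continuous f} <->
  forall e : R, 0 < e -> exists2 d : R, 0 < d & forall w, cabs (w - z) < d -> cabs (f w - f z) < e.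
Proof.
have E := @cvgrPdist_lt _ CC^o _ (nbhs (z : CC^o)) _ f (f z).
split=> [/E H e e0|H].
  have /H/nearC[d d0 K] : 0 < e%:C by rewrite ltcR.
  by exists d => // w /K; rewrite distrC cabsE ltcR.
apply/E => e /posC_real[r r0 ->]; apply/nearC.
have [d d0 K] := H r r0; exists d => // w /K.
by rewrite distrC cabsE ltcR.
Qed.

Lemma is_derivP (f : CC^o -> CC^o) (z L : CC) : is_derive (z : CC^o) 1 f L <->
  forall e : R, 0 < e -> exists2 d : R, 0 < d &
    forall h, cabs h < d -> cabs (f (z + h) - f z - L * h) <= e * cabs h.
Proof.
split=> [D e e0|H].
  have der : derivable f (z : CC^o) 1 by case: D.
  have dL : 'D_1 f (z : CC^o) = L by case: D.
  have : h^-1 *: ((f \o shift z) (h *: (1 : CC^o)) - f z) @[h --> (0 : CC^o)^'] --> (L : CC^o).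
    by rewrite -dL; apply: (cvg_toP der).
  move=> /cvgrPdist_lt H.
  have /H : 0 < e%:C by rewrite ltcR.
  rewrite near_withinE => /nearC[d d0 K]; exists d => // h hd.
  have [->|h0] := eqVneq h 0; first by rewrite addr0 subrr mulr0 subrr cabs0 mulr0.
  have := K h; rewrite subr0 => /(_ hd h0); rewrite /= distrC cabsE ltcR => /ltW.
  rewrite -(ler_pM2r (_ : 0 < cabs h)) ?cabs_gt0 // -cabsM.
  suff -> : (h^-1 *: (f (h *: 1 + z) - f z) - L) * h = f (z + h) - f z - L * h by [].
  by rewrite /GRing.scale /= mulr1 mulrBl mulrAC mulVf // mul1r [h + z]addrC.
have C : h^-1 *: ((f \o shift z) (h *: (1 : CC^o)) - f z) @[h --> (0 : CC^o)^'] --> (L : CC^o).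
  apply/cvgrPdist_lt => e /posC_real[r r0 ->].
  rewrite near_withinE; apply/nearC.
  have [d d0 K] := H (r / 2) (divr_gt0 r0 (ltr0n _ 2)).
  exists d => // h; rewrite subr0 => /K K1 h0.
  rewrite distrC cabsE ltcR -(ltr_pM2r (_ : 0 < cabs h)) ?cabs_gt0 // -cabsM.
  have -> : (h^-1 *: ((f \o shift z) (h *: 1) - f z) - L) * h = f (z + h) - f z - L * h.
    by rewrite /GRing.scale /= mulr1 mulrBl mulrAC mulVf // mul1r [h + z]addrC.
  by apply: le_lt_trans K1 _; rewrite ltr_pM2r ?cabs_gt0 // gtr_pMr // invf_lt1 // ltr1n.
apply: DeriveDef; first by apply/cvg_ex; exists L.
by apply/(cvg_lim _ C)/norm_hausdorff.
Qed.

Notation contC f z := {for (z : CC^o), continuous (f : CC^o -> CC^o)}.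
Notation derC f z := (derivable (f : CC^o -> CC^o) (z : CC^o) 1).

Section closure.
Variables (f g : CC -> CC) (z : CC).
Lemma contD : contC f z -> contC g z -> contC (fun w => f w + g w) z.
Proof. by move=> hf hg; apply: (@continuousD CC CC^o CC^o f g). Qed.
Lemma contB : contC f z -> contC g z -> contC (fun w => f w - g w) z.
Proof. by move=> hf hg; apply: (@continuousB CC CC^o CC^o f g). Qed.
Lemma contM : contC f z -> contC g z -> contC (fun w => f w * g w) z.
Proof. by move=> hf hg; exact: (@continuousM CC CC^o f g z hf hg). Qed.
Lemma contV : f z != 0 -> contC f z -> contC (fun w => (f w)^-1) z.
Proof. by move=> h hf; apply: (@continuousV CC CC^o f). Qed.
Lemma derD : derC f z -> derC g z -> derC (fun w => f w + g w) z.
Proof. by move=> hf hg; apply: derivableD. Qed.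
Lemma derB : derC f z -> derC g z -> derC (fun w => f w - g w) z.
Proof. by move=> hf hg; apply: derivableB. Qed.
Lemma derM : derC f z -> derC g z -> derC (fun w => f w * g w) z.
Proof. by move=> hf hg; exact: (@derivableM CC CC^o f g z 1 hf hg). Qed.
Lemma derV : f z != 0 -> derC f z -> derC (fun w => (f w)^-1) z.
Proof. by move=> h hf; exact: (@derivableV CC CC^o f z 1 h hf). Qed.
Lemma derX n : derC f z -> derC (fun w => f w ^+ n) z.
Proof.
move=> hf; rewrite (_ : (fun w => _) = (f : CC^o -> CC^o) ^+ n); last first.
  by apply/funext => w; rewrite fctE.
exact: (@derivableX CC CC^o f n z 1 hf).
Qed.
Lemma der_comp : derC g z -> derC f (g z) -> derC (fun w => f (g w)) z.
Proof.
move=> /derivable1_diffP hg /derivable1_diffP hf; apply/derivable1_diffP.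
exact: (@differentiable_comp CC CC^o CC^o CC^o g f).
Qed.
End closure.
Lemma cont_cst (c z : CC) : contC (fun=> c) z.
Proof. by apply/contP => e e0; exists 1 => // w _; rewrite subrr cabs0. Qed.
Lemma der_cst (c z : CC) : derC (fun=> c) z. Proof. exact: derivable_cst. Qed.
Lemma der_id (z : CC) : derC id z. Proof. exact: derivable_id. Qed.
Lemma der_cont f (z : CC) : derC f z -> contC f z.
Proof. by move=> /derivable1_diffP/differentiable_continuous. Qed.
Lemma cont_id (z : CC) : contC id z. Proof. exact/der_cont/der_id. Qed.
Lemma derX_z (f : CC -> CC) z (n : int) : f z != 0 -> derC f z -> derC (fun w => f w ^ n) z.
Proof.
move=> h hf; case: n => n; first exact: derX.
under eq_fun do rewrite NegzE -exprnN.
by apply: derV; [rewrite expf_neq0 | exact: derX].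
Qed.

Lemma near_eq_derC (f g : CC -> CC) (z : CC) :
  (exists2 d : R, 0 < d & forall w, cabs (w - z) < d -> f w = g w) -> derC f z -> derC g z.
Proof.
move=> [d d0 fg] /derivableP/is_derivP D.
suff : is_derive (z : CC^o) 1 (g : CC^o -> CC^o) ('D_1 (f : CC^o -> CC^o) (z : CC^o)) by case.
apply/is_derivP => e /D[d' d'0 H]; exists (Num.min d d'); first by rewrite lt_min d0.
move=> h; rewrite lt_min => /andP[h1 /H].
by rewrite !fg // ?subrr ?cabs0 // addrAC subrr add0r.
Qed.

Notation isD f z L := (is_derive (z : CC^o) 1 (f : CC^o -> CC^o) L).

Lemma isD_uniq (f : CC -> CC) (z L L' : CC) : isD f z L -> isD f z L' -> L = L'.
Proof. by move=> D D'; rewrite -(@derive_val _ _ _ _ _ _ _ D) (@derive_val _ _ _ _ _ _ _ D'). Qed.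

Lemma isD_near (f g : CC -> CC) (z L : CC) :
  (exists2 d : R, 0 < d & forall w, cabs (w - z) < d -> f w = g w) -> isD f z L -> isD g z L.
Proof.
move=> [d d0 fg] /is_derivP D; apply/is_derivP => e /D[d' d'0 H].
exists (Num.min d d'); first by rewrite lt_min d0.
move=> h; rewrite lt_min => /andP[h1 /H].
by rewrite !fg // ?subrr ?cabs0 // addrAC subrr add0r.
Qed.

Lemma isD_affine (a b z : CC) : isD (fun w => a * w + b) z a.
Proof.
apply/is_derivP => e e0; exists 1 => // h _.
have -> : a * (z + h) + b - (a * z + b) - a * h = 0 by ring.
by rewrite cabs0 mulr_ge0 ?cabs_ge0 ?ltW.
Qed.

Lemma isD_M (f g : CC -> CC) (z a b : CC) : isD f z a -> isD g z b ->
  isD (fun w => f w * g w) z (f z * b + g z * a).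
Proof. by move=> df dg; exact: (@is_deriveM CC CC^o f g z 1 a b df dg). Qed.

Lemma isD_cst (c z : CC) : isD (fun=> c) z 0.
Proof. exact: (@is_derive_cst CC CC^o CC^o c z 1). Qed.
Lemma isD_D (f g : CC -> CC) (z a b : CC) : isD f z a -> isD g z b -> isD (fun w => f w + g w) z (a + b).
Proof. by move=> df dg; exact: (@is_deriveD CC CC^o CC^o f g z 1 a b df dg). Qed.
Lemma isD_Z (c : CC) (f : CC -> CC) (z a : CC) : isD f z a -> isD (fun w => c * f w) z (c * a).
Proof. by move=> df; have := isD_M (isD_cst c z) df; rewrite mulr0 addr0. Qed.
Lemma isD_sum (I : Type) (r : seq I) (f : I -> CC -> CC) (z : CC) (a : I -> CC) :
  (forall i, isD (f i) z (a i)) -> isD (fun w => \sum_(i <- r) f i w) z (\sum_(i <- r) a i).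
Proof.
move=> df; elim: r => [|i r IH].
  by rewrite big_nil; under eq_fun do rewrite big_nil; exact: isD_cst.
by rewrite big_cons; under eq_fun do rewrite big_cons; exact: isD_D.
Qed.

Lemma isD_quot (f g : CC -> CC) (z a b : CC) n : g z != 0 -> isD f z a -> isD g z b ->
  isD (fun w => f w / g w ^+ n.+1) z ((a * g z - n.+1%:R * b * f z) / g z ^+ n.+2).
Proof.
move=> g0 df dg.
have dX : isD (fun w => g w ^+ n.+1) z (n.+1%:R * g z ^+ n * b).
  rewrite (_ : (fun w => _) = (g : CC^o -> CC^o) ^+ n.+1); last first.
    by apply/funext => w; rewrite fctE.
  exact: (@is_deriveX CC CC^o g n.+1 z 1 b dg).
have gX : g z ^+ n.+1 != 0 by rewrite expf_neq0.
have dV : isD (fun w => (g w ^+ n.+1)^-1) z (- (g z ^+ n.+1) ^- 2 * (n.+1%:R * g z ^+ n * b)).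
  have [dd ee] := dX; apply: DeriveDef; first exact: (@derV (fun w => g w ^+ n.+1) z gX dd).
  by rewrite (@deriveV CC CC^o _ z 1 gX dd) ee.
have := isD_M df dV; congr (is_derive _ _ _ _).
by rewrite !exprS; field; rewrite g0 expf_neq0.
Qed.

(** * Integrals along segments and rectangles *)

Definition path_cont (g : R -> CC) (t : R) : Prop :=
  forall e : R, 0 < e -> exists2 d : R, 0 < d & forall s, `|s - t| < d -> cabs (g s - g t) < e.

Definition integ (f : R -> R) (a b : R) : R := @RInt.RInt Hierarchy.R_CompleteNormedModule f a b.
Definition integrable (f : R -> R) (a b : R) := @RInt.ex_RInt Hierarchy.R_NormedModule f a b.

Lemma integrable_cont (f : R -> R) (a b : R) : a <= b ->
  (forall t, a <= t <= b -> forall e, 0 < e -> exists2 d, 0 < d &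
     forall s, `|s - t| < d -> `|f s - f t| < e) -> integrable f a b.
Proof.
move=> ab H; apply: (@RInt.ex_RInt_continuous Hierarchy.R_CompleteNormedModule) => z.
have /RleP ab' := ab.
rewrite Rmin_left // Rmax_right // => -[/RleP h1 /RleP h2].
apply/Hierarchy.continuity_pt_filterlim => e /RltP e0.
have [|d d0 K] := H z _ e e0; first by rewrite h1 h2.
exists d; split; first exact/RltP.
move=> x [_ /RltP xz]; apply/RltP.
by have := K x; rewrite /dist /= /R_dist -!RabsE; apply.
Qed.

Lemma integ_D f g a b : integrable f a b -> integrable g a b ->
  integ (fun t => f t + g t) a b = integ f a b + integ g a b.
Proof. exact: (@RInt.RInt_plus Hierarchy.R_CompleteNormedModule). Qed.
Lemma integ_Z f k a b : integrable f a b -> integ (fun t => k * f t) a b = k * integ f a b.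
Proof. by move=> h; exact: (@RInt.RInt_scal Hierarchy.R_CompleteNormedModule). Qed.
Lemma integrable_Z f k a b : integrable f a b -> integrable (fun t => k * f t) a b.
Proof. by move=> h; exact: (@RInt.ex_RInt_scal Hierarchy.R_NormedModule). Qed.
Lemma integ_const k a b : integ (fun=> k) a b = (b - a) * k.
Proof. exact: (@RInt.RInt_const Hierarchy.R_CompleteNormedModule). Qed.
Lemma integrable_const k a b : integrable (fun=> k) a b.
Proof. exact: (@RInt.ex_RInt_const Hierarchy.R_NormedModule). Qed.
Lemma integ_chasles f a b c : integrable f a b -> integrable f b c -> integ f a b + integ f b c = integ f a c.
Proof. exact: (@RInt.RInt_Chasles Hierarchy.R_CompleteNormedModule). Qed.
Lemma integ_ext f g a b : a <= b -> (forall t, a <= t <= b -> f t = g t) -> integ f a b = integ g a b.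
Proof.
move=> /[dup] ab /RleP ab' h; apply: (@RInt.RInt_ext Hierarchy.R_CompleteNormedModule) => x.
by rewrite Rmin_left // Rmax_right // => -[/RltP h1 /RltP h2]; apply: h; rewrite !ltW.
Qed.
Lemma integ_le f g a b : a <= b -> integrable f a b -> integrable g a b ->
  (forall t, a <= t <= b -> f t <= g t) -> integ f a b <= integ g a b.
Proof.
move=> /RleP ab xf xg h; apply/RleP/RInt.RInt_le => // x [/RltP h1 /RltP h2].
by apply/RleP/h; rewrite !ltW.
Qed.
Lemma integ_bound f a b M : a <= b -> integrable f a b ->
  (forall t, a <= t <= b -> `|f t| <= M) -> `|integ f a b| <= (b - a) * M.
Proof.
move=> /RleP ab xf h; apply/RleP; rewrite -RabsE.
apply: RInt.abs_RInt_le_const => // t [/RleP h1 /RleP h2].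
by apply/RleP; rewrite RabsE h // h1 h2.
Qed.

Definition cint (g : R -> CC) a b : CC :=
  Complex (integ (fun t => Re (g t)) a b) (integ (fun t => Im (g t)) a b).

Definition path_cont_on (g : R -> CC) a b := forall t, a <= t <= b -> path_cont g t.

Lemma path_contD f g t : path_cont f t -> path_cont g t -> path_cont (fun s => f s + g s) t.
Proof.
move=> hf hg e e0; have e2 : 0 < e / 2 by rewrite divr_gt0.
have [d d0 H] := hf _ e2; have [d' d'0 H'] := hg _ e2.
exists (Num.min d d') => [|s]; first by rewrite lt_min d0.
rewrite lt_min => /andP[/H h /H' h'].
rewrite opprD addrACA (le_lt_trans (cabsD _ _)) // [ltRHS](splitr e).
exact: ltrD.
Qed.
Lemma path_contZ c g t : path_cont g t -> path_cont (fun s => c * g s) t.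
Proof.
move=> hg e e0.
have c0 : 0 < cabs c + 1 by rewrite ltr_wpDl ?cabs_ge0.
have [d d0 H] := hg _ (divr_gt0 e0 c0).
exists d => // s /H h; rewrite -mulrBr cabsM.
rewrite ltr_pdivlMr // in h; apply: le_lt_trans h.
by rewrite mulrC ler_wpM2l ?cabs_ge0 // lerDl.
Qed.

Section cint.
Variables (a b : R) (ab : a <= b).
Implicit Types g : R -> CC.

Lemma integrable_Re g : path_cont_on g a b -> integrable (fun t => Re (g t)) a b.
Proof.
move=> h; apply: integrable_cont => // t /h ht e /ht[d d0 H]; exists d => // s /H.
by apply: le_lt_trans; rewrite -cReB Re_le_cabs.
Qed.
Lemma integrable_Im g : path_cont_on g a b -> integrable (fun t => Im (g t)) a b.
Proof.
move=> h; apply: integrable_cont => // t /h ht e /ht[d d0 H]; exists d => // s /H.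
by apply: le_lt_trans; rewrite -cImB Im_le_cabs.
Qed.

Lemma cintD f g : path_cont_on f a b -> path_cont_on g a b ->
  cint (fun t => f t + g t) a b = cint f a b + cint g a b.
Proof.
move=> hf hg; apply: complexP.
  by rewrite cReD /= -integ_D; [apply: integ_ext => // t _; rewrite cReD|apply: integrable_Re..].
by rewrite cImD /= -integ_D; [apply: integ_ext => // t _; rewrite cImD|apply: integrable_Im..].
Qed.

Lemma cintZ c g : path_cont_on g a b -> cint (fun t => c * g t) a b = c * cint g a b.
Proof.
move=> h; have [hr hi] := (integrable_Re h, integrable_Im h); apply: complexP.
  rewrite cReM /= -mulNr -!integ_Z // -integ_D; [|exact: integrable_Z..].
  by apply: integ_ext => // t _; rewrite cReM mulNr.
rewrite cImM /= -!integ_Z // -integ_D; [|exact: integrable_Z..].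
by apply: integ_ext => // t _; rewrite cImM.
Qed.

Lemma cint_ext f g : (forall t, a <= t <= b -> f t = g t) -> cint f a b = cint g a b.
Proof. by move=> h; congr Complex; apply: integ_ext => // t /h ->. Qed.

Lemma cint_const c : cint (fun=> c) a b = (b - a)%:C * c.
Proof. by rewrite /cint !integ_const; case: c => x y /=; apply: complexP => /=; ring. Qed.

Lemma cint_bound g M : path_cont_on g a b -> (forall t, a <= t <= b -> cabs (g t) <= M) ->
  cabs (cint g a b) <= 2 * M * (b - a).
Proof.
move=> h hM; apply: le_trans (cabs_le_ReIm _) _.
have -> : 2 * M * (b - a) = (b - a) * M + (b - a) * M by ring.
apply: lerD => /=; apply: integ_bound => //; first exact: integrable_Re.
- by move=> t /hM; apply: le_trans; exact: Re_le_cabs.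
- exact: integrable_Im.
- by move=> t /hM; apply: le_trans; exact: Im_le_cabs.
Qed.

Lemma cint_Re_ge g m : path_cont_on g a b -> (forall t, a <= t <= b -> m <= Re (g t)) ->
  (b - a) * m <= Re (cint g a b).
Proof. by move=> h hm; rewrite -integ_const integ_le //; [exact: integrable_const|exact: integrable_Re]. Qed.
Lemma cint_Im_ge g m : path_cont_on g a b -> (forall t, a <= t <= b -> m <= Im (g t)) ->
  (b - a) * m <= Im (cint g a b).
Proof. by move=> h hm; rewrite -integ_const integ_le //; [exact: integrable_const|exact: integrable_Im]. Qed.
End cint.

Lemma cint_chasles g a m b : a <= m -> m <= b -> path_cont_on g a b ->
  cint g a m + cint g m b = cint g a b.
Proof.
move=> am mb h.
have h1 : path_cont_on g a m by move=> t /andP[x y]; apply: h; rewrite x (le_trans y mb).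
have h2 : path_cont_on g m b by move=> t /andP[x y]; apply: h; rewrite y (le_trans am x).
by apply: complexP; rewrite ?cReD ?cImD /=; apply: integ_chasles;
   do ?[exact: integrable_Re|exact: integrable_Im].
Qed.

Definition rect x1 x2 y1 y2 (z : CC) : bool := (x1 <= Re z <= x2) && (y1 <= Im z <= y2).
Definition rect_bdry x1 x2 y1 y2 (z : CC) : bool :=
  rect x1 x2 y1 y2 z && [|| Re z == x1, Re z == x2, Im z == y1 | Im z == y2].

(** The integral over the boundary in the counterclockwise direction. Opposite
    sides are subtracted under the integral sign, so that an affine integrand
    becomes constant on each pair of sides. *)
Definition rect_oint (f : CC -> CC) x1 x2 y1 y2 : CC :=
  cint (fun t => f (Complex t y1) - f (Complex t y2)) x1 x2
  + iC * cint (fun t => f (Complex x2 t) - f (Complex x1 t)) y1 y2.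

Lemma path_cont_h f y t : contC f (Complex t y) -> path_cont (fun s => f (Complex s y)) t.
Proof.
move=> /contP h e /h[d d0 H]; exists d => // s st; apply: H.
suff -> : Complex s y - Complex t y = (s - t)%:C by rewrite cabs_real.
by apply: complexP; rewrite /= ?subrr.
Qed.

Lemma path_cont_v f x t : contC f (Complex x t) -> path_cont (fun s => f (Complex x s)) t.
Proof.
move=> /contP h e /h[d d0 H]; exists d => // s st; apply: H.
rewrite (le_lt_trans (cabs_le_ReIm _)) // cReB cImB /= subrr normr0 add0r //.
Qed.

Lemma path_contB f g t : path_cont f t -> path_cont g t -> path_cont (fun s => f s - g s) t.
Proof.
move=> hf hg; have := path_contD hf (path_contZ (-1) hg).
by move=> h e /h[d d0 H]; exists d => // s /H; rewrite !mulN1r.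
Qed.

Section rect_oint.
Variables (x1 x2 y1 y2 : R) (hx : x1 <= x2) (hy : y1 <= y2).
Let bd := rect_bdry x1 x2 y1 y2.

Let bdh1 t : x1 <= t <= x2 -> bd (Complex t y1).
Proof. by move=> h; rewrite /bd /rect_bdry /rect /= h !lexx ?hy /= eqxx ?orbT. Qed.
Let bdh2 t : x1 <= t <= x2 -> bd (Complex t y2).
Proof. by move=> h; rewrite /bd /rect_bdry /rect /= h !lexx ?hy /= eqxx ?orbT. Qed.
Let bdv1 t : y1 <= t <= y2 -> bd (Complex x1 t).
Proof. by move=> h; rewrite /bd /rect_bdry /rect /= h !lexx ?hx /= eqxx ?orbT. Qed.
Let bdv2 t : y1 <= t <= y2 -> bd (Complex x2 t).
Proof. by move=> h; rewrite /bd /rect_bdry /rect /= h !lexx ?hx /= eqxx ?orbT. Qed.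

Let ch f : (forall z, bd z -> contC f z) ->
  path_cont_on (fun t => f (Complex t y1) - f (Complex t y2)) x1 x2.
Proof.
by move=> cf t ht; apply: path_contB; apply: path_cont_h; apply: cf; [exact: bdh1|exact: bdh2].
Qed.
Let cv f : (forall z, bd z -> contC f z) ->
  path_cont_on (fun t => f (Complex x2 t) - f (Complex x1 t)) y1 y2.
Proof.
by move=> cf t ht; apply: path_contB; apply: path_cont_v; apply: cf; [exact: bdv2|exact: bdv1].
Qed.

Lemma rect_oint_ext f g : (forall z, bd z -> f z = g z) -> rect_oint f x1 x2 y1 y2 = rect_oint g x1 x2 y1 y2.
Proof.
move=> h; rewrite /rect_oint; congr (_ + _ * _); apply: cint_ext => // t ht.
  by rewrite !h ?bdh1 ?bdh2.
by rewrite !h ?bdv1 ?bdv2.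
Qed.

Lemma rect_ointD f g : (forall z, bd z -> contC f z) -> (forall z, bd z -> contC g z) ->
  rect_oint (fun z => f z + g z) x1 x2 y1 y2 = rect_oint f x1 x2 y1 y2 + rect_oint g x1 x2 y1 y2.
Proof.
move=> cf cg; rewrite /rect_oint.
have -> : forall a b c d : CC, (a + iC * b) + (c + iC * d) = (a + c) + iC * (b + d).
  by move=> *; ring.
rewrite -!cintD //; do ?[exact: ch|exact: cv].
by congr (_ + _ * _); apply: cint_ext => // t ht; ring.
Qed.

Lemma rect_ointZ c f : (forall z, bd z -> contC f z) ->
  rect_oint (fun z => c * f z) x1 x2 y1 y2 = c * rect_oint f x1 x2 y1 y2.
Proof.
move=> cf; rewrite /rect_oint mulrDr mulrCA -(cintZ hx c) -?(cintZ hy c) //; do ?[exact: ch|exact: cv].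
by congr (_ + _ * _); apply: cint_ext => // t ht; rewrite mulrBr.
Qed.

Lemma rect_oint_affine a b : rect_oint (fun z => a + b * z) x1 x2 y1 y2 = 0.
Proof.
rewrite /rect_oint.
rewrite (@cint_ext _ _ hx _ (fun=> b * (iC * (y1 - y2)%:C))); last first.
  by move=> t _; rewrite opprD addrACA subrr add0r -mulrBr; congr (_ * _); apply: complexP => /=; ring.
rewrite (@cint_ext _ _ hy _ (fun=> b * (x2 - x1)%:C)); last first.
  by move=> t _; rewrite opprD addrACA subrr add0r -mulrBr; congr (_ * _); apply: complexP => /=; ring.
by rewrite !cint_const !rmorphB /=; ring.
Qed.

Lemma rect_oint_bound f M : (forall z, bd z -> contC f z) -> (forall z, bd z -> cabs (f z) <= M) ->
  cabs (rect_oint f x1 x2 y1 y2) <= 4 * M * ((x2 - x1) + (y2 - y1)).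
Proof.
move=> cf hM; apply: le_trans (cabsD _ _) _; rewrite cabsM cabs_i mul1r.
have -> : 4 * M * (x2 - x1 + (y2 - y1)) = 2 * (M + M) * (x2 - x1) + 2 * (M + M) * (y2 - y1) by ring.
apply: lerD; apply: cint_bound => //; do ?[exact: ch|exact: cv] => t ht;
  apply: le_trans (cabsB _ _) _; apply: lerD; apply: hM;
  do ?[exact: bdh1|exact: bdh2|exact: bdv1|exact: bdv2].
Qed.

Lemma rect_oint_vcut f m : x1 <= m <= x2 -> (forall z, rect x1 x2 y1 y2 z -> contC f z) ->
  rect_oint f x1 x2 y1 y2 = rect_oint f x1 m y1 y2 + rect_oint f m x2 y1 y2.
Proof.
move=> /andP[m1 m2] cf; rewrite /rect_oint.
have cf' z : bd z -> contC f z by move=> /andP[/cf].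
rewrite -(cint_chasles m1 m2); last exact: ch.
have cm x : x1 <= x <= x2 -> path_cont_on (fun t => f (Complex x t)) y1 y2.
  by move=> xx t ht; apply: path_cont_v; apply: cf; rewrite /rect /= xx.
have c1 : path_cont_on (fun t => f (Complex m t) - f (Complex x1 t)) y1 y2.
  by move=> t ht; apply: path_contB; apply: cm; rewrite ?lexx ?m1 ?m2.
have c2 : path_cont_on (fun t => f (Complex x2 t) - f (Complex m t)) y1 y2.
  by move=> t ht; apply: path_contB; apply: cm; rewrite ?lexx ?hx ?m1 ?m2.
rewrite addrACA -mulrDr -cintD //; congr (_ + _ * _).
by apply: cint_ext => // t _; ring.
Qed.

Lemma rect_oint_hcut f m : y1 <= m <= y2 -> (forall z, rect x1 x2 y1 y2 z -> contC f z) ->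
  rect_oint f x1 x2 y1 y2 = rect_oint f x1 x2 y1 m + rect_oint f x1 x2 m y2.
Proof.
move=> /andP[m1 m2] cf; rewrite /rect_oint.
have cf' z : bd z -> contC f z by move=> /andP[/cf].
rewrite -(cint_chasles m1 m2); last exact: cv.
have cm y : y1 <= y <= y2 -> path_cont_on (fun t => f (Complex t y)) x1 x2.
  by move=> yy t ht; apply: path_cont_h; apply: cf; rewrite /rect /= yy ht.
have c1 : path_cont_on (fun t => f (Complex t y1) - f (Complex t m)) x1 x2.
  by move=> t ht; apply: path_contB; apply: cm; rewrite ?lexx ?hy ?m1 ?m2.
have c2 : path_cont_on (fun t => f (Complex t m) - f (Complex t y2)) x1 x2.
  by move=> t ht; apply: path_contB; apply: cm; rewrite ?lexx ?hy ?m1 ?m2.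
rewrite addrACA -mulrDr -cintD //; congr (_ + _ * _).
by apply: cint_ext => // t _; ring.
Qed.
End rect_oint.

Lemma rect_oint_quarters x y a b f : 0 <= a -> 0 <= b ->
  (forall z, rect x (x + 2 * a) y (y + 2 * b) z -> contC f z) ->
  rect_oint f x (x + 2 * a) y (y + 2 * b) =
    (rect_oint f x (x + a) y (y + b) + rect_oint f x (x + a) (y + b) (y + b + b))
  + (rect_oint f (x + a) (x + a + a) y (y + b) + rect_oint f (x + a) (x + a + a) (y + b) (y + b + b)).
Proof.
move=> a0 b0 cf.
have ea : x + a + a = x + 2 * a by ring.
have eb : y + b + b = y + 2 * b by ring.
have hx1 : x <= x + 2 * a by lra.
have hy1 : y <= y + 2 * b by lra.
have mx : x <= x + a <= x + 2 * a by lra.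
have my : y <= y + b <= y + 2 * b by lra.
have xa : x <= x + a by lra.
have xb : x + a <= x + 2 * a by lra.
rewrite ea eb (rect_oint_vcut hx1 hy1 mx) //.
congr (_ + _); apply: rect_oint_hcut => // z /andP[h1 h2]; apply: cf; rewrite /rect; lra.
Qed.

(** * Goursat and Cauchy theorems on rectangles *)

Section bisection.
Variable P : R -> R -> R -> R -> Prop.
Hypothesis split4 : forall x y a b, 0 <= a -> 0 <= b ->
  P x y a b -> P x (y + b) a b -> P (x + a) y a b -> P (x + a) (y + b) a b ->
  P x y (2 * a) (2 * b).

(** Bisection: if [P] failed on the rectangle, it would fail on a nested sequence
    of quarters, which shrinks to a point around which [P] holds. *)
Lemma rect_induction x y a b : 0 <= a -> 0 <= b ->
  (forall p q, x <= p <= x + a -> y <= q <= y + b -> exists2 d : R, 0 < d &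
     forall u v r s, 0 <= r -> 0 <= s -> x <= u -> u + r <= x + a -> y <= v -> v + s <= y + b ->
       u <= p <= u + r -> v <= q <= v + s -> r < d -> s < d -> P u v r s) ->
  P x y a b.
Proof.
move=> a0 b0 loc; apply: contrapT => nP.
pose A n : R := a / 2 ^+ n; pose B n : R := b / 2 ^+ n.
have AS n : A n = 2 * A n.+1 by rewrite /A exprS; field; rewrite expf_neq0 //; lra.
have BS n : B n = 2 * B n.+1 by rewrite /B exprS; field; rewrite expf_neq0 //; lra.
have A0 n : 0 <= A n by rewrite /A divr_ge0 // exprn_ge0 //; lra.
have B0 n : 0 <= B n by rewrite /B divr_ge0 // exprn_ge0 //; lra.
have step n (w : R * R) : exists w' : R * R,
  ~ P w.1 w.2 (A n) (B n) -> [/\ ~ P w'.1 w'.2 (A n.+1) (B n.+1),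
   (w'.1 = w.1 \/ w'.1 = w.1 + A n.+1) & (w'.2 = w.2 \/ w'.2 = w.2 + B n.+1)].
  rewrite AS BS.
  have [h1|h1] := pselect (P w.1 w.2 (A n.+1) (B n.+1)); last by exists w; split => //; left.
  have [h2|h2] := pselect (P w.1 (w.2 + B n.+1) (A n.+1) (B n.+1)); last first.
    by exists (w.1, w.2 + B n.+1) => _; split => //; [left|right].
  have [h3|h3] := pselect (P (w.1 + A n.+1) w.2 (A n.+1) (B n.+1)); last first.
    by exists (w.1 + A n.+1, w.2) => _; split => //; [right|left].
  have [h4|h4] := pselect (P (w.1 + A n.+1) (w.2 + B n.+1) (A n.+1) (B n.+1)); last first.
    by exists (w.1 + A n.+1, w.2 + B n.+1) => _; split => //; right.
  by exists w => nh; exfalso; apply: nh; apply: split4.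
have [g gP] := choice (fun nw : nat * (R * R) => step nw.1 nw.2).
pose w := fix w n := if n is m.+1 then g (m, w m) else (x, y).
have wP n : ~ P (w n).1 (w n).2 (A n) (B n).
  elim: n => [|n IH]; first by rewrite /A /B !expr0 !divr1.
  by have [] := gP (n, w n) IH.
have w1 n : (w n.+1).1 = (w n).1 \/ (w n.+1).1 = (w n).1 + A n.+1.
  by have [] := gP (n, w n) (wP n).
have w2 n : (w n.+1).2 = (w n).2 \/ (w n.+1).2 = (w n).2 + B n.+1.
  by have [] := gP (n, w n) (wP n).
have nest (u : nat -> R) (L : nat -> R) : (forall n, 0 <= L n) -> (forall n, L n = 2 * L n.+1) ->
   (forall n, u n.+1 = u n \/ u n.+1 = u n + L n.+1) ->
   exists p, forall n, [/\ u 0%N <= u n, u n + L n <= u 0%N + L 0%N & u n <= p <= u n + L n].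
  move=> L0 LS uS.
  have mono n k : u n <= u (n + k)%N /\ u (n + k)%N + L (n + k)%N <= u n + L n.
    elim: k => [|k [h1 h2]]; first by rewrite addn0 !lexx.
    rewrite addnS; have := LS (n + k)%N; have := L0 (n + k).+1.
    by case: (uS (n + k)%N) => ->; lra.
  have cmp n m : u n <= u m + L m.
    have [le|/ltnW le] := leqP n m.
      by have := mono n (m - n)%N; rewrite subnKC // => -[h _]; have := L0 m; lra.
    by have := mono m (n - m)%N; rewrite subnKC // => -[_ h]; have := L0 n; lra.
  exists (sup (range u)) => n.
  have hs : has_sup (range u).
    by split; [exists (u 0%N), 0%N | exists (u 0%N + L 0%N) => _ [m _ <-]].
  split; first by have [] := mono 0%N n.
    by have [] := mono 0%N n.
  apply/andP; split; first by apply: sup_upper_bound => //; exists n.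
  by apply: ge_sup => [|_ [m _ <-]]; [exists (u 0%N), 0%N | exact: cmp].
have [p pP] := nest (fun n => (w n).1) A A0 AS w1.
have [q qP] := nest (fun n => (w n).2) B B0 BS w2.
have a00 : A 0%N = a by rewrite /A expr0 divr1.
have b00 : B 0%N = b by rewrite /B expr0 divr1.
have [_ _ pp] := pP 0%N; have [_ _ qq] := qP 0%N; rewrite /= a00 b00 in pp qq.
have [d d0 H] := loc p q pp qq.
have small (c : R) : 0 <= c -> exists n, c / 2 ^+ n < d /\ True.
  move=> c0; have cd : 0 <= c / d by rewrite divr_ge0 // ltW.
  exists (Num.truncn (c / d)).+1; split => //.
  rewrite ltr_pdivrMr ?exprn_gt0 // mulrC -ltr_pdivrMr //.
  apply: lt_trans (truncnS_gt _) _.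
  by rewrite -natrX ltr_nat ltn_expl.
have ab0 : 0 <= a + b by rewrite addr_ge0.
have [n [nd _]] := small _ ab0.
have An : A n < d.
  by apply: le_lt_trans nd; rewrite /A ler_pM2r ?invr_gt0 ?exprn_gt0 // lerDl.
have Bn : B n < d.
  by apply: le_lt_trans nd; rewrite /B ler_pM2r ?invr_gt0 ?exprn_gt0 // lerDr.
have [p1 p2 p3] := pP n; have [q1 q2 q3] := qP n; rewrite /= a00 b00 in p1 p2 q1 q2.
by apply: (wP n); apply: H.
Qed.
End bisection.

(** Goursat: near a point [f] is affine up to an error that is small compared with
    the size of the rectangle, and affine functions integrate to [0]. The bound
    [e * (r + s) ^+ 2] on an [r] by [s] rectangle is exactly additive under
    quartering, so it spreads from small rectangles to the whole. *)
Lemma goursat f x y a b : 0 <= a -> 0 <= b ->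
  (forall z, rect x (x + a) y (y + b) z -> derivable (f : CC^o -> CC^o) (z : CC^o) 1) ->
  rect_oint f x (x + a) y (y + b) = 0.
Proof.
move=> a0 b0 df.
have cf z : rect x (x + a) y (y + b) z -> contC f z by move=> /df/der_cont.
suff K : forall e : R, 0 < e -> cabs (rect_oint f x (x + a) y (y + b)) <= e * (a + b) ^+ 2.
  apply/eqP; rewrite -cabs_eq0 eq_le cabs_ge0 andbT.
  apply/ler_addgt0Pr => e e0; rewrite add0r.
  have h : 0 < (a + b) ^+ 2 + 1 by rewrite ltr_wpDl // sqr_ge0.
  apply: le_trans (K _ (divr_gt0 e0 h)) _.
  by rewrite mulrAC ler_pdivrMr // ler_pM2l // lerDl.
move=> e e0.
pose P u v r s := x <= u -> u + r <= x + a -> y <= v -> v + s <= y + b ->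
  cabs (rect_oint f u (u + r) v (v + s)) <= e * (r + s) ^+ 2.
suff : P x y a b by apply.
apply: rect_induction => //.
  move=> u v r s r0 s0 h1 h2 h3 h4 l1 l2 l3 l4.
  have ea : u + r + r = u + 2 * r by ring.
  have eb : v + s + s = v + 2 * s by ring.
  rewrite rect_oint_quarters //; last first.
    by move=> z /andP[z1 z2]; apply: cf; rewrite /rect; lra.
  apply: le_trans (cabsD _ _) _; apply: le_trans (lerD (cabsD _ _) (cabsD _ _)) _.
  have -> : e * (2 * r + 2 * s) ^+ 2 = (e * (r + s) ^+ 2 + e * (r + s) ^+ 2) +
    (e * (r + s) ^+ 2 + e * (r + s) ^+ 2) by ring.
  by apply: lerD; apply: lerD; [apply: h1|apply: h2|apply: h3|apply: h4]; lra.
move=> p q hp hq.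
have /df/derivableP/is_derivP D : rect x (x + a) y (y + b) (Complex p q) by rewrite /rect /= hp hq.
move: D; set c := f _; set L := 'D_1 f _ => D.
have e4 : 0 < e / 4 by rewrite divr_gt0.
have [d d0 H] := D _ e4.
have d2 : 0 < d / 2 by rewrite divr_gt0.
exists (d / 2) => // u v r s r0 s0 xu ur yv vs pu qv rd sd _ _ _ _.
pose g z := f z - (c - L * Complex p q + L * z).
have ur' : u <= u + r by lra.
have vs' : v <= v + s by lra.
have ca z : contC (fun z => c - L * Complex p q + L * z) z.
  apply: contD; first exact: cont_cst.
  by apply: contM; [exact: cont_cst|exact: cont_id].
have cf' z : rect_bdry u (u + r) v (v + s) z -> contC f z.
  by move=> /andP[/andP[z1 z2] _]; apply: cf; rewrite /rect; lra.
have cg z : rect_bdry u (u + r) v (v + s) z -> contC g z.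
  by move=> hz; apply: contB; [exact: cf'|exact: ca].
have -> : rect_oint f u (u + r) v (v + s) = rect_oint g u (u + r) v (v + s).
  rewrite -[RHS]addr0 -(rect_oint_affine ur' vs' (c - L * Complex p q) L) -rect_ointD //.
  by apply: rect_oint_ext => // z _; rewrite /g subrK.
have -> : e * (r + s) ^+ 2 = 4 * (e / 4 * (r + s)) * (u + r - u + (v + s - v)) by field.
apply: rect_oint_bound => // z /andP[/andP[z1 z2] _].
have zd : cabs (z - Complex p q) <= r + s.
  by apply: le_trans (cabs_le_ReIm _) _; rewrite cReB cImB /=; apply: lerD; rewrite ler_norml; lra.
have : cabs (z - Complex p q) < d by apply: le_lt_trans zd _; lra.
move=> /H; rewrite subrKC => K; apply: le_trans (ler_wpM2l (ltW e4) zd).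
apply: le_trans K; rewrite le_eqVlt; apply/orP; left; apply/eqP; congr cabs.
by rewrite /g /c; ring.
Qed.

Lemma goursat_le f x1 x2 y1 y2 : x1 <= x2 -> y1 <= y2 ->
  (forall z, rect x1 x2 y1 y2 z -> derC f z) -> rect_oint f x1 x2 y1 y2 = 0.
Proof.
move=> hx hy df; have := @goursat f x1 y1 (x2 - x1) (y2 - y1).
by rewrite !subr_ge0 !subrKC; apply.
Qed.

(** At [w] the function is only continuous. Cutting out a square of side [2 * t]
    around [w] leaves four rectangles on which Goursat applies, and the integral
    over the square is [O(t)]. *)
Lemma goursat_punctured f x1 x2 y1 y2 w : x1 < Re w < x2 -> y1 < Im w < y2 ->
  (forall z, rect x1 x2 y1 y2 z -> contC f z) ->
  (forall z, rect x1 x2 y1 y2 z -> z != w -> derC f z) -> rect_oint f x1 x2 y1 y2 = 0.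
Proof.
case: w => u v /= hu hv cf df; set w := Complex u v.
have /contP/(_ 1 ltr01)[d d0 H] : contC f w by apply: cf; rewrite /rect /=; lra.
pose M := cabs (f w) + 1.
have M0 : 0 < M by rewrite /M ltr_wpDl ?cabs_ge0.
have key t : 0 < t -> t < u - x1 -> t < x2 - u -> t < v - y1 -> t < y2 - v -> t < d / 2 ->
    cabs (rect_oint f x1 x2 y1 y2) <= 16 * M * t.
  move=> t0 t1 t2 t3 t4 td.
  have hx : x1 <= x2 by lra.
  have hy : y1 <= y2 by lra.
  have zero a b c e : a <= b -> c <= e -> x1 <= a -> b <= x2 -> y1 <= c -> e <= y2 ->
     [|| b < u, u < a, e < v | v < c] -> rect_oint f a b c e = 0.
    move=> ab ce *; apply: goursat_le => // z /andP[z1 z2]; apply: df; first by rewrite /rect; lra.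
    by apply/eqP => zw; move: z1 z2; rewrite zw /=; lra.
  rewrite (@rect_oint_vcut _ _ _ _ hx hy _ (u - t)); [|lra|exact: cf].
  have -> : rect_oint f x1 (u - t) y1 y2 = 0 by apply: zero; lra.
  rewrite add0r.
  rewrite (@rect_oint_vcut (u - t) _ _ _ _ hy _ (u + t)); [|lra|lra|]; last first.
    by move=> z /andP[z1 z2]; apply: cf; rewrite /rect; lra.
  have -> : rect_oint f (u + t) x2 y1 y2 = 0 by apply: zero; lra.
  rewrite addr0.
  rewrite (@rect_oint_hcut (u - t) (u + t) _ _ _ _ _ (v - t)); [|lra|lra|lra|]; last first.
    by move=> z /andP[z1 z2]; apply: cf; rewrite /rect; lra.
  have -> : rect_oint f (u - t) (u + t) y1 (v - t) = 0 by apply: zero; lra.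
  rewrite add0r.
  rewrite (@rect_oint_hcut (u - t) (u + t) _ _ _ _ _ (v + t)); [|lra|lra|lra|]; last first.
    by move=> z /andP[z1 z2]; apply: cf; rewrite /rect; lra.
  have -> : rect_oint f (u - t) (u + t) (v + t) y2 = 0 by apply: zero; lra.
  rewrite addr0.
  have -> : 16 * M * t = 4 * M * ((u + t - (u - t)) + (v + t - (v - t))) by ring.
  apply: rect_oint_bound; [lra|lra| |].
    by move=> z /andP[/andP[z1 z2] _]; apply: cf; rewrite /rect; lra.
  move=> z /andP[/andP[z1 z2] _].
  have : cabs (z - w) < d.
    apply: le_lt_trans (cabs_le_ReIm _) _; rewrite cReB cImB /=.
    have : `|Re z - u| <= t by rewrite ler_norml; lra.
    have : `|Im z - v| <= t by rewrite ler_norml; lra.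
    lra.
  move=> /H h; rewrite /M -lerBlDl; apply: le_trans (ltW h); exact: cabs_sub_ge.
apply/eqP; rewrite -cabs_eq0 eq_le cabs_ge0 andbT leNgt; apply/negP => I0.
set I := cabs _ in I0 key.
pose t := Num.min (I / (32 * M)) (Num.min (Num.min ((u - x1) / 2) ((x2 - u) / 2))
   (Num.min (Num.min ((v - y1) / 2) ((y2 - v) / 2)) (d / 4))).
have M32 : 0 < 32 * M by lra.
have t0 : 0 < t by rewrite /t !lt_min divr_gt0 //; lra.
have : t <= t by [].
rewrite {2}/t !le_min => /andP[tI /andP[/andP[ta tb] /andP[/andP[tc te] tf]]].
have := key t t0; rewrite ler_pdivlMr // in tI; lra.
Qed.

Definition sq_bdry (w : CC) (r : R) := rect_bdry (Re w - r) (Re w + r) (Im w - r) (Im w + r).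
Definition sq (w : CC) (r : R) := rect (Re w - r) (Re w + r) (Im w - r) (Im w + r).
Definition sq_oint f (w : CC) (r : R) := rect_oint f (Re w - r) (Re w + r) (Im w - r) (Im w + r).

Lemma ler_subD (x r : R) : 0 < r -> x - r <= x + r.
Proof. lra. Qed.

Section square.
Variables (w0 : CC) (r : R).

Lemma sq_bdry_sq z : sq_bdry w0 r z -> sq w0 r z. Proof. by case/andP. Qed.

Lemma sq_bdry_ge z : 0 < r -> sq_bdry w0 r z -> r <= cabs (z - w0).
Proof.
move=> r0 /andP[_ /or4P h].
have a1 := Re_le_cabs (z - w0); have a2 := Im_le_cabs (z - w0); rewrite cReB cImB in a1 a2.
have b1 := ler_norm (Re z - Re w0); have b2 := ler_normr 0 (Re z - Re w0).
have c1 := lerNnormlW (lexx `|Re z - Re w0|); have c2 := lerNnormlW (lexx `|Im z - Im w0|).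
have d1 := ler_norm (Im z - Im w0).
by case: h => /eqP e; rewrite e in a1 a2 b1 b2 c1 c2 d1; lra.
Qed.

Lemma sq_le z : sq w0 r z -> cabs (z - w0) <= 2 * r.
Proof.
move=> /andP[z1 z2]; apply: le_trans (cabs_le_ReIm _) _; rewrite cReB cImB.
have : `|Re z - Re w0| <= r by rewrite ler_norml; lra.
have : `|Im z - Im w0| <= r by rewrite ler_norml; lra.
lra.
Qed.

Lemma cabs_le_sq z : cabs (z - w0) <= r -> sq w0 r z.
Proof.
move=> h; have := le_trans (Re_le_cabs _) h; have := le_trans (Im_le_cabs _) h.
by rewrite cReB cImB !ler_norml /sq /rect; lra.
Qed.

Variable h : CC.

Lemma sq_bdry_sub_ge z : 0 < r -> cabs h <= r / 2 -> sq_bdry w0 r z -> r / 2 <= cabs (z - (w0 + h)).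
Proof.
move=> r0 hr /(sq_bdry_ge r0) zr; have := cabs_sub_ge (z - w0) h; rewrite opprD addrA; lra.
Qed.
Lemma sq_bdry_sub_neq0 z : 0 < r -> cabs h <= r / 2 -> sq_bdry w0 r z -> z - (w0 + h) != 0.
Proof. by move=> r0 hr /(sq_bdry_sub_ge r0 hr) hz; rewrite -cabs_gt0; lra. Qed.

Lemma sq_shift_in : 0 < r -> cabs h <= r / 2 ->
  Re w0 - r < Re (w0 + h) < Re w0 + r /\ Im w0 - r < Im (w0 + h) < Im w0 + r.
Proof.
move=> r0 hr; have := le_trans (Re_le_cabs h) hr; have := le_trans (Im_le_cabs h) hr.
by rewrite !ler_norml cReD cImD; lra.
Qed.

Lemma cont_kernel z : 0 < r -> cabs h <= r / 2 -> sq_bdry w0 r z -> contC (fun z => (z - (w0 + h))^-1) z.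
Proof.
move=> r0 hr zb; apply: contV; first exact: sq_bdry_sub_neq0.
by apply: contB; [exact: cont_id|exact: cont_cst].
Qed.

Lemma invC_ReIm (z : CC) : Re z^-1 = Re z / cabs z ^+ 2 /\ Im z^-1 = - Im z / cabs z ^+ 2.
Proof. by rewrite cabs_sqr; case: z => x y /=; split => //; rewrite mulNr. Qed.

(** A lower bound for the winding integral around [w0 + h]: on every side of the
    square the imaginary part of [dz / (z - (w0 + h))] is positive. *)
Lemma kernel_ge : 0 < r -> cabs h <= r / 2 -> 1 / 3 <= cabs (sq_oint (fun z => (z - (w0 + h))^-1) w0 r).
Proof.
move=> r0 hr; apply: le_trans (le_trans (ler_norm _) (Im_le_cabs _)).
pose k z := (z - (w0 + h))^-1.
have hh := le_trans (Re_le_cabs h) hr; have hh' := le_trans (Im_le_cabs h) hr.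
rewrite !ler_norml in hh hh'.
have ck z : sq_bdry w0 r z -> contC k z by exact: cont_kernel.
have kb z : sq_bdry w0 r z -> (z - (w0 + h)) != 0 /\ cabs (z - (w0 + h)) ^+ 2 <= 9 * r ^+ 2.
  move=> zb; split; first exact: sq_bdry_sub_neq0.
  have -> : 9 * r ^+ 2 = (3 * r) ^+ 2 by ring.
  rewrite ler_pXn2r // ?nnegrE ?cabs_ge0 //; last by lra.
  rewrite opprD addrA; have := cabsB (z - w0) h; have := sq_le (sq_bdry_sq zb); lra.
have low (a b : R) : r / 2 <= a -> 0 < b -> b <= 9 * r ^+ 2 -> 1 / (18 * r) <= a / b.
  move=> ha b0 hb; rewrite ler_pdivrMr; last lra.
  rewrite mulrAC ler_pdivlMr // mul1r; apply: le_trans hb _.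
  have -> : 9 * r ^+ 2 = r / 2 * (18 * r) by field.
  by rewrite ler_pM2r //; lra.
have i1 t : Re w0 - r <= t <= Re w0 + r -> 1 / (9 * r) <= Im (k (Complex t (Im w0 - r)) - k (Complex t (Im w0 + r))).
  move=> ht.
  have z1 : sq_bdry w0 r (Complex t (Im w0 - r)) by rewrite /sq_bdry /rect_bdry /rect /= eqxx !orbT andbT; lra.
  have z2 : sq_bdry w0 r (Complex t (Im w0 + r)) by rewrite /sq_bdry /rect_bdry /rect /= eqxx !orbT andbT; lra.
  have [n1 b1] := kb _ z1; have [n2 b2] := kb _ z2.
  have := low (r + Im h) _ _ _ b1; have := low (r - Im h) _ _ _ b2.
  rewrite !exprn_gt0 ?cabs_gt0 // => /(_ ltac:(lra) isT) l2 /(_ ltac:(lra) isT) l1.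
  rewrite cImB /k !(proj2 (invC_ReIm _)) !cImB !cImD [Im (Complex _ _)]/= [Im (Complex _ _)]/=.
  have -> : 1 / (9 * r) = 1 / (18 * r) + 1 / (18 * r) by field; lra.
  rewrite -[X in _ <= _ - X]opprK opprK -mulNr opprK.
  have -> : - (Im w0 - r - (Im w0 + Im h)) = r + Im h by ring.
  have -> : Im w0 + r - (Im w0 + Im h) = r - Im h by ring.
  exact: lerD.
have i2 t : Im w0 - r <= t <= Im w0 + r -> 1 / (9 * r) <= Re (k (Complex (Re w0 + r) t) - k (Complex (Re w0 - r) t)).
  move=> ht.
  have z1 : sq_bdry w0 r (Complex (Re w0 + r) t) by rewrite /sq_bdry /rect_bdry /rect /= eqxx ?orbT andbT; lra.
  have z2 : sq_bdry w0 r (Complex (Re w0 - r) t) by rewrite /sq_bdry /rect_bdry /rect /= eqxx ?orbT andbT; lra.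
  have [n1 b1] := kb _ z1; have [n2 b2] := kb _ z2.
  have := low (r - Re h) _ _ _ b1; have := low (r + Re h) _ _ _ b2.
  rewrite !exprn_gt0 ?cabs_gt0 // => /(_ ltac:(lra) isT) l2 /(_ ltac:(lra) isT) l1.
  rewrite cReB /k !(proj1 (invC_ReIm _)) !cReB !cReD [Re (Complex _ _)]/= [Re (Complex _ _)]/=.
  have -> : 1 / (9 * r) = 1 / (18 * r) + 1 / (18 * r) by field; lra.
  rewrite -mulNr.
  have -> : - (Re w0 - r - (Re w0 + Re h)) = r + Re h by ring.
  have -> : Re w0 + r - (Re w0 + Re h) = r - Re h by ring.
  exact: lerD.
have c1 : path_cont_on (fun t => k (Complex t (Im w0 - r)) - k (Complex t (Im w0 + r))) (Re w0 - r) (Re w0 + r).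
  move=> t ht; apply: path_contB; apply: path_cont_h; apply: ck;
    by rewrite /sq_bdry /rect_bdry /rect /= eqxx ?orbT andbT; lra.
have c2 : path_cont_on (fun t => k (Complex (Re w0 + r) t) - k (Complex (Re w0 - r) t)) (Im w0 - r) (Im w0 + r).
  move=> t ht; apply: path_contB; apply: path_cont_v; apply: ck;
    by rewrite /sq_bdry /rect_bdry /rect /= eqxx ?orbT andbT; lra.
have j1 := cint_Im_ge (ler_subD _ r0) c1 i1; have j2 := cint_Re_ge (ler_subD _ r0) c2 i2.
have e1 : (Re w0 + r - (Re w0 - r)) * (1 / (9 * r)) = 2 / 9 by field; lra.
have e2 : (Im w0 + r - (Im w0 - r)) * (1 / (9 * r)) = 2 / 9 by field; lra.
rewrite e1 in j1; rewrite e2 in j2.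
have ImI (A B : CC) : Im (A + iC * B) = Im A + Re B by rewrite cImD cImM /= mul0r add0r mul1r.
rewrite /sq_oint /rect_oint -/k ImI.
by apply: le_trans (lerD j1 j2); lra.
Qed.

(** Cauchy formula: extended by [f^`() (w0 + h)], the quotient is continuous, so
    that [goursat_punctured] applies to it. *)
Lemma cauchy_formula f : 0 < r -> cabs h <= r / 2 -> (forall z, sq w0 r z -> derC f z) ->
  sq_oint (fun z => (f z - f (w0 + h)) * (z - (w0 + h))^-1) w0 r = 0.
Proof.
move=> r0 hr df; have [s1 s2] := sq_shift_in r0 hr; set w := w0 + h in s1 s2 *.
have dfw : derC f w by apply: df; rewrite /sq /rect; lra.
pose L := 'D_1 (f : CC^o -> CC^o) (w : CC^o).
have D : is_derive (w : CC^o) 1 (f : CC^o -> CC^o) L by apply/derivableP.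
pose e z := if z == w then L else (f z - f w) * (z - w)^-1.
have de z : sq w0 r z -> z != w -> derC e z.
  move=> zs zw.
  apply: (@near_eq_derC (fun z => (f z - f w) * (z - w)^-1)).
    exists (cabs (z - w)); first by rewrite cabs_gt0 subr_eq0.
    move=> u; rewrite /e; case: eqP => // ->; by rewrite cabsC ltxx.
  apply: derM; first by apply: derB; [exact: df|exact: der_cst].
  apply: derV; first by rewrite subr_eq0.
  by apply: derB; [exact: der_id|exact: der_cst].
have ce z : sq w0 r z -> contC e z.
  move=> zs; have [->|/(de z zs)] := eqVneq z w; last exact: der_cont.
  apply/contP => eps eps0; have e2 : 0 < eps / 2 by rewrite divr_gt0.
  have /is_derivP/(_ _ e2)[d d0 H] := D.
  exists d => // u ud; rewrite /e eqxx.
  case: eqP => [_|/eqP uw]; first by rewrite subrr cabs0.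
  have n0 : 0 < cabs (u - w) by rewrite cabs_gt0 subr_eq0.
  have := H (u - w) ud; rewrite subrKC => K.
  rewrite -(ltr_pM2r n0) -cabsM mulrBl -mulrA mulVf ?mulr1 ?subr_eq0 //.
  by apply: le_lt_trans K _; rewrite ltr_pM2r //; lra.
rewrite -(@goursat_punctured e _ _ _ _ w s1 s2) //.
apply: rect_oint_ext; [exact: ler_subD|exact: ler_subD|] => z zb; rewrite /e; case: eqP => // zw.
by have := sq_bdry_sub_neq0 r0 hr zb; rewrite -/w zw subrr eqxx.
Qed.
End square.

(** * Cauchy transforms, removable singularities and the Cauchy estimate *)

Section sq_oint.
Variables (w : CC) (r : R).
Lemma sq_oint_ext f g : 0 < r -> (forall z, sq_bdry w r z -> f z = g z) -> sq_oint f w r = sq_oint g w r.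
Proof. by move=> r0; apply: rect_oint_ext; exact: ler_subD. Qed.
Lemma sq_ointD f g : 0 < r -> (forall z, sq_bdry w r z -> contC f z) -> (forall z, sq_bdry w r z -> contC g z) ->
  sq_oint (fun z => f z + g z) w r = sq_oint f w r + sq_oint g w r.
Proof. by move=> r0; apply: rect_ointD; exact: ler_subD. Qed.
Lemma sq_ointZ c f : 0 < r -> (forall z, sq_bdry w r z -> contC f z) ->
  sq_oint (fun z => c * f z) w r = c * sq_oint f w r.
Proof. by move=> r0; apply: rect_ointZ; exact: ler_subD. Qed.
Lemma sq_oint_lin c f g : 0 < r -> (forall z, sq_bdry w r z -> contC f z) ->
  (forall z, sq_bdry w r z -> contC g z) ->
  sq_oint (fun z => f z + c * g z) w r = sq_oint f w r + c * sq_oint g w r.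
Proof.
move=> r0 cf cg; rewrite -(sq_ointZ c r0 cg) -(sq_ointD (g := fun z => c * g z)) // => z zb.
by apply: contM; [exact: cont_cst|exact: cg].
Qed.
Lemma sq_oint_bound f M : 0 < r -> (forall z, sq_bdry w r z -> contC f z) ->
  (forall z, sq_bdry w r z -> cabs (f z) <= M) -> cabs (sq_oint f w r) <= 16 * M * r.
Proof.
move=> r0 cf hM; have := rect_oint_bound (ler_subD _ r0) (ler_subD _ r0) cf hM.
by congr (_ <= _); ring.
Qed.
End sq_oint.

Section transform.
Variables (w : CC) (r M : R) (phi : CC -> CC).
Let T u := sq_oint (fun z => phi z * (z - u)^-1) w r.

Lemma transform_bound h : 0 < r -> cabs h <= r / 2 ->
  (forall z, sq_bdry w r z -> contC phi z) -> (forall z, sq_bdry w r z -> cabs (phi z) <= M) ->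
  cabs (T (w + h)) <= 32 * M.
Proof.
move=> r0 hr cp pM; have -> : 32 * M = 16 * (M / (r / 2)) * r by field; lra.
apply: sq_oint_bound => // z zb; first by apply: contM; [exact: cp|exact: (cont_kernel r0 hr)].
rewrite cabsM cabsV; apply: ler_pM; rewrite ?invr_ge0 ?cabs_ge0 ?pM //.
by rewrite lef_pV2 ?posrE ?(sq_bdry_sub_ge r0 hr) // -?(cabs_gt0 _)
  ?(sq_bdry_sub_neq0 r0 hr) // ?cabs_gt0 ?(sq_bdry_sub_neq0 r0 hr) //; lra.
Qed.
End transform.

(** The resolvent identity for the Cauchy kernel: it turns a difference of
    transforms into [h] times the transform of another density, which gives both
    the Lipschitz bound and the derivative below. *)
Lemma transform_diff w r phi h : 0 < r -> cabs h <= r / 2 ->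
  (forall z, sq_bdry w r z -> contC phi z) ->
  sq_oint (fun z => phi z * (z - (w + h))^-1) w r - sq_oint (fun z => phi z * (z - w)^-1) w r =
  h * sq_oint (fun z => (phi z * (z - w)^-1) * (z - (w + h))^-1) w r.
Proof.
move=> r0 hr cp.
have h0 : cabs (0 : CC) <= r / 2 by rewrite cabs0; lra.
have ck z : sq_bdry w r z -> contC (fun z => (z - w)^-1) z.
  by move=> zb; have := cont_kernel r0 h0 zb; rewrite addr0.
have ckh z : sq_bdry w r z -> contC (fun z => (z - (w + h))^-1) z by exact: cont_kernel.
apply/eqP; rewrite subr_eq [eqbRHS]addrC; apply/eqP.
rewrite -(@sq_oint_lin w r h (fun z => phi z * (z - w)^-1)) //; last 2 first.
- by move=> z zb; apply: contM; [exact: cp|exact: ck].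
- by move=> z zb; apply: contM; [apply: contM; [exact: cp|exact: ck]|exact: ckh].
apply: sq_oint_ext => // z zb.
have n1 := sq_bdry_sub_neq0 r0 hr zb; have n2 := sq_bdry_sub_neq0 r0 h0 zb.
rewrite addr0 in n2; field; rewrite n2 n1 //.
Qed.

Lemma transform_lip w r M phi h : 0 < r -> cabs h <= r / 2 ->
  (forall z, sq_bdry w r z -> contC phi z) -> (forall z, sq_bdry w r z -> cabs (phi z) <= M) ->
  cabs (sq_oint (fun z => phi z * (z - (w + h))^-1) w r - sq_oint (fun z => phi z * (z - w)^-1) w r) <=
  32 * M / r * cabs h.
Proof.
move=> r0 hr cp pM; rewrite transform_diff // cabsM mulrC ler_wpM2r ?cabs_ge0 //.
have h0 : cabs (0 : CC) <= r / 2 by rewrite cabs0; lra.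
rewrite -mulrA; apply: transform_bound => // z zb.
  by apply: contM; [exact: cp|have := cont_kernel r0 h0 zb; rewrite addr0].
rewrite cabsM cabsV; apply: ler_pM; rewrite ?invr_ge0 ?cabs_ge0 ?pM //.
by have K := sq_bdry_ge r0 zb; rewrite lef_pV2 ?posrE //; lra.
Qed.

Lemma transform_der w r M phi : 0 < r ->
  (forall z, sq_bdry w r z -> contC phi z) -> (forall z, sq_bdry w r z -> cabs (phi z) <= M) ->
  derC (fun u => sq_oint (fun z => phi z * (z - u)^-1) w r) w.
Proof.
move=> r0 cp pM.
have h0 : cabs (0 : CC) <= r / 2 by rewrite cabs0; lra.
pose phi2 z := phi z * (z - w)^-1.
have cp2 z : sq_bdry w r z -> contC phi2 z.
  by move=> zb; apply: contM; [exact: cp|have := cont_kernel r0 h0 zb; rewrite addr0].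
have pM2 z : sq_bdry w r z -> cabs (phi2 z) <= M / r.
  move=> zb; rewrite cabsM cabsV; apply: ler_pM; rewrite ?invr_ge0 ?cabs_ge0 ?pM //.
  by have K := sq_bdry_ge r0 zb; rewrite lef_pV2 ?posrE //; lra.
set T := fun u => _.
suff : is_derive (w : CC^o) 1 (T : CC^o -> CC^o) (sq_oint (fun z => phi2 z * (z - w)^-1) w r) by case.
apply/is_derivP => e e0.
pose C := 32 * (M / r) / r; pose C' := `|C| + 1.
have C'0 : 0 < C' by rewrite /C' ltr_wpDl.
exists (Num.min (r / 2) (e / C')) => [|h]; first by rewrite lt_min !divr_gt0.
rewrite lt_min => /andP[/ltW hr he].
rewrite /T transform_diff // [_ * h]mulrC -mulrBr cabsM mulrC ler_wpM2r ?cabs_ge0 //.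
apply: le_trans (transform_lip r0 hr cp2 pM2) _.
apply: (@le_trans _ _ (C' * cabs h)).
  by rewrite ler_wpM2r ?cabs_ge0 // /C' -/C (le_trans (ler_norm _)) // lerDl.
by rewrite mulrC -ler_pdivlMr // ltW.
Qed.

Lemma cabs_inv_le x (c : R) : 0 < c -> c <= cabs x -> cabs x^-1 <= c^-1.
Proof. by move=> c0 h; rewrite cabsV lef_pV2 ?posrE //; apply: lt_le_trans h. Qed.

Section divided_difference.
Variables (f : CC -> CC) (w : CC) (r M : R).
Hypothesis df : forall z, sq w r z -> derC f z.
Hypothesis r0 : 0 < r.
Let psi z := (f z - f w) * (z - w)^-1.
Let T u := sq_oint (fun z => psi z * (z - u)^-1) w r.
Let K u := sq_oint (fun z => 1 * (z - u)^-1) w r.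

Let h0 : cabs (0 : CC) <= r / 2. Proof. by rewrite cabs0 divr_ge0 // ltW. Qed.

Let cpsi z : sq_bdry w r z -> contC psi z.
Proof.
move=> zb; apply: contM; last by have := cont_kernel r0 h0 zb; rewrite addr0.
by apply: contB; [apply: der_cont; apply: df; exact: sq_bdry_sq|exact: cont_cst].
Qed.

Let K_ge h : cabs h <= r / 2 -> 1 / 3 <= cabs (K (w + h)).
Proof.
move=> hr; have -> : K (w + h) = sq_oint (fun z => (z - (w + h))^-1) w r.
  by apply: sq_oint_ext => // z _; rewrite mul1r.
exact: kernel_ge.
Qed.

Let K_neq0 h : cabs h <= r / 2 -> K (w + h) != 0.
Proof. by move=> /K_ge hK; rewrite -cabs_gt0; apply: lt_le_trans hK; rewrite divr_gt0. Qed.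

(** The divided difference of [f] is a quotient of Cauchy transforms. The right-hand
    side is differentiable also at [h = 0]: this is how one derivative of [f]
    yields a second one. It is the difference of the Cauchy formulas at [w + h]
    and at [w]. *)
Lemma divdiff_formula h : cabs h <= r / 2 -> f (w + h) - f w = h * (T (w + h) / K (w + h)).
Proof.
move=> hr; apply: (mulIf (K_neq0 hr)); rewrite -!mulrA mulVf ?K_neq0 // mulr1.
have cf z : sq_bdry w r z -> contC f z by move=> /sq_bdry_sq/df/der_cont.
have ck z : sq_bdry w r z -> contC (fun z => (z - w)^-1) z.
  by move=> zb; have := cont_kernel r0 h0 zb; rewrite addr0.
have ckh z : sq_bdry w r z -> contC (fun z => (z - (w + h))^-1) z by exact: cont_kernel.
have c0 := cauchy_formula r0 hr df; have c1 := cauchy_formula r0 h0 df.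
rewrite addr0 in c1.
have cT z : sq_bdry w r z -> contC (fun z => psi z * (z - (w + h))^-1) z.
  by move=> zb; apply: contM; [exact: cpsi|exact: ckh].
have cK z : sq_bdry w r z -> contC (fun z => 1 * (z - (w + h))^-1) z.
  by move=> zb; apply: contM; [exact: cont_cst|exact: ckh].
have cS z : sq_bdry w r z -> contC (fun z => psi z + h * (psi z * (z - (w + h))^-1)) z.
  move=> zb; apply: contD; first exact: cpsi.
  by apply: contM; [exact: cont_cst|exact: cT].
have := @sq_oint_lin w r (- (f (w + h) - f w)) _ _ r0 cS cK.
rewrite (@sq_oint_lin w r h _ _ r0 cpsi cT) c1 add0r => E.
suff E0 : sq_oint (fun z => (psi z + h * (psi z * (z - (w + h))^-1)) +
    - (f (w + h) - f w) * (1 * (z - (w + h))^-1)) w r = 0.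
  by move: E; rewrite E0 mulNr => /eqP; rewrite eq_sym subr_eq0 => /eqP ->.
rewrite -c0.
apply: sq_oint_ext => // z zb.
have n1 := sq_bdry_sub_neq0 r0 hr zb; have n2 := sq_bdry_sub_neq0 r0 h0 zb.
rewrite addr0 in n2; rewrite /psi; field; rewrite n2 n1 //.
Qed.

Hypothesis fM : forall z, sq w r z -> cabs (f z) <= M.

Let psiM z : sq_bdry w r z -> cabs (psi z) <= 2 * M / r.
Proof.
move=> zb; rewrite cabsM cabsV; apply: ler_pM; rewrite ?invr_ge0 ?cabs_ge0 //.
  apply: le_trans (cabsB _ _) _; rewrite mulr_natl mulr2n; apply: lerD; apply: fM.
    exact: sq_bdry_sq.
  by apply: cabs_le_sq; rewrite subrr cabs0 ltW.
by have K' := sq_bdry_ge r0 zb; rewrite lef_pV2 ?posrE //; apply: lt_le_trans K'.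
Qed.

Lemma divdiff_der : derC (fun u => T u / K u) w.
Proof.
apply: derM; first exact: transform_der r0 cpsi psiM.
apply: derV; first by have := K_neq0 h0; rewrite addr0.
apply: (@transform_der w r 1) => // z _; first exact: cont_cst.
by rewrite cabs1.
Qed.

Lemma divdiff_bound : cabs (T w / K w) <= 192 * M / r.
Proof.
rewrite cabsM.
have k : 1 / 3 <= cabs (K w) by have := K_ge h0; rewrite addr0.
have t : cabs (T w) <= 32 * (2 * M / r).
  by have := transform_bound r0 h0 cpsi psiM; rewrite addr0.
have -> : 192 * M / r = 32 * (2 * M / r) * (1 / 3)^-1 by field; rewrite gt_eqF.
by apply: ler_pM; rewrite ?cabs_ge0 // cabs_inv_le // divr_gt0.
Qed.

Lemma divdiff_lip h : cabs h <= r / 2 ->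
  cabs (T (w + h) / K (w + h) - T w / K w) <= 18624 * M / r ^+ 2 * cabs h.
Proof.
move=> hr.
have k0 : 1 / 3 <= cabs (K w) by have := K_ge h0; rewrite addr0.
have k : 1 / 3 <= cabs (K (w + h)) by exact: K_ge.
have kn0 : K w != 0 by have := K_neq0 h0; rewrite addr0.
have kn := K_neq0 hr.
have t : cabs (T w) <= 32 * (2 * M / r).
  by have := transform_bound r0 h0 cpsi psiM; rewrite addr0.
have tl := transform_lip r0 hr cpsi psiM.
have kl : cabs (K (w + h) - K w) <= 32 * 1 / r * cabs h.
  apply: transform_lip => // z _; first exact: cont_cst.
  by rewrite cabs1.
have inv3 x : 1 / 3 <= cabs x -> cabs x^-1 <= 3.
  by move=> hx; rewrite -[leRHS]invrK cabs_inv_le ?invr_gt0 // -div1r.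
have M0 : 0 <= M by apply: le_trans (cabs_ge0 (f w)) _; apply: fM; apply: cabs_le_sq; rewrite subrr cabs0 ltW.
have -> : T (w + h) / K (w + h) - T w / K w =
    (T (w + h) - T w) * (K (w + h))^-1 - T w * (K (w + h) - K w) * ((K (w + h))^-1 * (K w)^-1).
  by field; rewrite kn0 kn.
apply: le_trans (cabsB _ _) _.
have -> : 18624 * M / r ^+ 2 * cabs h =
   32 * (2 * M / r) / r * cabs h * 3 + 32 * (2 * M / r) * (32 * 1 / r * cabs h) * (3 * 3).
  by field; rewrite gt_eqF.
apply: lerD; rewrite cabsM; first by apply: ler_pM; rewrite ?cabs_ge0 ?inv3.
apply: ler_pM; rewrite ?cabs_ge0 // cabsM; apply: ler_pM; rewrite ?cabs_ge0 // ?inv3 //.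
Qed.

Lemma divdiff_is_derive : is_derive (w : CC^o) 1 (f : CC^o -> CC^o) (T w / K w).
Proof.
apply/is_derivP => e e0.
have /contP/(_ e e0)[d d0 H] := der_cont divdiff_der.
exists (Num.min d (r / 2)) => [|h]; first by rewrite lt_min d0 divr_gt0.
rewrite lt_min => /andP[hd /ltW hr]; rewrite divdiff_formula // [_ * h]mulrC -mulrBr cabsM mulrC.
by rewrite ler_wpM2r ?cabs_ge0 // ltW // H // addrC addKr.
Qed.
End divided_difference.

(** The bounds are linear in [M] with constants that depend on [r] only; this is
    what allows them to be summed over the terms of a series. *)
Lemma cauchy_estimate f w r M : 0 < r ->
  (forall z, cabs (z - w) <= 2 * r -> derC f z) -> (forall z, cabs (z - w) <= 2 * r -> cabs (f z) <= M) ->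
  exists L, [/\ is_derive (w : CC^o) 1 (f : CC^o -> CC^o) L, cabs L <= 192 * M / r &
   forall h, cabs h <= r / 2 -> cabs (f (w + h) - f w - L * h) <= 18624 * M / r ^+ 2 * cabs h ^+ 2].
Proof.
move=> r0 df fM.
have df' z : sq w r z -> derC f z by move=> /sq_le/df.
have fM' z : sq w r z -> cabs (f z) <= M by move=> /sq_le/fM.
eexists; split; [exact: divdiff_is_derive df' r0 fM'|exact: divdiff_bound df' r0 fM'|].
move=> h hr; rewrite (divdiff_formula df' r0 hr) [_ * h]mulrC -mulrBr cabsM mulrC expr2 mulrA.
by rewrite ler_wpM2r ?cabs_ge0 //; exact: divdiff_lip.
Qed.

(** Removable singularities, in the case of a simple pole. *)
Lemma divided_difference_der f w L r : 0 < r -> (forall z, cabs (z - w) < r -> derC f z) ->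
  is_derive (w : CC^o) 1 (f : CC^o -> CC^o) L ->
  derC (fun u => if u == w then L else (f u - f w) / (u - w)) w.
Proof.
move=> r0 df dL.
have /der_cont/contP/(_ 1 ltr01)[d d0 H] : derC f w by apply: df; rewrite subrr cabs0.
pose s := Num.min (r / 3) (d / 3); pose M := cabs (f w) + 1.
have s0 : 0 < s by rewrite /s lt_min !divr_gt0.
have sr : s <= r / 3 by rewrite /s ge_min lexx.
have sd : s <= d / 3 by rewrite /s ge_min lexx orbT.
have df' z : sq w s z -> derC f z by move=> /sq_le zs; apply: df; lra.
have fM z : sq w s z -> cabs (f z) <= M.
  move=> /sq_le zs; have : cabs (z - w) < d by lra.
  by move=> /H h; rewrite /M -lerBlDl; apply: le_trans (ltW h); exact: cabs_sub_ge.
apply: near_eq_derC (divdiff_der df' s0 fM).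
have LE : L = sq_oint (fun z => (f z - f w) / (z - w) / (z - w)) w s / sq_oint (fun z => 1 / (z - w)) w s.
  have D := divdiff_is_derive df' s0 fM.
  by rewrite -(@derive_val _ _ _ _ _ _ _ dL) (@derive_val _ _ _ _ _ _ _ D).
exists (s / 2) => [|u ud]; first by rewrite divr_gt0.
have [->|uw] := eqVneq u w; first by rewrite LE.
have E := divdiff_formula df' s0 (ltW ud); rewrite subrKC in E.
by rewrite E [RHS]mulrC mulKf ?subr_eq0.
Qed.

(** * Unordered sums and the Weierstrass theorem *)

(** Summation along finite subsets: its invariance under every bijection of the
    index set is what makes Poincare series modular. *)
Definition has_sum (I : eqType) (u : I -> CC) (S : CC) : Prop :=
  forall e : R, 0 < e -> exists2 s0 : seq I, uniq s0 &
    forall s, uniq s -> {subset s0 <= s} -> cabs (\sum_(i <- s) u i - S) <= e.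

(** For a nonnegative family this is summability, with [B] bounding the sum. *)
Definition sums_le (I : eqType) (M : I -> R) (B : R) : Prop :=
  forall s, uniq s -> \sum_(i <- s) M i <= B.

Section sums.
Variable I : eqType.
Implicit Types (u v : I -> CC) (M : I -> R) (s : seq I).

Lemma big_split_sub (V : zmodType) (u : I -> V) s0 s : uniq s0 -> uniq s -> {subset s0 <= s} ->
  \sum_(i <- s) u i = \sum_(i <- s0) u i + \sum_(i <- [seq i <- s | i \notin s0]) u i.
Proof.
move=> u0 us sub; rewrite (bigID (mem s0)) /=; congr (_ + _); last by rewrite big_filter.
rewrite -big_filter; apply: perm_big; apply: uniq_perm; rewrite ?filter_uniq // => i.
by rewrite mem_filter andb_idr // => /sub.
Qed.

Lemma sums_le_sub M s0 s : (forall i, 0 <= M i) -> uniq s0 -> uniq s -> {subset s0 <= s} ->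
  \sum_(i <- s0) M i <= \sum_(i <- s) M i.
Proof.
by move=> M0 u0 us sub; rewrite (big_split_sub M u0 us sub) lerDl sumr_ge0.
Qed.

Lemma cat_undup s1 s2 : let s := undup (s1 ++ s2) in
  [/\ uniq s, {subset s1 <= s} & {subset s2 <= s}].
Proof.
by split=> [|i|i]; rewrite ?undup_uniq // mem_undup mem_cat => ->; rewrite ?orbT.
Qed.

Lemma has_sum_unique u S T : has_sum u S -> has_sum u T -> S = T.
Proof.
move=> hS hT; apply/eqP; rewrite -subr_eq0 -cabs_eq0 eq_le cabs_ge0 andbT.
apply/ler_addgt0Pr => e e0; rewrite add0r; have e2 : 0 < e / 2 by rewrite divr_gt0.
have [s1 _ h1] := hS _ e2; have [s2 _ h2] := hT _ e2.
have [us a b] := cat_undup s1 s2.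
have := h1 _ us a; have := h2 _ us b; set x := \sum_(i <- _) _ => k2 k1.
rewrite (splitr e); apply: le_trans (cabs_triangle _ x _) _.
by apply: lerD => //; rewrite cabsC.
Qed.

Lemma has_sumD u v S T : has_sum u S -> has_sum v T -> has_sum (fun i => u i + v i) (S + T).
Proof.
move=> hS hT e e0; have e2 : 0 < e / 2 by rewrite divr_gt0.
have [s1 _ h1] := hS _ e2; have [s2 _ h2] := hT _ e2.
have [us a b] := cat_undup s1 s2.
exists (undup (s1 ++ s2)) => // s su sub.
rewrite big_split opprD addrACA (splitr e); apply: le_trans (cabsD _ _) _.
by apply: lerD; [apply: h1 => // i /a/sub|apply: h2 => // i /b/sub].
Qed.

Lemma has_sumZ c u S : has_sum u S -> has_sum (fun i => c * u i) (c * S).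
Proof.
move=> hS e e0; have c0 : 0 < cabs c + 1 by rewrite ltr_wpDl ?cabs_ge0.
have [s0 us h] := hS _ (divr_gt0 e0 c0); exists s0 => // s su /(h s su).
rewrite -mulr_sumr -mulrBr cabsM ler_pdivlMr //; apply: le_trans.
by rewrite mulrC ler_wpM2l ?cabs_ge0 // lerDl.
Qed.

Lemma eq_has_sum u v S : u =1 v -> has_sum u S -> has_sum v S.
Proof. by move=> /funext ->. Qed.

Lemma has_sumN u S : has_sum u S -> has_sum (fun i => - u i) (- S).
Proof. by move=> /(has_sumZ (-1)); rewrite mulN1r; apply: eq_has_sum => i; rewrite mulN1r. Qed.

Lemma has_sum0 : has_sum (fun _ : I => 0) 0.
Proof. by move=> e e0; exists [::] => // s _ _; rewrite big1 // subr0 cabs0 ltW. Qed.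

Lemma has_sum_sum (J : Type) (r : seq J) (u : J -> I -> CC) (S : J -> CC) :
  (forall j, has_sum (u j) (S j)) ->
  has_sum (fun i => \sum_(j <- r) u j i) (\sum_(j <- r) S j).
Proof.
move=> h; elim: r => [|j r IH].
  by rewrite big_nil; apply: eq_has_sum has_sum0 => i; rewrite big_nil.
by rewrite big_cons; apply: eq_has_sum (has_sumD (h j) IH) => i; rewrite big_cons.
Qed.

Lemma has_sum_bound u S M B : has_sum u S -> (forall i, cabs (u i) <= M i) -> sums_le M B -> cabs S <= B.
Proof.
move=> hS uM MB; apply/ler_addgt0Pr => e e0.
have [s us /(_ s us (fun _ => id)) h] := hS _ e0.
rewrite -[S](subKr (\sum_(i <- s) u i)); apply: le_trans (cabsB _ _) _.
apply: lerD => //; apply: le_trans (cabs_sum _ _) _.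
by apply: le_trans (MB _ us); apply: ler_sum => i _.
Qed.

Lemma has_sum_reindex (J : eqType) (f : J -> I) (g : I -> J) u S : cancel f g -> cancel g f ->
  has_sum u S -> has_sum (u \o f) S.
Proof.
move=> fg gf hS e /hS[s0 us0 h].
exists (map g s0) => [|s us sub]; first by rewrite map_inj_uniq //; exact: can_inj gf.
have := h (map f s); rewrite big_map; apply.
  by rewrite map_inj_uniq //; exact: can_inj fg.
by move=> i /(map_f g)/sub/(map_f f); rewrite gf.
Qed.

Lemma sums_leZ c M B : 0 <= c -> sums_le M B -> sums_le (fun i => c * M i) (c * B).
Proof. by move=> c0 h s us; rewrite -mulr_sumr ler_wpM2l // h. Qed.

Lemma sums_le_le M N B : (forall i, N i <= M i) -> sums_le M B -> sums_le N B.
Proof. by move=> h hB s us; apply: le_trans (hB s us); apply: ler_sum => i _. Qed.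

Lemma sums_tail M B e : (forall i, 0 <= M i) -> sums_le M B -> 0 < e ->
  exists2 s0, uniq s0 & forall s, uniq s -> (forall i, i \in s -> i \notin s0) -> \sum_(i <- s) M i <= e.
Proof.
move=> M0 MB e0.
pose A := [set x : R | exists2 s, uniq s & x = \sum_(i <- s) M i].
have hA : has_sup A.
  split; first by exists 0, [::]; rewrite ?big_nil.
  by exists B => _ [s us ->]; exact: MB.
have [_ [s0 us0 ->] h] := sup_adherent e0 hA.
exists s0 => // s us dis.
have us' : uniq (s0 ++ s).
  by rewrite cat_uniq us0 us andbT; apply/hasPn => i /dis.
have : \sum_(i <- s0 ++ s) M i <= sup A by apply: sup_upper_bound => //; exists (s0 ++ s).
rewrite big_cat /= => k; lra.
Qed.

Lemma has_sum_nneg M B : (forall i, 0 <= M i) -> sums_le M B -> exists S : R, has_sum (fun i => (M i)%:C) S%:C.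
Proof.
move=> M0 MB.
pose A := [set x : R | exists2 s, uniq s & x = \sum_(i <- s) M i].
have hA : has_sup A.
  split; first by exists 0, [::]; rewrite ?big_nil.
  by exists B => _ [s us ->]; exact: MB.
exists (sup A) => e e0.
have [_ [s0 us0 ->] h] := sup_adherent e0 hA; exists s0 => // s us sub.
rewrite -raddf_sum -raddfB cabs_real ler_norml.
have := sums_le_sub M0 us0 us sub.
have : \sum_(i <- s) M i <= sup A by apply: sup_upper_bound => //; exists s.
lra.
Qed.

(** [u] is the difference of the nonnegative families [u + M] and [M], whose sums
    are suprema of finite partial sums. *)
Lemma has_sum_real (u : I -> R) M B : (forall i, `|u i| <= M i) -> sums_le M B ->
  exists S : R, has_sum (fun i => (u i)%:C) S%:C.
Proof.
move=> uM MB.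
have M0 i : 0 <= M i by apply: le_trans (uM i).
have [S hS] := has_sum_nneg M0 MB.
have p0 i : 0 <= u i + M i by have := uM i; rewrite ler_norml; lra.
have p1 : sums_le (fun i => u i + M i) (2 * B).
  apply: sums_le_le (sums_leZ (ler0n _ 2) MB) => i.
  by have := uM i; rewrite ler_norml; lra.
have [T hT] := has_sum_nneg p0 p1.
exists (T - S); rewrite raddfB; apply: eq_has_sum (has_sumD hT (has_sumN hS)) => i.
by rewrite -raddfB addrK.
Qed.

Lemma has_sum_exists u M B : (forall i, cabs (u i) <= M i) -> sums_le M B -> exists S, has_sum u S.
Proof.
move=> uM MB.
have [S hS] := has_sum_real (fun i => le_trans (Re_le_cabs (u i)) (uM i)) MB.
have [T hT] := has_sum_real (fun i => le_trans (Im_le_cabs (u i)) (uM i)) MB.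
exists (S%:C + iC * T%:C); apply: eq_has_sum (has_sumD hS (has_sumZ iC hT)) => i.
by case: (u i) => a b; apply: complexP => /=; ring.
Qed.

Lemma finite_local_bound (f : I -> CC -> CC) (w : CC) s : (forall i, contC (f i) w) ->
  exists d B : R, [/\ 0 < d, 0 <= B & forall i z, i \in s -> cabs (z - w) < d -> cabs (f i z) <= B].
Proof.
move=> cf; elim: s => [|i s [d [B [d0 B0 IH]]]]; first by exists 1, 0; split.
have /contP/(_ 1 ltr01)[d' d'0 H] := cf i.
exists (Num.min d d'), (B + (cabs (f i w) + 1)); split.
- by rewrite lt_min d0.
- by rewrite !addr_ge0 ?cabs_ge0.
- move=> j z; rewrite inE lt_min => /predU1P[->|js] /andP[h h'].
    have k := H _ h'; have := cabs_sub_ge (f i z) (f i w); lra.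
  have := IH j z js h; have := cabs_ge0 (f i w); lra.
Qed.

(** Term-by-term differentiation: the quadratic remainders of [cauchy_estimate] add
    up to a quadratic remainder. The finitely many terms in [s], to which the bound
    [M] does not apply, are bounded near [w] by continuity. *)
Lemma weierstrass_sum (f : I -> CC -> CC) (F : CC -> CC) (w : CC) (r : R) (s : seq I) M B : 0 < r ->
  (forall i z, cabs (z - w) < r -> derC (f i) z) ->
  (forall i z, cabs (z - w) < r -> i \notin s -> cabs (f i z) <= M i) ->
  (forall i, 0 <= M i) -> sums_le M B ->
  (forall z, cabs (z - w) < r -> has_sum (fun i => f i z) (F z)) ->
  exists L D, [/\ forall i, is_derive (w : CC^o) 1 (f i : CC^o -> CC^o) (L i),
    has_sum L D & is_derive (w : CC^o) 1 (F : CC^o -> CC^o) D].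
Proof.
move=> r0 df fM M0 MB hF.
have w0 : cabs (w - w) < r by rewrite subrr cabs0.
have [d [C [d0 C0 hC]]] := @finite_local_bound f w s (fun i => der_cont (df i w w0)).
pose q := Num.min (r / 4) (d / 4).
have q0 : 0 < q by rewrite lt_min !divr_gt0.
have qr : q <= r / 4 by rewrite ge_min lexx.
have qd : q <= d / 4 by rewrite ge_min lexx orbT.
pose N i := if i \in s then C else M i.
have N0 i : 0 <= N i by rewrite /N; case: ifP.
have fN i z : cabs (z - w) <= 2 * q -> cabs (f i z) <= N i.
  move=> hz; rewrite /N; case: ifPn => is_; first by apply: hC => //; lra.
  by apply: fM => //; lra.
have NB : sums_le N (C * (size s)%:R + B).
  move=> t ut; rewrite /N (bigID (mem s)) /=; apply: lerD; last first.
    rewrite -big_filter (eq_big_seq M); first by apply: MB; rewrite filter_uniq.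
    by move=> i; rewrite mem_filter => /andP[/negPf ->].
  rewrite -big_filter (eq_big_seq (fun=> C)) => [|i]; last by rewrite mem_filter => /andP[->].
  rewrite big_const_seq count_predT iter_addr_0 -[leLHS]mulr_natr ler_wpM2l // ler_nat.
  by apply: uniq_leq_size; rewrite ?filter_uniq // => i; rewrite mem_filter => /andP[].
have dfq i z : cabs (z - w) <= 2 * q -> derC (f i) z by move=> hz; apply: df; lra.
have [L LP] := choice (fun i => cauchy_estimate q0 (dfq i) (fN i)).
have LN i : cabs (L i) <= 192 / q * N i.
  by have [_ h _] := LP i; rewrite mulrAC.
have c1 : 0 <= 192 / q by rewrite divr_ge0 // ltW.
have [D hD] := has_sum_exists LN (sums_leZ c1 NB).
exists L, D; split => [i||]; [by have [] := LP i|exact: hD|].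
set B' := C * _ + B in NB.
apply/is_derivP => e e0; pose K := 18624 / q ^+ 2 * B'; pose K' := `|K| + 1.
have K'0 : 0 < K' by rewrite /K' ltr_wpDl.
exists (Num.min (q / 2) (e / K')) => [|h]; first by rewrite lt_min !divr_gt0.
rewrite lt_min => /andP[/ltW hq he].
have hS : has_sum (fun i => f i (w + h) - f i w - L i * h) (F (w + h) - F w - D * h).
  apply: has_sumD; last first.
    by rewrite mulrC; apply: has_sumN; apply: eq_has_sum (has_sumZ h hD) => i; rewrite mulrC.
  by apply: has_sumD; [apply: hF; rewrite addrC addKr; lra|apply/has_sumN/hF].
have hb i : cabs (f i (w + h) - f i w - L i * h) <= 18624 / q ^+ 2 * cabs h ^+ 2 * N i.
  by have [_ _ /(_ h hq)] := LP i; congr (_ <= _); ring.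
have c2 : 0 <= 18624 / q ^+ 2 * cabs h ^+ 2 by rewrite mulr_ge0 ?exprn_ge0 ?cabs_ge0 // divr_ge0 // exprn_ge0 // ltW.
apply: le_trans (has_sum_bound hS hb (sums_leZ c2 NB)) _.
have -> : 18624 / q ^+ 2 * cabs h ^+ 2 * B' = K * cabs h * cabs h by rewrite /K; ring.
rewrite ler_wpM2r ?cabs_ge0 //; apply: (@le_trans _ _ (K' * cabs h)).
  by rewrite ler_wpM2r ?cabs_ge0 // /K' (le_trans (ler_norm _)) // lerDl.
by rewrite mulrC -ler_pdivlMr // ltW.
Qed.
End sums.

(** * The modular action and its fixed points *)

Definition cconj (z : CC) : CC := Complex (Re z) (- Im z).

Lemma intCE (n : int) : (n%:~R : CC) = (n%:~R : R)%:C.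
Proof. by rewrite rmorph_int. Qed.

Lemma SL2Z_mulE (g h : SL2Z) (i j : 'I_2) :
  (g * h)%g i j = g i 0 * h 0 j + g i 1 * h 1 j.
Proof.
rewrite [LHS]/= mxE big_ord_recl big_ord1.
by congr (_ * _ + _ * _); congr (fun_of_matrix _ _ _); apply: val_inj.
Qed.

Lemma mob_den_neq0 (g : SL2Z) (t : uhp) : mob_den g t != 0.
Proof.
apply: contraTneq (mobius_subproof g t) => /= ->.
by rewrite invr0 mulr0 ltxx.
Qed.

Lemma mobiusE (g : SL2Z) (t : uhp) : uhp_val (mobius g t) * mob_den g t = mob_num g t.
Proof. by rewrite /= divfK // mob_den_neq0. Qed.

Lemma mob_denM (g h : SL2Z) (t : uhp) :
  mob_den (g * h)%g t = mob_den g (mobius h t) * mob_den h t.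
Proof.
rewrite {2}/mob_den mulrDl -mulrA mobiusE /mob_den /mob_num !SL2Z_mulE !rmorphD !rmorphM /=.
ring.
Qed.

Lemma mobiusM (g h : SL2Z) (t : uhp) : mobius (g * h)%g t = mobius g (mobius h t).
Proof.
apply: val_inj; apply: (mulIf (mob_den_neq0 (g * h)%g t)).
change (uhp_val (mobius (g * h)%g t) * mob_den (g * h)%g t =
  uhp_val (mobius g (mobius h t)) * mob_den (g * h)%g t).
rewrite mobiusE mob_denM mulrA mobiusE {2}/mob_num mulrDl -mulrA mobiusE.
rewrite /mob_den /mob_num !SL2Z_mulE !rmorphD !rmorphM /=; ring.
Qed.

Lemma mob_den1 (t : uhp) : mob_den 1%g t = 1.
Proof. by rewrite /mob_den !mxE /= mul0r add0r. Qed.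

Lemma mobius1 (t : uhp) : mobius 1%g t = t.
Proof.
apply: val_inj => /=; rewrite /mob_num /mob_den !mxE /=.
by rewrite mul0r add0r divr1 mul1r addr0.
Qed.

Lemma mob_denV (g : SL2Z) (t : uhp) : mob_den g^-1%g (mobius g t) = (mob_den g t)^-1.
Proof.
apply: (mulIf (mob_den_neq0 g t)); rewrite -mob_denM mulVg mob_den1 mulVf //.
exact: mob_den_neq0.
Qed.

Lemma mobiusV (g : SL2Z) (t : uhp) : mobius g^-1%g (mobius g t) = t.
Proof. by rewrite -mobiusM mulVg mobius1. Qed.

Lemma uhp_Im_gt0 (t : uhp) : 0 < Im t. Proof. by case: t. Qed.

Lemma Im_mobius (g : SL2Z) (t : uhp) : Im (mobius g t) = Im t / cabs (mob_den g t) ^+ 2.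
Proof.
have j0 := mob_den_neq0 g t.
have n0 : cabs (mob_den g t) ^+ 2 != 0 by rewrite expf_neq0 // cabs_eq0.
apply: (mulIf n0); rewrite divfK // [mobius g t : CC]/=.
have -> : mob_num g t / mob_den g t = (cabs (mob_den g t) ^+ 2)^-1%:C * (mob_num g t * cconj (mob_den g t)).
  have e : mob_den g t * cconj (mob_den g t) = (cabs (mob_den g t) ^+ 2)%:C.
    by rewrite cabs_sqr; apply: complexP; rewrite /cconj; case: (mob_den g t) => x y /=; ring.
  apply: (mulIf j0); rewrite divfK // -mulrA -[_ * cconj _ * _]mulrA [cconj _ * _]mulrC e mulrCA.
  by rewrite -rmorphM mulVf // mulr1.
rewrite cImM /= mul0r addr0 mulrC mulrA mulfV // mul1r /mob_num /mob_den /cconj.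
rewrite !intCE.
have := det_SL2Z g; rewrite det2 => /(congr1 (fun n : int => n%:~R : R)).
rewrite rmorphB !rmorphM rmorph1 /=.
move: (_%:~R : R) (_%:~R : R) (_%:~R : R) (_%:~R : R) => a b c d det.
case: t {j0 n0} => -[x y] /= _.
by rewrite -[RHS]mul1r -det; ring.
Qed.

(** If [g] fixes [t], then [j = mob_den g t] is an eigenvalue of [g], and its modulus
    is [1] because [g] preserves [Im t]. So [j + j^-1], the trace of [g], is the
    integer [2 * Re j] between [-2] and [2], and [j] is a root of unity of order
    1, 2, 3, 4 or 6. *)
Lemma mob_den_fix12 (g : SL2Z) (t : uhp) : mobius g t = t -> mob_den g t ^+ 12 = 1.
Proof.
move=> fg; set j := mob_den g t.
have e1 : mob_num g t = uhp_val t * j by rewrite -mobiusE fg.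
have j0 : j != 0 by exact: mob_den_neq0.
have it := uhp_Im_gt0 t.
have nj : cabs j ^+ 2 = 1.
  have := Im_mobius g t; rewrite fg -/j => h.
  have n0 : cabs j ^+ 2 != 0 by rewrite expf_neq0 // cabs_eq0.
  by apply: (mulfI (lt0r_neq0 it)); rewrite mulr1 {1}h divfK.
pose tr : int := g 0 0 + g 1 1.
have quad : j ^+ 2 - tr%:~R * j + 1 = 0.
  have := det_SL2Z g; rewrite det2 => /(congr1 (fun n : int => n%:~R : CC)).
  rewrite rmorphB !rmorphM rmorph1 /= => det.
  rewrite /tr rmorphD /=.
  have e2 : j = (g 1 0)%:~R * uhp_val t + (g 1 1)%:~R by [].
  move: det e1 e2; rewrite /mob_num; clearbody j.
   move: ((g 0 0)%:~R : CC) ((g 0 1)%:~R : CC) ((g 1 0)%:~R : CC) ((g 1 1)%:~R : CC) => a b c d det e1 e2.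
  rewrite -det; transitivity ((a - j) * (d - j) - b * c); first by ring.
  have -> : d - j = - (c * uhp_val t) by rewrite e2; ring.
  have -> : b = uhp_val t * j - a * uhp_val t by rewrite -e1; ring.
  by ring.
have trE : tr%:~R = 2 * Re j :> R.
  have e : j * cconj j = 1.
    transitivity ((cabs j ^+ 2)%:C); last by rewrite nj.
    by rewrite cabs_sqr; apply: complexP; rewrite /cconj; case: (j) => x y /=; ring.
  have : tr%:~R = j + cconj j :> CC.
    apply: (mulIf j0); rewrite mulrDl [cconj j * j]mulrC e -expr2.
    by apply/eqP; rewrite eq_sym -subr_eq0 -quad; apply/eqP; ring.
  by rewrite intCE => /(congr1 (fun z : CC => Re z)); rewrite cReD /cconj /= => ->; ring.
have Rj : `|Re j| <= 1.
  apply: le_trans (Re_le_cabs j) _.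
  by rewrite -(@ler_pXn2r _ 2) ?nnegrE ?cabs_ge0 // nj expr1n.
have trb : (-2%:Z <= tr <= 2%:Z).
  rewrite -2!(ler_int R) trE; move: Rj; rewrite ler_norml => /andP[h1 h2].
  by apply/andP; split; rewrite /=; lra.
have : tr \in [:: -2%:Z; -1; 0; 1; 2%:Z].
  by case/andP: trb; case: (tr) => [[|[|[|n]]]|[|[|n]]].
rewrite !inE => /or4P[/eqP e|/eqP e|/eqP e|/orP[/eqP e|/eqP e]].
- move: quad; rewrite e; have -> : j ^+ 2 - (-2%:Z)%:~R * j + 1 = (j + 1) ^+ 2 by ring.
  by move=> /eqP; rewrite expf_eq0 /= addr_eq0 => /eqP ->; ring.
- have h : j ^+ 2 = - j - 1 by move: quad; rewrite e => q; rewrite -[LHS]subr0 -q; ring.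
  have -> : j ^+ 12 = (j * j ^+ 2) ^+ 4 by ring.
  have -> : j * j ^+ 2 = - j ^+ 2 - j by rewrite {1}h; ring.
  by rewrite h; ring.
- have h : j ^+ 2 = - 1 by move: quad; rewrite e => q; rewrite -[LHS]subr0 -q; ring.
  have -> : j ^+ 12 = (j ^+ 2) ^+ 6 by ring.
  by rewrite h; ring.
- have h : j ^+ 2 = j - 1 by move: quad; rewrite e => q; rewrite -[LHS]subr0 -q; ring.
  have -> : j ^+ 12 = (j * j ^+ 2) ^+ 4 by ring.
  have -> : j * j ^+ 2 = j ^+ 2 - j by rewrite {1}h; ring.
  by rewrite h; ring.
- move: quad; rewrite e; have -> : j ^+ 2 - (2%:Z)%:~R * j + 1 = (j - 1) ^+ 2 by ring.
  by move=> /eqP; rewrite expf_eq0 /= subr_eq0 => /eqP ->; rewrite expr1n.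
Qed.

(** * Lattice sums over the modular group *)

(** With [g] of rows [(a, b)] and [(c, d)], these are the linear forms
    [(a t + b) - t0 (c t + d)] and [(a t + b) - cconj t0 (c t + d)] in [(t, 1)].
    The first vanishes when [g] maps [t] to [t0], the second never does. *)
Definition tau_form (t0 : uhp) (g : SL2Z) (t : uhp) : CC := mob_den g t * (uhp_val (mobius g t) - uhp_val t0).
Definition taubar_form (t0 : uhp) (g : SL2Z) (t : uhp) : CC := mob_den g t * (uhp_val (mobius g t) - cconj t0).

Section forms.
Variable t0 : uhp.

Lemma cabs_sub_cconj (z w : CC) : cabs (z - cconj w) ^+ 2 = cabs (z - w) ^+ 2 + 4 * Im z * Im w.
Proof. by rewrite !cabs_sqr !cReB !cImB /cconj /=; ring. Qed.

Lemma taubar_formA (g : SL2Z) t : cabs (taubar_form t0 g t) ^+ 2 = cabs (tau_form t0 g t) ^+ 2 + 4 * Im t * Im t0.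
Proof.
rewrite /tau_form /taubar_form !cabsM !exprMn cabs_sub_cconj mulrDr Im_mobius; congr (_ + _).
by field; rewrite cabs_eq0 mob_den_neq0.
Qed.

Lemma taubar_form_ge (g : SL2Z) (t : uhp) : 4 * Im t * Im t0 <= cabs (taubar_form t0 g t) ^+ 2.
Proof. by rewrite taubar_formA lerDr sqr_ge0. Qed.

Lemma taubar_form_gt0 (g : SL2Z) t : 0 < cabs (taubar_form t0 g t).
Proof.
rewrite -(@ltr_pXn2r _ 2) // ?nnegrE ?cabs_ge0 // expr0n /=; apply: lt_le_trans (taubar_form_ge g t).
by rewrite !mulr_gt0 ?uhp_Im_gt0.
Qed.

Lemma tau_form_leC (g : SL2Z) t : cabs (tau_form t0 g t) <= cabs (taubar_form t0 g t).
Proof.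
rewrite -(@ler_pXn2r _ 2) // ?nnegrE ?cabs_ge0 // taubar_formA lerDl.
by rewrite !mulr_ge0 // ltW ?uhp_Im_gt0.
Qed.

Lemma taubar_formM (g h : SL2Z) t : taubar_form t0 (g * h)%g t = taubar_form t0 g (mobius h t) * mob_den h t.
Proof. by rewrite /taubar_form mob_denM mobiusM; ring. Qed.

Definition entries_sq (g : SL2Z) : R :=
  (g 0 0)%:~R ^+ 2 + (g 0 1)%:~R ^+ 2 + (g 1 0)%:~R ^+ 2 + (g 1 1)%:~R ^+ 2.

Lemma lin_bound (X e : R) : 0 < e -> exists2 K : R, 0 < K & forall (t : CC) (p q : R),
  `|Re t| <= X -> e <= Im t -> p ^+ 2 + q ^+ 2 <= K * cabs (p%:C * t + q%:C) ^+ 2.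
Proof.
move=> e0; have e2 : 0 < e ^+ 2 by rewrite exprn_gt0.
exists ((1 + 2 * X ^+ 2) / e ^+ 2 + 2).
  by rewrite ltr_wpDl // divr_ge0 // ?(ltW e2) // addr_ge0 // mulr_ge0 // sqr_ge0.
move=> [x y] p q; rewrite cabs_sqr /= => hx hy.
rewrite !mul0r subr0 !addr0.
set n := (X in _ <= _ * X).
have h1 : p ^+ 2 * e ^+ 2 <= n.
  have : e ^+ 2 <= y ^+ 2 by rewrite ler_pXn2r ?nnegrE //; lra.
  move=> /(ler_wpM2l (sqr_ge0 p)) h; apply: le_trans h _.
  by rewrite /n -exprMn lerDr sqr_ge0.
have h2 : p ^+ 2 <= n / e ^+ 2 by rewrite ler_pdivlMr.
have h3 : q ^+ 2 <= 2 * n + 2 * X ^+ 2 * (n / e ^+ 2).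
  have a1 : x ^+ 2 <= X ^+ 2.
    by rewrite -(real_normK (num_real x)) ler_pXn2r ?nnegrE //; apply: le_trans hx.
  have a2 : p ^+ 2 * x ^+ 2 <= n / e ^+ 2 * X ^+ 2 by apply: ler_pM; rewrite ?sqr_ge0.
  have a3 : (p * x + q) ^+ 2 <= n by rewrite /n lerDl sqr_ge0.
  have a4 : q ^+ 2 <= 2 * (p * x + q) ^+ 2 + 2 * (p ^+ 2 * x ^+ 2).
    rewrite -subr_ge0; have -> : 2 * (p * x + q) ^+ 2 + 2 * (p ^+ 2 * x ^+ 2) - q ^+ 2 = (2 * (p * x) + q) ^+ 2 by ring.
    exact: sqr_ge0.
  lra.
have -> : ((1 + 2 * X ^+ 2) / e ^+ 2 + 2) * n = n / e ^+ 2 + (2 * n + 2 * X ^+ 2 * (n / e ^+ 2)) by ring.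
exact: lerD.
Qed.

(** By the parallelogram law [taubar_form] bounds [(a t + b) - Re t0 (c t + d)] and
    [c t + d]. Both have real coefficients, so [lin_bound] recovers the
    coefficients from the values, with a constant uniform over the strip. *)
Lemma entries_sq_bound (X e : R) : 0 < e -> exists2 K : R, 0 < K & forall (g : SL2Z) (t : uhp),
  `|Re t| <= X -> e <= Im t -> entries_sq g <= K * cabs (taubar_form t0 g t) ^+ 2.
Proof.
move=> /(lin_bound X)[K K0 hK].
have y0 := uhp_Im_gt0 t0.
pose x0 := Re t0.
exists (2 * K + (2 * x0 ^+ 2 + 1) * K / Im t0 ^+ 2).
  rewrite ltr_wpDr ?mulr_gt0 // divr_ge0 ?sqr_ge0 // mulr_ge0 ?(ltW K0) //.
  by rewrite addr_ge0 // mulr_ge0 // sqr_ge0.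
move=> g t hx hy.
pose a : R := (g 0 0)%:~R; pose b : R := (g 0 1)%:~R.
pose c : R := (g 1 0)%:~R; pose d : R := (g 1 1)%:~R.
have EX : mob_num g t = a%:C * t + b%:C by rewrite /mob_num !intCE.
have EY : mob_den g t = c%:C * t + d%:C by rewrite /mob_den !intCE.
have h1 := hK t (a - x0 * c) (b - x0 * d) hx hy.
have h2 := hK t c d hx hy.
have eC : taubar_form t0 g t = mob_num g t - cconj t0 * mob_den g t.
  by rewrite /taubar_form mulrBr mulrC mobiusE [_ * cconj _]mulrC.
have eA : tau_form t0 g t = mob_num g t - uhp_val t0 * mob_den g t.
  by rewrite /tau_form mulrBr mulrC mobiusE [_ * uhp_val t0]mulrC.
have eB : (a - x0 * c)%:C * t + (b - x0 * d)%:C = mob_num g t - x0%:C * mob_den g t.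
  by rewrite EX EY !rmorphB !rmorphM /=; ring.
rewrite eB in h1; rewrite -EY in h2.
have par : cabs (taubar_form t0 g t) ^+ 2 + cabs (tau_form t0 g t) ^+ 2 =
   2 * (cabs (mob_num g t - x0%:C * mob_den g t) ^+ 2 + Im t0 ^+ 2 * cabs (mob_den g t) ^+ 2).
  rewrite eC eA /x0 /cconj; case: (mob_num g t) => u1 u2; case: (mob_den g t) => v1 v2.
  by case: (uhp_val t0) => p q; rewrite !cabs_sqr /=; ring.
have leAC : cabs (tau_form t0 g t) ^+ 2 <= cabs (taubar_form t0 g t) ^+ 2.
  by rewrite taubar_formA lerDl !mulr_ge0 // ltW ?uhp_Im_gt0.
set P := cabs (mob_num g t - x0%:C * mob_den g t) ^+ 2 in h1 par.
set Q := cabs (mob_den g t) ^+ 2 in h2 par.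
set n := cabs (taubar_form t0 g t) ^+ 2 in par leAC *.
have hPQ : P + Im t0 ^+ 2 * Q <= n by lra.
have P0 : 0 <= P by exact: sqr_ge0.
have Q0 : 0 <= Q by exact: sqr_ge0.
have hP : P <= n by have := mulr_ge0 (sqr_ge0 (Im t0)) Q0; lra.
have hQ : Q <= n / Im t0 ^+ 2 by rewrite ler_pdivlMr ?exprn_gt0 // mulrC; lra.
have ab : a ^+ 2 + b ^+ 2 <= 2 * ((a - x0 * c) ^+ 2 + (b - x0 * d) ^+ 2) + 2 * x0 ^+ 2 * (c ^+ 2 + d ^+ 2).
  rewrite -subr_ge0.
  have -> : 2 * ((a - x0 * c) ^+ 2 + (b - x0 * d) ^+ 2) + 2 * x0 ^+ 2 * (c ^+ 2 + d ^+ 2) - (a ^+ 2 + b ^+ 2)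
    = (a - 2 * (x0 * c)) ^+ 2 + (b - 2 * (x0 * d)) ^+ 2 by ring.
  by rewrite addr_ge0 ?sqr_ge0.
have -> : entries_sq g = (a ^+ 2 + b ^+ 2) + (c ^+ 2 + d ^+ 2) by rewrite /entries_sq; ring.
have k1 : (a - x0 * c) ^+ 2 + (b - x0 * d) ^+ 2 <= K * n.
  by apply: le_trans h1 _; rewrite ler_pM2l.
have k2 : c ^+ 2 + d ^+ 2 <= K * (n / Im t0 ^+ 2).
  by apply: le_trans h2 _; rewrite ler_pM2l.
have k3 := ler_wpM2l (_ : 0 <= 2 * x0 ^+ 2 + 1) k2.
have := k3 ltac:(by rewrite addr_ge0 // mulr_ge0 // sqr_ge0).
have -> : (2 * K + (2 * x0 ^+ 2 + 1) * K / Im t0 ^+ 2) * n = 2 * (K * n) + (2 * x0 ^+ 2 + 1) *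
  (K * (n / Im t0 ^+ 2)) by ring.
lra.
Qed.
End forms.

Definition int_weight (n : int) : R := (1 + n%:~R ^+ 2)^-1.

Lemma int_weight_ge0 n : 0 <= int_weight n. Proof. by rewrite invr_ge0 addr_ge0 ?sqr_ge0. Qed.

Lemma sums_le_prod (I J : eqType) (M : I -> R) (N : J -> R) B C :
  (forall i, 0 <= M i) -> (forall j, 0 <= N j) -> 0 <= B ->
  sums_le M B -> sums_le N C -> sums_le (fun ij : I * J => M ij.1 * N ij.2) (B * C).
Proof.
move=> M0 N0 B0 hM hN s us.
pose s1 := undup (map fst s); pose s2 := undup (map snd s).
have u12 : uniq [seq (i, j) | i <- s1, j <- s2].
  by apply: allpairs_uniq; rewrite ?undup_uniq // => -[? ?] [? ?] _ _ [-> ->].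
apply: (@le_trans _ _ (\sum_(ij <- [seq (i, j) | i <- s1, j <- s2]) M ij.1 * N ij.2)).
  apply: sums_le_sub => //; first by move=> ij; rewrite mulr_ge0.
  by move=> [i j] hs; apply/allpairsP; exists (i, j); split => //=;
     rewrite mem_undup; apply/mapP; exists (i, j).
rewrite big_allpairs /=.
under eq_bigr do rewrite -mulr_sumr.
rewrite -mulr_suml; apply: ler_pM; rewrite ?sumr_ge0 ?hM ?hN ?undup_uniq //.
Qed.

Lemma sums_le_inj (I J : eqType) (f : J -> I) M B : injective f -> sums_le M B -> sums_le (M \o f) B.
Proof. by move=> fi h s us; have := h (map f s); rewrite big_map map_inj_uniq //; apply. Qed.

(** Telescoping of [1 / (1 + m ^+ 2) <= 2 / m - 2 / (m + 1)]. *)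
Lemma int_weight_sum_nat n : \sum_(0 <= i < n.+1) int_weight i%:Z <= 3 - 2 / n.+1%:R.
Proof.
elim: n => [|n IH]; first by rewrite big_nat1 /int_weight expr0n addr0 invr1; lra.
rewrite big_nat_recr //=; apply: le_trans (lerD IH (lexx _)) _.
rewrite /int_weight; set m : R := n.+1%:R.
have m0 : 0 < m by rewrite ltr0n.
have -> : (n.+2%:R : R) = m + 1 by rewrite -[in LHS]addn1 natrD.
have -> : (n.+1%:Z%:~R : R) = m by [].
have h : (1 + m ^+ 2)^-1 <= 2 / (m * (m + 1)).
  rewrite -[leRHS]invrK lef_pV2 ?posrE; last 2 first.
  - by rewrite ltr_wpDr ?sqr_ge0.
  - by rewrite invr_gt0 divr_gt0 // mulr_gt0 // ltr_wpDr.
  rewrite invf_div ler_pdivrMr //; have := sqr_ge0 (m - 1); rewrite !expr2; nra.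
have -> : 3 - 2 / (m + 1) = 3 - 2 / m + 2 / (m * (m + 1)) by field; lra.
by rewrite lerD2l.
Qed.

Lemma int_weight_sum : sums_le int_weight 6.
Proof.
move=> s us.
pose n := (\max_(i <- s) absz i)%N.
pose t := [seq i%:Z | i <- index_iota 0 n.+1] ++ [seq - (i.+1%:Z) | i <- index_iota 0 n].
have ut : uniq t.
  rewrite cat_uniq !map_inj_uniq ?iota_uniq //=; last 2 first.
  - by move=> i j /oppr_inj [].
  - by move=> i j [].
  by rewrite andbT; apply/hasPn => _ /mapP[i _ ->]; apply/mapP => -[j _].
have st : {subset s <= t}.
  move=> i hi; have ni : (absz i <= n)%N by rewrite /n; exact: leq_bigmax_seq.
  rewrite mem_cat; case: i ni hi => i ni hi; apply/orP.
    by left; apply: map_f; rewrite mem_index_iota.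
  by right; rewrite NegzE; apply: (map_f (fun i => - i.+1%:Z)); rewrite mem_index_iota.
apply: le_trans (sums_le_sub int_weight_ge0 us ut st) _.
rewrite big_cat !big_map /=.
have h : \sum_(0 <= i < n.+1) int_weight i%:Z <= 3.
  by apply: le_trans (int_weight_sum_nat n) _; rewrite lerBlDr lerDl divr_ge0.
have h' : \sum_(0 <= i < n) int_weight (- i.+1%:Z) <= 3.
  apply: le_trans h; rewrite big_nat_recl //= -[leLHS]add0r lerD ?int_weight_ge0 //.
  by apply: ler_sum => i _; rewrite /int_weight rmorphN sqrrN.
lra.
Qed.

Definition entry_weight (g : SL2Z) : R :=
  int_weight (g 0 0) * int_weight (g 0 1) * (int_weight (g 1 0) * int_weight (g 1 1)).

Lemma entry_weight_ge0 g : 0 <= entry_weight g. Proof. by rewrite !mulr_ge0 ?int_weight_ge0. Qed.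

(** Over all quadruples of integers, of any determinant, the sum is a product of
    four sums over [int]. *)
Lemma entry_weight_sum : exists B, sums_le entry_weight B.
Proof.
have h2 := sums_le_prod int_weight_ge0 int_weight_ge0 (ler0n _ 6) int_weight_sum int_weight_sum.
have w0 (p : int * int) : 0 <= int_weight p.1 * int_weight p.2 by rewrite mulr_ge0 ?int_weight_ge0.
have h4 := sums_le_prod w0 w0 (mulr_ge0 (ler0n _ 6) (ler0n _ 6)) h2 h2.
pose f (g : SL2Z) := ((g 0 0, g 0 1), (g 1 0, g 1 1)).
exists (6 * 6 * (6 * 6)); apply: (@sums_le_inj _ _ f _ _ _ h4).
move=> g h [e1 e2 e3 e4]; apply: val_inj; apply/matrixP => i j.
have ord2 (k : 'I_2) : k = 0 \/ k = 1.
  by case: k => [[|[|//]]] kk; [left|right]; apply: val_inj.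
by case: (ord2 i) => ->; case: (ord2 j) => ->.
Qed.

Section bounds.
Variable t0 : uhp.
Let y0 := Im t0.

Lemma entries_sq1_bound (X e : R) : 0 < e -> exists2 K : R, 0 < K & forall (g : SL2Z) (t : uhp),
  `|Re t| <= X -> e <= Im t -> 1 + entries_sq g <= K * cabs (taubar_form t0 g t) ^+ 2.
Proof.
move=> e0; have [K K0 hK] := entries_sq_bound t0 X e0.
have y0' := uhp_Im_gt0 t0.
have c0 : 0 < 4 * e * Im t0 by rewrite !mulr_gt0.
exists ((4 * e * Im t0)^-1 + K) => [|g t hx hy]; first by rewrite addr_gt0 ?invr_gt0.
rewrite mulrDl lerD ?hK // mulrC ler_pdivlMr // mul1r; apply: le_trans (taubar_form_ge t0 g t).
by rewrite ler_pM2r // ler_pM2l.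
Qed.

Lemma entry_weight_entry g : (entry_weight g)^-1 <= (1 + entries_sq g) ^+ 4.
Proof.
rewrite /entry_weight /int_weight !invfM !invrK.
have h (x : R) : 0 <= 1 + x ^+ 2 by rewrite addr_ge0 ?sqr_ge0.
rewrite (_ : (1 + entries_sq g) ^+ 4 =
  ((1 + entries_sq g) * (1 + entries_sq g)) * ((1 + entries_sq g) * (1 + entries_sq g))); last by ring.
have s0 := sqr_ge0 ((g 0 0)%:~R : R); have s1 := sqr_ge0 ((g 0 1)%:~R : R).
have s2 := sqr_ge0 ((g 1 0)%:~R : R); have s3 := sqr_ge0 ((g 1 1)%:~R : R).
by apply: ler_pM; rewrite ?mulr_ge0 ?h //; apply: ler_pM; rewrite ?h // /entries_sq; lra.
Qed.

Lemma entry_weight_gt0 g : 0 < entry_weight g.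
Proof. by rewrite !mulr_gt0 // invr_gt0 ltr_wpDr ?sqr_ge0. Qed.

Lemma entries_sq_ge0 g : 0 <= entries_sq g.
Proof. by rewrite !addr_ge0 ?sqr_ge0. Qed.

Lemma entries_sq1_ge0 g : 0 <= 1 + entries_sq g.
Proof. by apply: addr_ge0 => //; exact: entries_sq_ge0. Qed.

Lemma taubar_form_sum_bound (X e : R) : 0 < e -> exists2 K : R, 0 < K & forall (g : SL2Z) (t : uhp),
  `|Re t| <= X -> e <= Im t -> (cabs (taubar_form t0 g t) ^+ 8)^-1 <= K * entry_weight g.
Proof.
move=> /(entries_sq1_bound X)[K K0 hK]; exists (K ^+ 4) => [|g t hx hy]; first by rewrite exprn_gt0.
have n0 : 0 < cabs (taubar_form t0 g t) ^+ 8 by rewrite exprn_gt0 ?taubar_form_gt0.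
rewrite -(ler_pM2r n0) mulVf ?gt_eqF // mulrAC -ler_pdivrMr ?entry_weight_gt0 // mul1r.
apply: le_trans (entry_weight_entry g) _.
have -> : K ^+ 4 * cabs (taubar_form t0 g t) ^+ 8 = (K * cabs (taubar_form t0 g t) ^+ 2) ^+ 4 by ring.
rewrite ler_pXn2r ?nnegrE ?hK ?entries_sq1_ge0 //.
by rewrite mulr_ge0 ?sqr_ge0 ?ltW.
Qed.

Lemma taubar_form_large (X e c : R) : 0 < e -> exists s : seq SL2Z, forall (g : SL2Z) (t : uhp),
  g \notin s -> `|Re t| <= X -> e <= Im t -> c <= cabs (taubar_form t0 g t).
Proof.
move=> /(entries_sq1_bound X)[K K0 hK].
pose T := K * c ^+ 2; have T0 : 0 <= T by rewrite mulr_ge0 ?sqr_ge0 ?ltW.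
have [B hB] := entry_weight_sum.
have e0 : 0 < ((1 + T) ^+ 4)^-1 by rewrite invr_gt0 exprn_gt0 // ltr_wpDr.
have [s _ hs] := sums_tail entry_weight_ge0 hB e0.
exists s => g t gs hx hy.
have : entry_weight g <= ((1 + T) ^+ 4)^-1.
  by have := hs [:: g] isT; rewrite big_seq1; apply => i; rewrite inE => /eqP ->.
rewrite -[leLHS]invrK lef_pV2 ?posrE ?invr_gt0 ?entry_weight_gt0 ?exprn_gt0 //; last by rewrite ltr_wpDr.
move=> /le_trans/(_ (entry_weight_entry g)).
rewrite ler_pXn2r ?nnegrE ?entries_sq1_ge0 ?(addr_ge0 _ T0) // => h.
have k := hK g t hx hy.
have : K * c ^+ 2 <= K * cabs (taubar_form t0 g t) ^+ 2 by rewrite -/T; lra.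
rewrite ler_pM2l // => h'.
have [c0|/ltW c0] := lerP 0 c; last exact: le_trans c0 (cabs_ge0 _).
by rewrite -(@ler_pXn2r _ 2) ?nnegrE ?cabs_ge0.
Qed.

(** Since the squared moduli of the two forms differ by [4 * Im t * Im t0], this
    follows from [taubar_form_large] when [Im t] is bounded. *)
Lemma tau_form_large (X e Y : R) : 0 < e -> exists s : seq SL2Z, forall (g : SL2Z) (t : uhp),
  g \notin s -> `|Re t| <= X -> e <= Im t -> Im t <= Y -> 1 <= cabs (tau_form t0 g t).
Proof.
move=> e0; have y0' := uhp_Im_gt0 t0.
pose c := Num.sqrt (1 + 4 * `|Y| * y0).
have [s hs] := taubar_form_large X c e0; exists s => g t gs hx hy hY.
have C0 : 0 <= 1 + 4 * `|Y| * y0 by rewrite addr_ge0 // !mulr_ge0 // ltW.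
have h := hs g t gs hx hy.
have : c ^+ 2 <= cabs (taubar_form t0 g t) ^+ 2 by rewrite ler_pXn2r ?nnegrE ?cabs_ge0 ?sqrtr_ge0.
rewrite sqr_sqrtr // taubar_formA -/y0 => k.
have : 4 * Im t * y0 <= 4 * `|Y| * y0.
  by rewrite ler_pM2r // ler_pM2l //; apply: le_trans hY (ler_norm _).
move=> k'; have : 1 ^+ 2 <= cabs (tau_form t0 g t) ^+ 2 by rewrite expr1n; lra.
by rewrite ler_pXn2r ?nnegrE ?cabs_ge0.
Qed.

(** High up in the half-plane no image of [t] comes near [t0]: if [c != 0] then
    [Im (g t) <= 1 / Im t], and if [c = 0] then [Im (g t) = Im t]. *)
Lemma tau_form_cusp : exists y1 : R, forall (g : SL2Z) (t : uhp), y1 <= Im t -> 1 <= cabs (tau_form t0 g t).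
Proof.
have y0' : 0 < y0 := uhp_Im_gt0 t0.
exists (2 / y0 + y0 + 1) => g t ht.
have t0' : 0 < 2 / y0 by rewrite divr_gt0.
have j0 : 0 < cabs (mob_den g t) by rewrite cabs_gt0 mob_den_neq0.
set j := cabs (mob_den g t) in j0.
have im : `|Im t / j - j * y0| <= cabs (tau_form t0 g t).
  rewrite /tau_form cabsM -/j.
  have -> : Im t / j - j * y0 = j * (Im (mobius g t) - y0).
    by rewrite Im_mobius -/j; field; rewrite gt_eqF.
  by rewrite normrM gtr0_norm // ler_pM2l // -cImB Im_le_cabs.
apply: le_trans im.
have [c0|c0] := eqVneq (g 1 0) 0.
  have j1 : j = 1.
    have dd : (g 1 1)%:~R ^+ 2 = 1 :> R.
      have := det_SL2Z g; rewrite det2 c0 mulr0 subr0 => ad.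
      have : (g 1 1) ^+ 2 = 1.
        have : (g 1 1 \is a GRing.unit) by apply/unitrP; exists (g 0 0); rewrite ad mulrC ad.
        by rewrite qualifE /= => /orP[/eqP -> | /eqP ->].
      by rewrite -rmorphXn /= => ->.
    apply/eqP; rewrite -(@eqrXn2 _ 2) // ?ltW // expr1n /j /mob_den c0 mul0r add0r intCE cabs_real.
    by rewrite real_normK ?num_real // dd.
  by rewrite j1 divr1 mul1r; apply: le_trans (ler_norm _); lra.
have jt : Im t <= j.
  apply: le_trans (Im_le_cabs _); rewrite /mob_den !intCE cImD cImM /= mul0r !addr0.
  rewrite normrM (ger0_norm (ltW (uhp_Im_gt0 t))) ler_peMl ?(ltW (uhp_Im_gt0 t)) //.
  by rewrite -intr_norm (_ : 1 = 1%:~R) // ler_int -gtz0_ge1 normr_gt0.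
rewrite distrC; apply: le_trans (ler_norm _).
have h1 : Im t / j <= 1 by rewrite ler_pdivrMr ?mul1r.
have h2 : (2 / y0 + y0) * y0 <= j * y0 by rewrite ler_pM2r //; lra.
have : 2 / y0 * y0 = 2 by rewrite divfK ?gt_eqF.
have := mulr_gt0 y0' y0'.
rewrite mulrDl in h2; lra.
Qed.

Fact matT_det (m : int) : 1 * 1 - m * 0 == 1 :> int.
Proof. by rewrite mulr0 subr0 mulr1. Qed.
Definition matT (m : int) : SL2Z := SL2Z_of (matT_det m).

Lemma mob_denT m t : mob_den (matT m) t = 1.
Proof. by rewrite /mob_den !mxE /= mul0r add0r. Qed.

Lemma mobiusT m t : uhp_val (mobius (matT m) t) = uhp_val t + (m%:~R)%:C.
Proof. by rewrite -[LHS]mulr1 -(mob_denT m t) mobiusE /mob_num !mxE /= mul1r intCE. Qed.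

(** The bound is uniform in [Re t], as boundedness at the cusp requires: translating
    [t] permutes the terms of the sum, which reduces to [`|Re t| <= 1]. Translating
    the form instead would not do, because the powers of [rho (matT 1)] may be
    unbounded. *)
Lemma taubar_form_cusp_sum : exists B : R, forall t : uhp, 1 <= Im t ->
  sums_le (fun g => (cabs (taubar_form t0 g t) ^+ 8)^-1) B.
Proof.
have [K K0 hK] := taubar_form_sum_bound 1 ltr01.
have [B hB] := entry_weight_sum.
exists (K * B) => t ht.
pose m : int := - Num.floor (Re t).
have T1 : `|Re (mobius (matT m) t)| <= 1.
  rewrite mobiusT cReD /= /m rmorphN /=.
  have := floor_itv (Re t); move=> /andP[h1 h2].
  by rewrite intrD /= in h2; rewrite ler_norml; lra.
have T2 : 1 <= Im (mobius (matT m) t) by rewrite mobiusT cImD /= addr0.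
have h : sums_le (fun g => (cabs (taubar_form t0 g (mobius (matT m) t)) ^+ 8)^-1) (K * B).
  by apply: sums_le_le (sums_leZ (ltW K0) hB) => g; exact: hK.
have := sums_le_inj (@mulIg _ (matT m)^-1%g) h.
apply: sums_le_le => g /=.
have e : g = ((g * (matT m)^-1) * matT m)%g by rewrite -mulgA mulVg mulg1.
by rewrite {1}e taubar_formM mob_denT mulr1.
Qed.
End bounds.

(** * Poincare series *)

Lemma extend0E (f : uhp -> CC) (t : uhp) : extend0 f t = f t.
Proof. by rewrite /extend0 valK. Qed.

Lemma uhp_open (t : uhp) (z : CC) : cabs (z - uhp_val t) < Im t -> exists t' : uhp, uhp_val t' = z.
Proof.
move=> h; have z0 : 0 < Im z.
  have := le_lt_trans (Im_le_cabs _) h; rewrite cImB ltr_norml; lra.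
by exists (MkUhp z0).
Qed.

Lemma holoM (f g : uhp -> CC) : holomorphic f -> holomorphic g -> holomorphic (fun t => f t * g t).
Proof.
move=> hf hg t; have -> : extend0 (fun t => f t * g t) = (fun z => extend0 f z * extend0 g z).
  by apply/funext => z; rewrite /extend0; case: insub => //; rewrite mulr0.
exact: derM.
Qed.

Lemma holoD (f g : uhp -> CC) : holomorphic f -> holomorphic g -> holomorphic (fun t => f t + g t).
Proof.
move=> hf hg t; have -> : extend0 (fun t => f t + g t) = (fun z => extend0 f z + extend0 g z).
  by apply/funext => z; rewrite /extend0; case: insub => //; rewrite addr0.
exact: derD.
Qed.

Lemma holo_fun (h : CC -> CC) : (forall t : uhp, derC h t) -> holomorphic (fun t => h t).
Proof.
move=> dh t; apply: near_eq_derC (dh t); exists (Im t); first exact: uhp_Im_gt0.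
by move=> z /uhp_open[t' <-]; rewrite extend0E.
Qed.

Lemma extend0_sum (I : Type) (r : seq I) (f : I -> uhp -> CC) :
  extend0 (fun t => \sum_(i <- r) f i t) = fun z => \sum_(i <- r) extend0 (f i) z.
Proof.
by apply/funext => z; rewrite /extend0; case: insub => //; rewrite big1.
Qed.

Lemma extend0_mul (c : CC) (f : uhp -> CC) :
  extend0 (fun t => c * f t) = fun z => c * extend0 f z.
Proof. by apply/funext => z; rewrite /extend0; case: insub => //; rewrite mulr0. Qed.

Lemma holo_sum (I : Type) (r : seq I) (f : I -> uhp -> CC) :
  (forall i, holomorphic (f i)) -> holomorphic (fun t => \sum_(i <- r) f i t).
Proof.
move=> hf; elim: r => [|i r IH].
  under eq_fun do rewrite big_nil; by apply: (@holo_fun (fun=> 0)) => t; exact: der_cst.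
under eq_fun do rewrite big_cons.
exact: (holoD (hf i) IH).
Qed.

Lemma mob_den_der g (z : CC) : derC (mob_den g) z.
Proof. by apply: derD; [apply: derM; [exact: der_cst|exact: der_id]|exact: der_cst]. Qed.
Lemma mob_num_der g (z : CC) : derC (mob_num g) z.
Proof. by apply: derD; [apply: derM; [exact: der_cst|exact: der_id]|exact: der_cst]. Qed.

Lemma holo_mobius (f : uhp -> CC) g : holomorphic f -> holomorphic (fun t => f (mobius g t)).
Proof.
move=> hf t.
apply: (@near_eq_derC (fun z => extend0 f (mob_num g z / mob_den g z))).
  exists (Im t); first exact: uhp_Im_gt0.
  move=> z /uhp_open[t' <-]; rewrite extend0E.
  by have -> : mob_num g t' / mob_den g t' = mobius g t' by []; rewrite extend0E.
apply: der_comp; last exact: (hf (mobius g t)).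
apply: derM; first exact: mob_num_der.
by apply: derV; [exact: mob_den_neq0|exact: mob_den_der].
Qed.

Lemma holo_den g (n : int) : holomorphic (fun t => mob_den g t ^ n).
Proof.
apply: (@holo_fun (fun z => mob_den g z ^ n)) => t.
by apply: derX_z; [exact: mob_den_neq0|exact: mob_den_der].
Qed.

Section vect.
Variable V : vectType CC.
Let n := \dim (fullv : {vspace V}).
Let b := vbasis (fullv : {vspace V}).
Definition vcoord (j : 'I_n) : 'Hom(V, CC^o) := linfun (coord b j : V -> CC^o).

Lemma vcoordE j v : vcoord j v = coord b j v. Proof. by rewrite lfunE. Qed.
Lemma vcoord_dec v : v = \sum_j vcoord j v *: b`_j.
Proof. by rewrite [LHS](coord_vbasis (memvf v)); apply: eq_bigr => j _; rewrite vcoordE. Qed.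

Lemma functional_ext (v w : V) : (forall psi : 'Hom(V, CC^o), psi v = psi w) -> v = w.
Proof. by move=> h; rewrite (vcoord_dec v) (vcoord_dec w); apply: eq_bigr => j _; rewrite h. Qed.

Lemma functionalE (psi : 'Hom(V, CC^o)) v : psi v = \sum_(j < n) psi b`_j * vcoord j v.
Proof.
rewrite [v in LHS]vcoord_dec linear_sum; apply: eq_bigr => j _.
by rewrite linearZ /= mulrC.
Qed.

Lemma vhas_sum_exists (I : eqType) (u : I -> V) :
  (forall psi : 'Hom(V, CC^o), exists S, has_sum (fun i => psi (u i)) S) ->
  exists S : V, forall psi : 'Hom(V, CC^o), has_sum (fun i => psi (u i)) (psi S).
Proof.
move=> h; have [S hS] := choice (fun j => h (vcoord j)).
exists (\sum_j S j *: b`_j) => psi.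
rewrite linear_sum; have := has_sum_sum (index_enum 'I_n) (fun j => has_sumZ (psi b`_j) (hS j)).
have -> : \sum_(j <- index_enum 'I_n) psi b`_j * S j = \sum_j psi (S j *: b`_j).
  by apply: eq_bigr => j _; rewrite linearZ /= mulrC.
by apply: eq_has_sum => i; rewrite -functionalE.
Qed.

Variables (rho : SL2Z -> 'End(V)) (t0 : uhp) (W : int) (Psi : uhp -> V).
Hypothesis rho_rep : representation rho.
Hypothesis Psi_holo : vholomorphic Psi.

Lemma rhoM g h v : rho (g * h)%g v = rho g (rho h v).
Proof. by case: rho_rep => _ ->; rewrite lfunE. Qed.
Lemma rho1 v : rho 1%g v = v.
Proof. by case: rho_rep => -> _; rewrite lfunE. Qed.

(** The image of [Psi] under [g] in the action of weight [W] twisted by [rho]. *)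
Definition slash_term (g : SL2Z) (t : uhp) : V :=
  mob_den g t ^ (- W) *: rho g^-1%g (Psi (mobius g t)).

Hypothesis loc : forall (psi : 'Hom(V, CC^o)) (t : uhp), exists (r : R) (s : seq SL2Z) (B : R),
  0 < r /\ forall g (t' : uhp), cabs (uhp_val t' - uhp_val t) < r -> g \notin s ->
  cabs (psi (slash_term g t')) <= B * (cabs (taubar_form t0 g t') ^+ 8)^-1.
Hypothesis cusp : forall (psi : 'Hom(V, CC^o)), exists (y1 B : R),
  forall g t, y1 <= Im (uhp_val t) -> cabs (psi (slash_term g t)) <= B * (cabs (taubar_form t0 g t) ^+ 8)^-1.

Lemma slash_term_slash g h t : slash_term g (mobius h t) = mob_den h t ^ W *: rho h (slash_term (g * h)%g t).
Proof.
rewrite /slash_term linearZ /= scalerA -rhoM mobiusM invgM mulgA mulgV mul1g; congr (_ *: _).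
rewrite mob_denM expfzMl mulrCA -expfzDr ?mob_den_neq0 // subrr expr0z mulr1 //.
Qed.

Lemma slash_term_holo (psi : 'Hom(V, CC^o)) g : holomorphic (fun t => psi (slash_term g t)).
Proof.
have -> : (fun t => psi (slash_term g t)) =
    (fun t => mob_den g t ^ (- W) * (psi \o rho g^-1%g)%VF (Psi (mobius g t))).
  by apply/funext => t; rewrite linearZ /= comp_lfunE.
apply: holoM; first exact: holo_den.
exact: (@holo_mobius (fun t => (psi \o rho g^-1%g)%VF (Psi t))).
Qed.

Lemma slash_term_dominated (psi : 'Hom(V, CC^o)) (t : uhp) : exists (r : R) (s : seq SL2Z) (M : SL2Z -> R) (B : R),
  [/\ 0 < r, r <= Im t, forall g, 0 <= M g, sums_le M B &
   forall g (t' : uhp), cabs (uhp_val t' - uhp_val t) < r -> g \notin s -> cabs (psi (slash_term g t')) <= M g].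
Proof.
have it0 := uhp_Im_gt0 t.
pose e := Im t / 2; have e0 : 0 < e by rewrite divr_gt0.
pose X := `|Re t| + 1.
have [r [s [B [r0 hB]]]] := loc psi t.
have [K K0 hK] := taubar_form_sum_bound t0 X e0.
have [C hC] := entry_weight_sum.
exists (Num.min r (Num.min e 1)), s, (fun g => `|B| * K * entry_weight g), (`|B| * K * C); split.
- by rewrite !lt_min r0 e0 ltr01.
- by rewrite !ge_min; apply/orP; right; apply/orP; left; rewrite /e; lra.
- by move=> g; apply: mulr_ge0 (entry_weight_ge0 g); rewrite mulr_ge0 // ltW.
- by apply: sums_leZ => //; rewrite mulr_ge0 // ltW.
move=> g t'; rewrite !lt_min => /andP[hr /andP[h1 h2]] gs.
have a1 := Re_le_cabs (uhp_val t' - uhp_val t); have a2 := Im_le_cabs (uhp_val t' - uhp_val t).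
rewrite cReB in a1; rewrite cImB in a2.
have rX : `|Re t'| <= X.
  by rewrite -[Re t'](subrK (Re t)) (le_trans (ler_normD _ _)) // /X; lra.
have := le_trans a2 (ltW h1); rewrite ler_norml => a3.
have ie : e <= Im t' by rewrite /e in a3 *; lra.
apply: le_trans (hB g t' hr gs) _; rewrite -mulrA.
have k := hK g t' rX ie.
apply: (@le_trans _ _ (`|B| * (cabs (taubar_form t0 g t') ^+ 8)^-1)).
  by rewrite ler_wpM2r ?ler_norm // invr_ge0 exprn_ge0 // cabs_ge0.
by rewrite ler_wpM2l.
Qed.

(** The sum of the images of [Psi] is modular, because [slash_term_slash] turns the
    action of [h] into a right translation of the index [g]. The last clause gives
    derivatives term by term. *)
Lemma poincare_series : exists H : uhp -> V, [/\ hol_vvmf rho W H,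
  forall (psi : 'Hom(V, CC^o)) t, has_sum (fun g => psi (slash_term g t)) (psi (H t)) &
  forall (psi : 'Hom(V, CC^o)) (t : uhp), exists L D,
   [/\ forall g, is_derive (uhp_val t : CC^o) 1 (extend0 (fun t => psi (slash_term g t)) : CC^o -> CC^o) (L g),
    has_sum L D & is_derive (uhp_val t : CC^o) 1 (extend0 (fun t => psi (H t)) : CC^o -> CC^o) D]].
Proof.
have ex t : exists S : V, forall psi : 'Hom(V, CC^o), has_sum (fun g => psi (slash_term g t)) (psi S).
  apply: vhas_sum_exists => psi.
  have [r [s [M [B [r0 _ M0 MB hM]]]]] := slash_term_dominated psi t.
  pose N g := (if g \in s then cabs (psi (slash_term g t)) else 0) + M g.
  apply: (@has_sum_exists _ _ N (\sum_(g <- undup s) cabs (psi (slash_term g t)) + B)).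
    move=> g; rewrite /N; case: ifPn => gs; first by rewrite lerDl.
    by rewrite add0r hM // subrr cabs0.
  move=> l ul; rewrite /N big_split lerD ?MB //= -big_mkcond /= -big_filter.
  apply: sums_le_sub; rewrite ?undup_uniq ?filter_uniq //; first by move=> g; exact: cabs_ge0.
  by move=> g; rewrite mem_filter mem_undup => /andP[].
have [H hH] := choice ex.
have der (psi : 'Hom(V, CC^o)) (t : uhp) : exists L D,
   [/\ forall g, is_derive (uhp_val t : CC^o) 1 (extend0 (fun t => psi (slash_term g t)) : CC^o -> CC^o) (L g),
    has_sum L D & is_derive (uhp_val t : CC^o) 1 (extend0 (fun t => psi (H t)) : CC^o -> CC^o) D].
  have [r [s [M [B [r0 rt M0 MB hM]]]]] := slash_term_dominated psi t.
  have inU z : cabs (z - uhp_val t) < r -> exists t' : uhp, uhp_val t' = z.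
    by move=> h; apply: (@uhp_open t); apply: lt_le_trans h rt.
  apply: (@weierstrass_sum _ (fun g => extend0 (fun t => psi (slash_term g t))) _ t r s M B) => //.
  - by move=> g z /inU[t' <-]; exact: slash_term_holo.
  - by move=> g z /[dup] /inU[t' <-] h gs; rewrite extend0E; exact: hM.
  - move=> z /inU[t' <-]; rewrite extend0E; apply: eq_has_sum (hH t' psi) => g.
    by rewrite extend0E.
exists H; split; [split; first split|by move=> psi t; exact: hH|exact: der].
- by move=> psi t; have [L [D [_ _ []]]] := der psi t.
- move=> h t; apply: functional_ext => psi.
  have h1 := hH (mobius h t) psi.
  have h2 : has_sum (fun g => psi (slash_term (g * h)%g (t))) (psi (H t)).
    have := @has_sum_reindex _ _ (fun g : SL2Z => (g * h)%g) (fun g : SL2Z => (g * h^-1)%g) _ _ _ _ (hH t psi).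
    by apply => g; rewrite -mulgA ?mulgV ?mulVg mulg1.
  have h3 : has_sum (fun g => (psi \o rho h)%VF (slash_term (g * h)%g t)) ((psi \o rho h)%VF (H t)).
    have := @has_sum_reindex _ _ (fun g : SL2Z => (g * h)%g) (fun g : SL2Z => (g * h^-1)%g)
      _ _ _ _ (hH t (psi \o rho h)%VF).
    by apply => g; rewrite -mulgA ?mulgV ?mulVg mulg1.
  rewrite linearZ /=; apply: has_sum_unique h1 _.
  have := has_sumZ (mob_den h t ^ W) h3; rewrite comp_lfunE; apply: eq_has_sum => g.
  by rewrite slash_term_slash comp_lfunE [RHS]linearZ.
- move=> psi; have [y1 [B hB]] := cusp psi; have [C hC] := taubar_form_cusp_sum t0.
  exists (Num.max y1 1), (`|B| * C) => t; rewrite gt_max => /andP[/ltW ty1 /ltW t1].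
  rewrite cabsE lecR.
  apply: has_sum_bound (hH t psi) _ (sums_leZ (normr_ge0 B) (hC t t1)) => g.
  apply: le_trans (hB g t ty1) _.
  by rewrite ler_wpM2r ?ler_norm // invr_ge0 exprn_ge0 // cabs_ge0.
Qed.
End vect.

Lemma triv_rep_rep : representation triv_rep.
Proof. by split=> // g h; rewrite comp_lfun1l. Qed.

Lemma taubar_form_powle t0 (e : R) m : 0 < e -> exists2 B : R, 0 <= B & forall g (t : uhp), e <= Im t ->
  (cabs (taubar_form t0 g t) ^+ (8 + m))^-1 <= B * (cabs (taubar_form t0 g t) ^+ 8)^-1.
Proof.
move=> e0; have y0 := uhp_Im_gt0 t0.
pose c := Num.sqrt (4 * e * Im t0).
have c4 : 0 < 4 * e * Im t0 by rewrite !mulr_gt0.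
have c0 : 0 < c by rewrite sqrtr_gt0.
exists (c ^+ m)^-1 => [|g t et]; first by rewrite invr_ge0 exprn_ge0 // ltW.
have cC : c <= cabs (taubar_form t0 g t).
  rewrite -(@ler_pXn2r _ 2) ?nnegrE ?cabs_ge0 ?(ltW c0) // sqr_sqrtr ?(ltW c4) //.
  apply: le_trans (taubar_form_ge t0 g t); by rewrite ler_pM2r // ler_pM2l.
rewrite exprD invfM mulrC ler_wpM2r ?invr_ge0 ?exprn_ge0 ?cabs_ge0 //.
by rewrite lef_pV2 ?posrE ?exprn_gt0 ?taubar_form_gt0 // lerXn2r ?nnegrE ?cabs_ge0 ?(ltW c0).
Qed.

Lemma scalar_functional (psi : 'Hom(CC^o, CC^o)) (v : CC^o) : psi v = psi (1 : CC^o) * v.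
Proof. by rewrite -{1}[v]mulr1 -[v * 1]/(v *: (1 : CC^o)) linearZ /= mulrC. Qed.

(** An exponential beats a linear factor, by Bernoulli. The exponent [2 * (6 * l + 1)]
    is [n - 9] for [n = 12 * l + 11], the residue class that
    [form_with_nonzero_derivative] needs. *)
Lemma geometric_small (q c : R) : 0 <= q < 1 ->
  exists l : nat, (12 * (6 * l + 1))%:R * q ^+ (2 * (6 * l + 1)) * c <= 1 / 2.
Proof.
move=> /andP[q0 q1].
(* Replacing [q] by a larger [p] excludes [q = 0], which has no inverse. *)
pose p := (q + 1) / 2; have p0 : 0 < p by rewrite /p; lra.
have p1 : p < 1 by rewrite /p; lra.
have qp : q <= p by rewrite /p; lra.
pose d := p^-1 - 1; have d0 : 0 < d by rewrite /d subr_gt0 invf_gt1.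
have key (m : nat) : (0 < m)%N -> p ^+ (2 * m) <= ((m%:R * d) ^+ 2)^-1.
  move=> m0; rewrite exprM exprAC -[leLHS]invrK lef_pV2 ?posrE ?invr_gt0 ?exprn_gt0 ?(mulr_gt0 _ d0) ?ltr0n ?p0 //.
  rewrite -!exprVn ler_pXn2r ?nnegrE ?exprn_ge0 ?invr_ge0 ?exprn_ge0 ?(ltW p0) ?mulr_ge0 ?(ltW d0) //.
  have -> : p^-1 = 1 + d by rewrite /d; ring.
  elim: m {m0} => [|m IH]; first by rewrite mul0r expr0.
  rewrite exprS -natr1 mulrDl mul1r mulrDl mul1r; apply: lerD => //.
  have : 1 <= (1 + d) ^+ m by rewrite exprn_ege1 // lerDl ltW.
  by rewrite -(ler_pM2l d0) mulr1.
pose l := Num.truncn (24 * `|c| / d ^+ 2).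
exists l; set m := (6 * l + 1)%N.
have m0 : (0 < m)%N by rewrite /m addn1.
have ml : 24 * `|c| / d ^+ 2 <= m%:R.
  apply: le_trans (ltW (truncnS_gt _)) _; rewrite ler_nat -/l /m addn1 ltnS.
  by rewrite leq_pmull.
have d2 : 0 < d ^+ 2 by rewrite exprn_gt0.
have mR : 0 < m%:R :> R by rewrite ltr0n.
rewrite ler_pdivrMr // in ml.
apply: (@le_trans _ _ ((12 * m)%:R * p ^+ (2 * m) * `|c|)).
  apply: (@le_trans _ _ ((12 * m)%:R * q ^+ (2 * m) * `|c|)).
    by rewrite ler_wpM2l ?ler_norm // mulr_ge0 // exprn_ge0.
  rewrite ler_wpM2r // ler_wpM2l // ler_pXn2r ?nnegrE ?muln_gt0 //; exact: ltW.
apply: (@le_trans _ _ ((12 * m)%:R * ((m%:R * d) ^+ 2)^-1 * `|c|)).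
  by rewrite ler_wpM2r // ler_wpM2l // key.
rewrite natrM exprMn.
have -> : 12%:R * m%:R * (m%:R ^+ 2 * d ^+ 2)^-1 * `|c| = 12 * `|c| / (m%:R * d ^+ 2).
  by field; rewrite !gt_eqF.
by rewrite ler_pdivrMr ?mulr_gt0 //; lra.
Qed.

(** * A scalar form with nonzero derivative at a given point *)

Section vanishing.
Variable t0 : uhp.
Let y0 := Im t0.
Let beta : CC := uhp_val t0 - cconj t0.

Lemma betaE : beta = Complex 0 (2 * y0).
Proof. by rewrite /beta /cconj /y0; case: (uhp_val t0) => x y; apply: complexP => /=; ring. Qed.
Lemma cabs_beta : cabs beta = 2 * y0.
Proof.
have y0' : 0 < y0 := uhp_Im_gt0 t0.
rewrite betaE; have -> : Complex 0 (2 * y0) = iC * (2 * y0)%:C by apply: complexP => /=; ring.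
by rewrite cabsM cabs_i mul1r cabs_real gtr0_norm // mulr_gt0.
Qed.
Lemma beta_neq0 : beta != 0.
Proof. by rewrite -cabs_gt0 cabs_beta mulr_gt0 // (uhp_Im_gt0 t0). Qed.

Lemma sub_cconj_neq0 (t : uhp) : uhp_val t - cconj t0 != 0.
Proof.
apply/eqP => /(congr1 (fun z : CC => Im z)); rewrite /= cImB /cconj /= => h.
have := uhp_Im_gt0 t; have := uhp_Im_gt0 t0; lra.
Qed.

(** The kernel of a Poincare series of weight [n - 1]. Its simple zero at [t0] makes
    the derivative of the series at [t0] computable. *)
Definition zero_kernel n (z : uhp) : CC^o := (uhp_val z - uhp_val t0) / (uhp_val z - cconj t0) ^+ n.

Lemma slash_term_zero_kernel m g t :
  slash_term triv_rep (8 + m)%N%:Z (zero_kernel (9 + m)) g t = tau_form t0 g t / taubar_form t0 g t ^+ (9 + m).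
Proof.
rewrite /slash_term lfunE /= /zero_kernel /tau_form /taubar_form -exprnN exprMn.
have := mob_den_neq0 g t; have := sub_cconj_neq0 (mobius g t).
set u := _ - cconj t0; set j := mob_den g t => u0 j0.
rewrite -[X in _ / (j ^+ X * _)]/((8 + m).+1) exprS /GRing.scale /=.
by field; rewrite j0 !expf_neq0.
Qed.

Lemma zero_kernel_holo n : vholomorphic (zero_kernel n).
Proof.
move=> psi.
under eq_fun do rewrite scalar_functional.
apply: (@holo_fun (fun z => psi (1 : CC^o) * ((z - uhp_val t0) / (z - cconj t0) ^+ n))) => t.
apply: derM; first exact: der_cst.
apply: derM; first by apply: derB; [exact: der_id|exact: der_cst].
apply: derV; first by rewrite expf_neq0 // sub_cconj_neq0.
by apply: derX; apply: derB; [exact: der_id|exact: der_cst].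
Qed.

Lemma zero_kernel_bound (psi : 'Hom(CC^o, CC^o)) m (e : R) : 0 < e -> exists B : R, forall g (t : uhp), e <= Im t ->
  cabs (psi (slash_term triv_rep (8 + m)%N%:Z (zero_kernel (9 + m)) g t)) <= B * (cabs (taubar_form t0 g t) ^+ 8)^-1.
Proof.
move=> e0; have [B B0 hB] := taubar_form_powle t0 m e0.
exists (cabs (psi (1 : CC^o)) * B) => g t et.
rewrite scalar_functional slash_term_zero_kernel cabsM [cabs (_ / _)]cabsM -[leRHS]mulrA ler_wpM2l ?cabs_ge0 //.
apply: le_trans (hB g t et).
have c0 := taubar_form_gt0 t0 g t.
rewrite cabsV cabsX ler_pdivrMr ?exprn_gt0 //.
rewrite -[X in _ * _ ^+ X]/((8 + m).+1) exprS mulrCA mulVf ?mulr1 ?tau_form_leC //.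
by rewrite expf_neq0 // gt_eqF.
Qed.

Lemma zero_kernel_series m : exists E : uhp -> CC^o, hol_vvmf triv_rep (8 + m)%N%:Z E /\
  exists L D, [/\
    forall g, isD (extend0 (fun t => slash_term triv_rep (8 + m)%N%:Z (zero_kernel (9 + m)) g t)) (uhp_val t0) (L g),
    has_sum L D & isD (extend0 E) (uhp_val t0) D].
Proof.
have [||E [hE _ dE]] := @poincare_series _ triv_rep t0 (8 + m)%N%:Z _ triv_rep_rep (@zero_kernel_holo (9 + m)).
- move=> psi t; have e0 : 0 < Im t / 2 by rewrite divr_gt0 ?uhp_Im_gt0.
  have [B hB] := zero_kernel_bound psi m e0.
  exists (Im t / 2), [::], B; split => // g t' h _; apply: hB.
  have := le_trans (Im_le_cabs _) (ltW h); rewrite cImB ler_norml; lra.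
- by move=> psi; have [B hB] := zero_kernel_bound psi m ltr01; exists 1, B.
exists E; split => //; have [L [D [h1 h2 h3]]] := dE \1%VF t0.
exists L, D; split => //.
  by move=> g; have := h1 g; under eq_fun do rewrite lfunE /=.
by move: h3; under eq_fun do rewrite lfunE /=.
Qed.

Let al (g : SL2Z) : CC := (g 0 0)%:~R - uhp_val t0 * (g 1 0)%:~R.
Let ga (g : SL2Z) : CC := (g 0 0)%:~R - cconj t0 * (g 1 0)%:~R.

Lemma tau_formE g t : tau_form t0 g t = al g * uhp_val t + ((g 0 1)%:~R - uhp_val t0 * (g 1 1)%:~R).
Proof. by rewrite /tau_form mulrBr mulrC mobiusE /mob_num /mob_den /al; ring. Qed.
Lemma taubar_formE g t : taubar_form t0 g t = ga g * uhp_val t + ((g 0 1)%:~R - cconj t0 * (g 1 1)%:~R).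
Proof. by rewrite /taubar_form mulrBr mulrC mobiusE /mob_num /mob_den /ga; ring. Qed.

(** The determinant of the two linear forms is that of [g] times [t0 - cconj t0]. *)
Lemma form_wronskian g t : al g * taubar_form t0 g t - ga g * tau_form t0 g t = beta.
Proof.
rewrite tau_formE taubar_formE.
have := det_SL2Z g; rewrite det2 => /(congr1 (fun n : int => n%:~R : CC)).
rewrite rmorphB !rmorphM rmorph1 /= => h.
transitivity (beta * ((g 0 0)%:~R * (g 1 1)%:~R - (g 0 1)%:~R * (g 1 0)%:~R)).
  by rewrite /al /ga /beta; ring.
by rewrite h mulr1.
Qed.

Lemma slash_term_zero_kernel_der m g L :
  isD (extend0 (fun t => slash_term triv_rep (8 + m)%N%:Z (zero_kernel (9 + m)) g t)) (uhp_val t0) L ->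
  L = (beta - (8 + m)%:R * ga g * tau_form t0 g t0) / taubar_form t0 g t0 ^+ (10 + m).
Proof.
move=> D.
have C0 : taubar_form t0 g t0 != 0 by rewrite -cabs_gt0 taubar_form_gt0.
have dA := isD_affine (al g) ((g 0 1)%:~R - uhp_val t0 * (g 1 1)%:~R) (uhp_val t0).
have dC := isD_affine (ga g) ((g 0 1)%:~R - cconj t0 * (g 1 1)%:~R) (uhp_val t0).
have C0' := C0; rewrite taubar_formE in C0'.
have := @isD_quot _ (fun w => ga g * w + ((g 0 1)%:~R - cconj t0 * (g 1 1)%:~R)) _ _ _ (8 + m) C0' dA dC.
rewrite -taubar_formE -tau_formE.
set L' := (X in isD _ _ X) => D'.
have -> : L = L'.
  refine (isD_uniq (isD_near _ D) D'); exists (Im t0); first exact: uhp_Im_gt0.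
  by move=> z /uhp_open[t <-]; rewrite extend0E slash_term_zero_kernel tau_formE taubar_formE.
rewrite /L' -(form_wronskian g t0); congr (_ / _).
by rewrite -[(8 + m).+1%:R]natr1; ring.
Qed.

Definition fixes (g : SL2Z) := mobius g t0 = t0.

Lemma tau_form_fix g : fixes g -> tau_form t0 g t0 = 0.
Proof. by rewrite /tau_form => ->; rewrite subrr mulr0. Qed.
Lemma taubar_form_fix g : fixes g -> taubar_form t0 g t0 = mob_den g t0 * beta.
Proof. by rewrite /taubar_form => ->. Qed.

Let D0 : R := 2 * y0.
Let D0_gt0 : 0 < D0. Proof. by rewrite mulr_gt0 // (uhp_Im_gt0 t0). Qed.

Lemma taubar_form2 g : cabs (taubar_form t0 g t0) ^+ 2 = cabs (tau_form t0 g t0) ^+ 2 + D0 ^+ 2.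
Proof. by rewrite taubar_formA /D0 /y0; ring. Qed.

Lemma taubar_form_geD0 g : D0 <= cabs (taubar_form t0 g t0).
Proof. by rewrite -(@ler_pXn2r _ 2) ?nnegrE ?cabs_ge0 ?(ltW D0_gt0) // taubar_form2 lerDr sqr_ge0. Qed.

(** Each quotient is below [1] because [tau_form] does not vanish, and all but
    finitely many are below [1 / 2]. *)
Lemma nonfix_gap : exists2 q : R, 0 <= q < 1 & forall g, ~ fixes g -> D0 / cabs (taubar_form t0 g t0) <= q.
Proof.
have lt1 g : ~ fixes g -> D0 / cabs (taubar_form t0 g t0) < 1.
  move=> nf; rewrite ltr_pdivrMr ?taubar_form_gt0 // mul1r.
  rewrite -(@ltr_pXn2r _ 2) ?nnegrE ?cabs_ge0 ?(ltW D0_gt0) // taubar_form2 ltrDr exprn_gt0 //.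
  rewrite cabs_gt0 mulf_neq0 ?mob_den_neq0 // subr_eq0; apply/eqP => h.
  by apply: nf; exact: val_inj.
have fin (s : seq SL2Z) : exists2 q : R, 0 <= q < 1 &
    forall g, g \in s -> ~ fixes g -> D0 / cabs (taubar_form t0 g t0) <= q.
  elim: s => [|h s [q /andP[q0 q1] hq]]; first by exists 0; rewrite ?lexx ?ltr01.
  have [fh|/lt1 hh] := pselect (fixes h).
    exists q; first by rewrite q0.
    by move=> g; rewrite inE => /predU1P[-> /(_ fh)|/hq] //.
  exists (Num.max q (D0 / cabs (taubar_form t0 h t0))); first by rewrite le_max q0 gt_max q1.
  by move=> g; rewrite inE le_max => /predU1P[->|/hq h' /h' ->]; rewrite ?lexx ?orbT.
have [s hs] := taubar_form_large t0 `|Re t0| (2 * D0) (uhp_Im_gt0 t0).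
have [q /andP[q0 q1] hq] := fin s.
exists (Num.max q (1 / 2)); first by rewrite le_max q0 gt_max q1 /=; lra.
move=> g nf; rewrite le_max; have [gs|gs] := boolP (g \in s); first by rewrite hq.
have := hs g t0 gs (lexx _) (lexx _) => h.
by apply/orP; right; rewrite ler_pdivrMr ?taubar_form_gt0 //; lra.
Qed.

Lemma ga_bound : exists2 k : R, 0 <= k & forall g, cabs (ga g) <= k * cabs (taubar_form t0 g t0).
Proof.
have [K K0 hK] := entries_sq_bound t0 `|Re t0| (uhp_Im_gt0 t0).
exists ((1 + cabs (cconj t0)) * Num.sqrt K) => [|g].
  by rewrite mulr_ge0 ?sqrtr_ge0 // addr_ge0 ?cabs_ge0.
have h := hK g t0 (lexx _) (lexx _).
have bd (x : R) : x ^+ 2 <= entries_sq g -> `|x| <= Num.sqrt K * cabs (taubar_form t0 g t0).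
  move=> hx; rewrite -(@ler_pXn2r _ 2) ?nnegrE ?mulr_ge0 ?sqrtr_ge0 ?cabs_ge0 //.
  by rewrite real_normK ?num_real // exprMn sqr_sqrtr ?(ltW K0) //; apply: le_trans hx h.
have s0 := sqr_ge0 ((g 0 0)%:~R : R); have s1 := sqr_ge0 ((g 0 1)%:~R : R).
have s2 := sqr_ge0 ((g 1 0)%:~R : R); have s3 := sqr_ge0 ((g 1 1)%:~R : R).
rewrite -mulrA mulrDl mul1r; apply: le_trans (cabsB _ _) _; apply: lerD.
  by rewrite intCE cabs_real bd // /entries_sq; lra.
by rewrite cabsM ler_wpM2l ?cabs_ge0 // intCE cabs_real bd // /entries_sq; lra.
Qed.

(** Scaled by [beta ^+ n], the derivative at [t0] of the Poincare series of
    [zero_kernel n] is a sum in which every [g] fixing [t0] contributes [1] when [12]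
    divides [n + 1], while the contribution of all other [g] tends to [0] as [n]
    grows, by [nonfix_gap]. *)
Lemma form_with_nonzero_derivative : exists (l : nat) (E : uhp -> CC^o) (D : CC),
  [/\ hol_vvmf triv_rep (12 * l + 10)%N%:Z E, D != 0 & isD (extend0 E) (uhp_val t0) D].
Proof.
have [q q01 hq] := nonfix_gap; have /andP[q0 q1] := q01.
have [k k0 hk] := ga_bound.
have [K K0 hK] := taubar_form_sum_bound t0 `|Re t0| (uhp_Im_gt0 t0).
have [B hB] := entry_weight_sum.
have sumC : sums_le (fun g => (cabs (taubar_form t0 g t0) ^+ 8)^-1) (K * B).
  by apply: sums_le_le (sums_leZ (ltW K0) hB) => g; exact: hK.
pose c1 := 1 + k * D0.
have c10 : 0 <= c1 by rewrite addr_ge0 // mulr_ge0 // ltW.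
have [l hl] := geometric_small (c1 * D0 ^+ 8 * (K * B)) q01.
pose m' := (6 * l + 1)%N; pose m := (2 * m')%N.
have [E [hE [L [D [hL hS hD]]]]] := zero_kernel_series m.
exists l, E, D; split => //.
  have -> : (12 * l + 10 = 8 + m)%N by rewrite /m /m'; ring.
  exact: hE.
apply/eqP => D0E; rewrite D0E in hS.
(* Normalised so that the elements fixing [t0] contribute [1]. *)
pose v g := beta ^+ (9 + m) * L g.
have vE g : v g = beta ^+ (9 + m) * ((beta - (8 + m)%:R * ga g * tau_form t0 g t0) / taubar_form t0 g t0 ^+ (10 + m)).
  by rewrite /v (slash_term_zero_kernel_der (hL g)).
have vfix g : fixes g -> v g = 1.
  move=> fg; rewrite vE tau_form_fix // mulr0 subr0 taubar_form_fix //.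
  have b0 := beta_neq0; have j0 := mob_den_neq0 g t0.
  have -> : (10 + m = 12 * l.+1)%N by rewrite /m /m'; ring.
  rewrite exprMn [mob_den g t0 ^+ _]exprM (mob_den_fix12 fg) expr1n mul1r.
  have -> : (9 + m = (12 * l + 11))%N by rewrite /m /m'; ring.
  have -> : (12 * l.+1 = (12 * l + 11).+1)%N by ring.
  by rewrite mulrA -exprSr mulfV // expf_neq0.
have vnf g : ~ fixes g -> cabs (v g) <= (12 * m')%:R * q ^+ m * (c1 * D0 ^+ 8) * (cabs (taubar_form t0 g t0) ^+ 8)^-1.
  move=> nf; rewrite vE.
  set C := cabs (taubar_form t0 g t0).
  have C0 : 0 < C by exact: taubar_form_gt0.
  have CD : D0 <= C by exact: taubar_form_geD0.
  have ncb : cabs beta = D0 by exact: cabs_beta.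
  rewrite cabsM [cabs (_ / _)]cabsM cabsV !cabsX ncb -/C.
  have num : cabs (beta - (8 + m)%:R * ga g * tau_form t0 g t0) <= (12 * m')%:R * c1 * (C ^+ 2 / D0).
    apply: le_trans (cabsB _ _) _; rewrite ncb.
    have h1 : D0 <= C ^+ 2 / D0 by rewrite ler_pdivlMr // -expr2 ler_pXn2r ?nnegrE ?(ltW D0_gt0) ?(ltW C0).
    have h2 : cabs ((8 + m)%:R * ga g * tau_form t0 g t0) <= (8 + m)%:R * k * C ^+ 2.
      rewrite [cabs (_ * tau_form _ _ _)]cabsM [cabs (_ * ga _)]cabsM.
      have -> : (8 + m)%:R = ((8 + m)%:R : R)%:C by rewrite rmorph_nat.
      rewrite cabs_real ger0_norm // -mulrA expr2 -[leRHS]mulrA ler_wpM2l // mulrA.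
      by apply: ler_pM; rewrite ?cabs_ge0 ?hk ?tau_form_leC.
    apply: (@le_trans _ _ (C ^+ 2 / D0 + (8 + m)%:R * k * C ^+ 2)); first exact: lerD.
    have -> : (12 * m')%:R * c1 * (C ^+ 2 / D0) = (12 * m')%:R * (C ^+ 2 / D0) + (12 * m')%:R * k * C ^+ 2.
      by rewrite /c1; field; rewrite gt_eqF.
    have cd0 : 0 <= C ^+ 2 / D0 by rewrite divr_ge0 ?sqr_ge0 // ltW.
    apply: lerD; first by rewrite ler_peMl // ler1n /m' addn1 muln_gt0.
    apply: ler_wpM2r; first exact: sqr_ge0.
    apply: ler_wpM2r; first exact: k0.
    rewrite ler_nat.
    rewrite /m /m'.
    clear; lia.
  apply: (@le_trans _ _ (D0 ^+ (9 + m) * ((12 * m')%:R * c1 * (C ^+ 2 / D0) / C ^+ (10 + m)))).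
    by rewrite ler_wpM2l ?exprn_ge0 ?(ltW D0_gt0) // ler_wpM2r // invr_ge0 exprn_ge0 // ltW.
  have -> : D0 ^+ (9 + m) * ((12 * m')%:R * c1 * (C ^+ 2 / D0) / C ^+ (10 + m)) =
     (12 * m')%:R * (D0 / C) ^+ m * (c1 * D0 ^+ 8) * (C ^+ 8)^-1.
    rewrite expr_div_n !exprD; field.
    by rewrite !expf_neq0 ?(gt_eqF C0) ?(gt_eqF D0_gt0).
  apply: ler_wpM2r; first by rewrite invr_ge0 exprn_ge0 // ltW.
  apply: ler_wpM2r; first by rewrite mulr_ge0 // exprn_ge0 // ltW.
  by apply: ler_wpM2l => //; rewrite lerXn2r ?nnegrE ?divr_ge0 ?(ltW C0) ?(ltW D0_gt0) // hq.
have hv : has_sum v 0 by rewrite -(mulr0 (beta ^+ (9 + m))); exact: has_sumZ.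
have e4 : (0 : R) < 1 / 4 by lra.
have [s0 us0 hs0] := hv _ e4.
(* A partial sum that is nearly [0] and contains the term of [g = 1]. *)
have [us sub1 sub2] := cat_undup [:: (1%g : SL2Z)] s0.
have {hs0} := hs0 _ us sub2; rewrite subr0; set s := undup _ in us sub1 sub2 *.
have fix1 : fixes 1%g by rewrite /fixes mobius1.
have s1 : (1%g : SL2Z) \in s by apply: sub1; rewrite inE.
rewrite (bigID (fun g => `[< fixes g >])) /=.
set S1 := \sum_(i <- s | _) _; set S2 := \sum_(i <- s | _) _ => hsum.
have n2 : cabs S2 <= 1 / 2.
  rewrite /S2 -big_filter; apply: le_trans (cabs_sum _ _) _.
  set c := (12 * m')%:R * q ^+ m * (c1 * D0 ^+ 8).
  have c0 : 0 <= c.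
    by apply: mulr_ge0; apply: mulr_ge0 => //; apply: exprn_ge0 => //; exact: ltW D0_gt0.
  apply: (@le_trans _ _ (\sum_(g <- [seq g <- s | ~~ `[< fixes g >]]) c * (cabs (taubar_form t0 g t0) ^+ 8)^-1)).
    rewrite big_seq [leRHS]big_seq; apply: ler_sum => g; rewrite mem_filter => /andP[/asboolPn nf _].
    exact: vnf.
  rewrite -mulr_sumr; apply: le_trans (ler_wpM2l c0 (sumC _ (filter_uniq _ us))) _.
  by rewrite /c -[leLHS]mulrA; move: hl; rewrite -/m' -/m !mulrA.
have n1 : 1 <= Re S1.
  rewrite /S1 -big_filter (eq_big_seq (fun=> 1)) => [|g]; last first.
    by rewrite mem_filter => /andP[/asboolP fg _]; rewrite vfix.
  rewrite big_const_seq count_predT iter_addr_0.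
  have -> : (1 : CC) *+ size [seq g <- s | `[< fixes g >]] = ((size [seq g <- s | `[< fixes g >]])%:R : R)%:C.
    by rewrite rmorph_nat.
  rewrite /= ler1n -has_predT; apply/hasP; exists 1%g => //.
  by rewrite mem_filter s1 andbT; apply/asboolP.
have := le_trans (ler_norm _) (Re_le_cabs (S1 + S2)); rewrite cReD.
have := le_trans (Re_le_cabs S2) n2; rewrite ler_norml; lra.
Qed.
End vanishing.

(** * Poincare series with a pole in their kernel *)

Section polar_part.
Variables (V : vectType CC) (rho : SL2Z -> 'End(V)) (rho_rep : representation rho).
Variables (t0 : uhp) (d : nat) (w : 'I_d -> int) (F : 'I_d -> uhp -> V) (a : 'I_d -> CC).
Variables (m : 'I_d -> nat) (W : int).
Hypothesis HF : forall i, hol_vvmf rho (w i) (F i).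
Hypothesis HW : forall i, W = w i + (9 + m i)%N%:Z.

(** The exponents [8 + m i] compensate the weights [w i]: divided by [t - t0], every
    summand has a kernel of the same weight [W]. *)
Definition polar_numer (t : uhp) : V := \sum_i (a i / (uhp_val t - cconj t0) ^+ (8 + m i)) *: F i t.
Definition polar_part (fill : V) (t : uhp) : V :=
  if uhp_val t == uhp_val t0 then fill else (uhp_val t - uhp_val t0)^-1 *: polar_numer t.

Hypothesis rel : polar_numer t0 = 0.

Lemma polar_numer_fun (psi : 'Hom(V, CC^o)) :
  (fun t => psi (polar_numer t)) = (fun t => \sum_i (a i / (uhp_val t - cconj t0) ^+ (8 + m i)) * psi (F i t)).
Proof. by apply/funext => t; rewrite /polar_numer linear_sum; apply: eq_bigr => i _; rewrite linearZ. Qed.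

Lemma polar_numer_holo : vholomorphic polar_numer.
Proof.
move=> psi; rewrite polar_numer_fun; apply: holo_sum => i; apply: holoM; last by have [[h _] _] := HF i.
apply: (@holo_fun (fun z => a i / (z - cconj t0) ^+ (8 + m i))) => t.
apply: derM; first exact: der_cst.
apply: derV; first by rewrite expf_neq0 // sub_cconj_neq0.
by apply: derX; apply: derB; [exact: der_id|exact: der_cst].
Qed.

(** The value at [t0] of the quotient of [polar_numer] by [t - t0] is the derivative
    of [polar_numer], assembled from its coordinates. *)
Lemma fill_exists : exists fill : V, forall psi : 'Hom(V, CC^o),
  isD (extend0 (fun t => psi (polar_numer t))) (uhp_val t0) (psi fill).
Proof.
pose L j : CC := 'D_1 (extend0 (fun t => vcoord j (polar_numer t)) : CC^o -> CC^o) (uhp_val t0 : CC^o).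
have hd j : isD (extend0 (fun t => vcoord j (polar_numer t))) (uhp_val t0) (L j).
  by apply/derivableP; exact: polar_numer_holo.
exists (\sum_j L j *: (vbasis (fullv : {vspace V}))`_j) => psi.
have -> : (fun t => psi (polar_numer t)) =
  (fun t => \sum_(j < \dim (fullv : {vspace V}))
     psi (vbasis (fullv : {vspace V}))`_j * vcoord j (polar_numer t)).
  by apply/funext => t; rewrite functionalE.
rewrite extend0_sum linear_sum; apply: isD_sum => j.
rewrite extend0_mul /=.
have -> : psi (L j *: (vbasis (fullv : {vspace V}))`_j) = psi (vbasis (fullv : {vspace V}))`_j * L j.
  by rewrite linearZ /= [RHS]mulrC.
exact: (isD_Z _ (hd j)).
Qed.

Lemma polar_part_holo fill : (forall psi : 'Hom(V, CC^o),
  isD (extend0 (fun t => psi (polar_numer t))) (uhp_val t0) (psi fill)) -> vholomorphic (polar_part fill).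
Proof.
move=> hfill psi t.
pose f := extend0 (fun t => psi (polar_numer t)).
have pE (t' : uhp) : psi (polar_part fill t') =
    if uhp_val t' == uhp_val t0 then psi fill else f (uhp_val t') / (uhp_val t' - uhp_val t0).
  by rewrite /polar_part; case: eqP => // _; rewrite linearZ /= /f extend0E mulrC.
have [e|ne] := eqVneq (uhp_val t) (uhp_val t0).
  have df z : cabs (z - uhp_val t0) < Im t0 -> derC f z.
    by move=> /uhp_open[t' <-]; exact: polar_numer_holo.
  have := divided_difference_der (uhp_Im_gt0 t0) df (hfill psi); rewrite -e.
  apply: near_eq_derC; exists (Im t); first exact: uhp_Im_gt0.
  move=> z /uhp_open[t' <-]; rewrite extend0E pE -e.
  by rewrite {2}/f e extend0E rel linear0 subr0.
apply: (@near_eq_derC (fun z => f z / (z - uhp_val t0))).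
  exists (Num.min (Im t) (cabs (uhp_val t - uhp_val t0))).
    by rewrite lt_min uhp_Im_gt0 cabs_gt0 subr_eq0.
  move=> z; rewrite lt_min => /andP[/uhp_open[t' <-] h]; rewrite extend0E pE.
  by case: eqP => // e; rewrite e cabsC ltxx in h.
apply: derM; first exact: polar_numer_holo.
by apply: derV; [rewrite subr_eq0|apply: derB; [exact: der_id|exact: der_cst]].
Qed.

(** The modularity of the [F i] absorbs [rho] and the factors of weight [w i]: what
    is left in front of [F i t] is a term of a scalar Poincare series. *)
Lemma slash_term_polar_part fill g t : tau_form t0 g t != 0 ->
  slash_term rho W (polar_part fill) g t = \sum_i (a i / (tau_form t0 g t * taubar_form t0 g t ^+ (8 + m i))) *: F i t.
Proof.
move=> A0.
have j0 := mob_den_neq0 g t.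
have u0 : uhp_val (mobius g t) - uhp_val t0 != 0.
  by move: A0; rewrite /tau_form mulf_eq0 negb_or => /andP[].
have v0 := sub_cconj_neq0 t0 (mobius g t).
have pE : polar_part fill (mobius g t) = (uhp_val (mobius g t) - uhp_val t0)^-1 *: polar_numer (mobius g t).
  by rewrite /polar_part ifN // -subr_eq0.
rewrite /slash_term pE [rho _ _]linearZ scalerA.
rewrite [polar_numer _]/polar_numer linear_sum.
rewrite scaler_sumr.
apply: eq_bigr => i _; rewrite linearZ /= scalerA.
have [[_ ->] _] := HF i.
rewrite linearZ /= -(rhoM rho_rep) mulVg (rho1 rho_rep) scalerA; congr (_ *: _).
have jW : mob_den g t ^ (- W) * mob_den g t ^ w i = (mob_den g t ^+ (8 + m i).+1)^-1.
  by rewrite -expfzDr // (HW i) opprD addrAC addNr add0r -exprnN.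
set v := uhp_val _ - cconj t0 in v0 *; set u := uhp_val _ - _ in u0 *.
transitivity ((mob_den g t ^ (- W) * mob_den g t ^ w i) * (u^-1 * (a i / v ^+ (8 + m i)))).
  by ring.
rewrite jW exprS /tau_form /taubar_form -/u -/v exprMn.
by field; rewrite j0 u0 !expf_neq0.
Qed.

Lemma slash_term_polar_bound fill (psi : 'Hom(V, CC^o)) (e : R) (Bf : 'I_d -> R) : 0 < e ->
  exists B : R, forall g t, 1 <= cabs (tau_form t0 g t) -> e <= Im (uhp_val t) ->
   (forall i, cabs (psi (F i t)) <= Bf i) ->
   cabs (psi (slash_term rho W (polar_part fill) g t)) <= B * (cabs (taubar_form t0 g t) ^+ 8)^-1.
Proof.
move=> e0; have hc i : exists B : R, 0 <= B /\ forall g (t : uhp), e <= Im t ->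
    (cabs (taubar_form t0 g t) ^+ (8 + m i))^-1 <= B * (cabs (taubar_form t0 g t) ^+ 8)^-1.
  by have [B B0 hB] := taubar_form_powle t0 (m i) e0; exists B.
have [Bc hBc] := choice hc.
exists (\sum_i (cabs (a i) * Bc i * Bf i)) => g t A1 et hF.
have A0 : tau_form t0 g t != 0 by rewrite -cabs_gt0; lra.
rewrite slash_term_polar_part // linear_sum mulr_suml; apply: le_trans (cabs_sum _ _) _.
apply: ler_sum => i _; have [B0 hB] := hBc i.
rewrite linearZ /= [cabs (_ * _)]cabsM [cabs (_ / _)]cabsM cabsV [cabs (_ * _ ^+ _)]cabsM cabsX invfM.
rewrite [leRHS]mulrAC; apply: ler_pM; rewrite ?mulr_ge0 ?invr_ge0 ?exprn_ge0 ?cabs_ge0 //.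
rewrite -mulrA ler_wpM2l ?cabs_ge0 //; apply: le_trans (hB g t et).
rewrite -[leRHS]mul1r ler_wpM2r ?invr_ge0 ?exprn_ge0 ?cabs_ge0 //.
by rewrite invf_le1 //; lra.
Qed.

(** The vanishing of [polar_numer] at [t0] makes every term of the series
    holomorphic, although each of the scalar series in front of the [F i] has poles
    on the orbit of [t0]. *)
Lemma polar_poincare : exists (fill : V) (H : uhp -> V), [/\
  forall psi : 'Hom(V, CC^o), isD (extend0 (fun t => psi (polar_numer t))) (uhp_val t0) (psi fill),
  hol_vvmf rho W H &
  forall (psi : 'Hom(V, CC^o)) t, has_sum (fun g => psi (slash_term rho W (polar_part fill) g t)) (psi (H t))].
Proof.
have [fill hfill] := fill_exists.
have [||H [hH hS _]] := @poincare_series V rho t0 W (polar_part fill) rho_rep (polar_part_holo hfill).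
- move=> psi t; have it := uhp_Im_gt0 t.
  have e0 : 0 < Im t / 2 by rewrite divr_gt0.
  have cF i : contC (extend0 (fun t => psi (F i t))) (uhp_val t).
    by apply: der_cont; have [[h _] _] := HF i; exact: h.
  have [r [Bf [r0 _ hBf]]] := finite_local_bound (enum 'I_d) cF.
  have [B hB] := slash_term_polar_bound fill psi (fun=> Bf) e0.
  have [s hs] := tau_form_large t0 (`|Re t| + Im t) (Im t + Im t) e0.
  exists (Num.min r (Im t / 2)), s, B; split; first by rewrite lt_min r0.
  move=> g t'; rewrite lt_min => /andP[hr h] gs.
  have h1 := le_trans (Re_le_cabs _) (ltW h); have h2 := le_trans (Im_le_cabs _) (ltW h).
  rewrite cReB in h1; rewrite cImB ler_norml in h2.
  have ie : Im t / 2 <= Im t' by lra.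
  apply: hB => //.
    apply: hs => //; last lra.
    by rewrite -[Re t'](subrK (Re t)) (le_trans (ler_normD _ _)) //; lra.
  by move=> i; have := hBf i (uhp_val t') (mem_enum _ i) hr; rewrite extend0E.
- move=> psi.
  have hb i : exists yB : R * R, forall t : uhp, yB.1 < Im t -> cabs (psi (F i t)) <= yB.2.
    have [_ h] := HF i; have [y [B hyB]] := h psi; exists (y, B) => t /hyB.
    by rewrite cabsE lecR.
  have [yB hyB] := choice hb.
  have [B hB] := slash_term_polar_bound fill psi (fun i => (yB i).2) ltr01.
  have [y1 hy1] := tau_form_cusp t0.
  exists (Num.max y1 1 + 1 + \sum_i `|(yB i).1|), B => g t ht.
  have s0 : 0 <= \sum_i `|(yB i).1| by apply: sumr_ge0.
  have m1 : y1 <= Num.max y1 1 by rewrite le_max lexx.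
  have m2 : 1 <= Num.max y1 1 by rewrite le_max lexx orbT.
  apply: hB; [by apply: hy1; lra|lra|] => i; apply: hyB.
  have : `|(yB i).1| <= \sum_i `|(yB i).1| by rewrite (bigD1 i) //= lerDl sumr_ge0.
  have := ler_norm (yB i).1; lra.
by exists fill, H; split.
Qed.
End polar_part.

(** * The graded module and the independence of the generators *)

Section graded.
Variables (V : vectType CC) (rho : SL2Z -> 'End(V)).

Lemma hol_vvmf0 n : hol_vvmf rho n 0.
Proof.
split; first split.
- move=> psi; have -> : (fun t : uhp => psi ((0 : uhp -> V) t)) = fun=> 0.
    by apply/funext => t; rewrite linear0.
  by apply: (@holo_fun (fun=> 0)) => t; exact: der_cst.
- by move=> g t; rewrite linear0 scaler0.
- move=> psi; exists 0, 0 => t _; rewrite linear0 normr0 //.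
Qed.

Lemma hol_vvmf_mul (E : uhp -> CC^o) (H : uhp -> V) k n :
  hol_vvmf triv_rep k E -> hol_vvmf rho n H -> hol_vvmf rho (k + n) (fun t => E t *: H t).
Proof.
move=> [[hE mE] bE] [[hH mH] bH].
have e1 (psi : 'Hom(CC^o, CC^o)) t : psi (E t) = psi (1 : CC^o) * E t by rewrite scalar_functional.
have hE' : holomorphic E.
  by have := hE \1%VF; under eq_fun do rewrite lfunE /=.
split; first split.
- move=> psi.
  have -> : (fun t => psi (E t *: H t)) = (fun t => E t * psi (H t)).
    by apply/funext => t; rewrite linearZ.
  exact: (holoM hE' (hH psi)).
- move=> g t; rewrite mE mH lfunE /= [in RHS]linearZ /= !scalerA expfzDr ?mob_den_neq0 //.
  congr (_ *: _); transitivity (mob_den g t ^ k * (E t : CC) * mob_den g t ^ n) => //.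
  exact: mulrAC.
- move=> psi; have [y1 [B1 h1]] := bE \1%VF; have [y2 [B2 h2]] := bH psi.
  exists (Num.max y1 y2), (B1 * B2) => t; rewrite gt_max => /andP[/h1 k1 /h2 k2].
  move: k1 k2; rewrite lfunE /= !cabsE !lecR => k1 k2.
  by rewrite linearZ /= [cabs (_ * _)]cabsM; apply: ler_pM; rewrite ?cabs_ge0.
Qed.

Definition single (T : zmodType) (I : eqType) (e : I) (f : T) : I -> T := fun n => if n == e then f else 0.

Lemma single_mod n (X : uhp -> V) : hol_vvmf rho n X -> modmodule rho (single n X).
Proof.
move=> hX; split; first by move=> k; rewrite /single; case: eqP => [->|_] //; exact: hol_vvmf0.
apply: (sub_finite_set _ (finite_set1 n)) => k /=; rewrite /single.
by case: (k =P n) => // _; rewrite eqxx.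
Qed.

Lemma modact_support (c : nat -> uhp -> CC^o) (X : int -> uhp -> V) n e :
  (forall k, k != e -> c k = 0 \/ X (n - k.*2%:Z) = 0) ->
  modact c X n = fun t => c e t *: X (n - e.*2%:Z) t.
Proof.
move=> h; rewrite /modact -(fsbig_widen [set e]) ?fsbig_set1 // => k [_ /= /eqP /h [->|->]] //=.
  by apply/funext => t; rewrite scale0r.
by apply/funext => t; rewrite scaler0.
Qed.

Lemma modact0 (c : nat -> uhp -> CC^o) (X : int -> uhp -> V) n :
  (forall k, c k = 0 \/ X (n - k.*2%:Z) = 0) -> modact c X n = 0.
Proof.
move=> h; rewrite (@modact_support c X n 0%N) => [|k _]; last exact: h.
by apply/funext => t; case: (h 0%N) => ->; rewrite ?scale0r ?scaler0.
Qed.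
End graded.

Lemma single_ring k (f : uhp -> CC^o) : hol_vvmf triv_rep (k.*2%:Z) f -> modring (single k f).
Proof.
move=> hf; split; first by move=> n; rewrite /single; case: eqP => [->|_] //; exact: hol_vvmf0.
apply: (sub_finite_set _ (finite_set1 k)) => n /=; rewrite /single.
by case: (n =P k) => // _; rewrite eqxx.
Qed.

Lemma modring0 : modring 0.
Proof.
split; first by move=> n; exact: hol_vvmf0.
by rewrite (_ : [set i | _] = set0) //; apply/seteqP; split => // i /=; rewrite eqxx.
Qed.

(** Apply the transformation rule to [negI], which acts trivially. *)
Lemma odd_weight0 (n : nat) (f : uhp -> CC^o) : odd n -> hol_vvmf triv_rep n%:Z f -> f = 0.
Proof.
move=> on [[_ h] _]; apply/funext => t.
have := h negI t.
have den : mob_den negI t = -1 by rewrite /mob_den !mxE /= mul0r add0r rmorphN.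
have -> : mobius negI t = t.
  apply: val_inj; apply: (mulIf (mob_den_neq0 negI t)).
  have := mobiusE negI t; rewrite den /mob_num !mxE /= rmorphN /= => ->.
  by rewrite addr0 mulN1r mulrN1.
rewrite den lfunE /= -exprnP -signr_odd on expr1 scaleN1r => /eqP.
by rewrite -subr_eq0 opprK -mulr2n -scaler_nat scaler_eq0 pnatr_eq0 /= => /eqP.
Qed.

(** In weight 10 modulo 12 the rule at the fixed point is [E t0 = j ^+ 10 * E t0], and
    [j ^+ 10 = j ^- 2]. *)
Lemma weight_vanish (t0 : uhp) (g0 : SL2Z) (l : nat) (E : uhp -> CC^o) :
  mobius g0 t0 = t0 -> mob_den g0 t0 ^+ 2 != 1 ->
  hol_vvmf triv_rep (12 * l + 10)%N%:Z E -> E t0 = 0.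
Proof.
move=> fg j2 [[_ h] _]; have := h g0 t0.
rewrite fg lfunE /= -exprnP exprD exprM (mob_den_fix12 fg) expr1n mul1r.
move=> e; apply/eqP; apply: contraNT j2 => E0.
have j10 : mob_den g0 t0 ^+ 10 = 1.
  by apply: (mulIf E0); rewrite mul1r [RHS]e.
by rewrite -(mob_den_fix12 fg) -[12%N]/(2 + 10)%N exprD j10 mulr1.
Qed.

(** The partial sums are multiples of [c], nonzero ones once they include [g = 1]. *)
Lemma has_sum_stabilizer (t0 : uhp) (c : CC) :
  has_sum (fun g => if `[< mobius g t0 = t0 >] then c else 0) 0 -> c = 0.
Proof.
move=> h; apply/eqP; rewrite -cabs_eq0 eq_le cabs_ge0 andbT.
apply/ler_addgt0Pr => e e0; rewrite add0r.
have [s0 us0 hs0] := h _ e0.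
have [us sub1 sub2] := cat_undup [:: (1%g : SL2Z)] s0.
have := hs0 _ us sub2; rewrite subr0 -big_mkcond -big_filter big_const_seq count_predT iter_addr_0.
have s1 : (0 < size [seq g <- undup ([:: (1%g : SL2Z)] ++ s0) | `[< mobius g t0 = t0 >]])%N.
  rewrite -has_predT; apply/hasP; exists 1%g => //.
  by rewrite mem_filter sub1 ?inE // andbT; apply/asboolP; exact: mobius1.
set N := size _ in s1 *; rewrite -mulr_natr cabsM; apply: le_trans.
have -> : (N%:R : CC) = (N%:R : R)%:C by rewrite rmorph_nat.
by rewrite cabs_real normr_nat ler_peMr ?cabs_ge0 // ler1n.
Qed.

Section independence.
Variables (d : nat) (V : vectType CC) (rho : SL2Z -> 'End(V)).
Variables (F : 'I_d -> int -> uhp -> V) (w : 'I_d -> int).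
Hypothesis rho_rep : representation rho.
Hypothesis F_free : free_generators rho F.
Hypothesis F_weight : forall i : 'I_d, homogeneous (w i) (F i).

Lemma generator_form i : hol_vvmf rho (w i) (F i (w i)).
Proof. by case: F_free => h _; have [k _] := h i. Qed.

(** Uniqueness of the coordinates, read in the single degree [n]. The ring of
    coefficients is indexed by even weights only, and coefficients of odd weight
    are [0] by [odd_weight0]. *)
Lemma free_generators_cancel (n : int) (e : 'I_d -> nat) (p q : 'I_d -> uhp -> CC^o) :
  (forall i, n = w i + (e i)%:Z) ->
  (forall i, hol_vvmf triv_rep (e i)%:Z (p i)) -> (forall i, hol_vvmf triv_rep (e i)%:Z (q i)) ->
  hol_vvmf rho n (fun t => \sum_i p i t *: F i (w i) t) ->
  (forall t, \sum_i p i t *: F i (w i) t = \sum_i q i t *: F i (w i) t) -> p = q.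
Proof.
move=> en hp hq hn pq.
pose c (p : 'I_d -> uhp -> CC^o) i : nat -> uhp -> CC^o := if odd (e i) then 0 else single (e i)./2 (p i).
have cring r : (forall i, hol_vvmf triv_rep (e i)%:Z (r i)) -> forall i, modring (c r i).
  move=> hr i; rewrite /c; case: ifPn => oe; first exact: modring0.
  by apply: single_ring; rewrite even_halfK.
have cE r : (forall i, hol_vvmf triv_rep (e i)%:Z (r i)) ->
   \sum_(i < d) modact (c r i) (F i) = single n (fun t => \sum_i r i t *: F i (w i) t).
  move=> hr; apply/funext => k; apply/funext => t.
  rewrite !fct_sumE.
  have tm i : modact (c r i) (F i) k t = if k == n then r i t *: F i (w i) t else 0.
    rewrite /c; case: ifPn => oe.
      rewrite modact0 => [|j]; last by left.
      by rewrite (odd_weight0 oe (hr i)) scale0r if_same.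
    rewrite (@modact_support _ _ _ _ (e i)./2) => [|j je]; last by left; rewrite /single (negPf je).
    rewrite /single eqxx even_halfK //.
    case: eqP => [->|/eqP kn]; first by rewrite (en i) addrK.
    rewrite (F_weight (m := k - (e i)%:Z)) ?scaler0 //.
    by apply: contra kn => /eqP h; rewrite (en i) -h subrK.
  rewrite (eq_bigr _ (fun i _ => tm i)) /single; case: eqP => // _.
  by rewrite big1.
case: F_free => _ free.
have hX : modmodule rho (single n (fun t => \sum_i p i t *: F i (w i) t)).
  exact: single_mod.
have [c0 [_ uniq]] := free _ hX.
have e1 : c0 = c p by apply: uniq; split; [exact: cring|rewrite cE].
have e2 : c0 = c q.
  apply: uniq; split; [exact: cring|rewrite cE //]; congr single; exact/funext.
apply/funext => i; have := congr1 (fun c => c i) (etrans (esym e1) e2).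
rewrite /c; case: ifPn => oe; first by rewrite (odd_weight0 oe (hp i)) (odd_weight0 oe (hq i)).
by move=> /(congr1 (fun s => s (e i)./2)); rewrite /single eqxx.
Qed.

Variables (t0 : uhp) (g0 : SL2Z).
Hypothesis fix0 : mobius g0 t0 = t0.
Hypothesis j2 : mob_den g0 t0 ^+ 2 != 1.

(** From a relation at [t0], [polar_poincare] produces a form [H], and for every [i] a
    scalar form [Q i] with kernel [b i] times that of [E], such that
    [E t *: H t = \sum_i Q i t *: F i (w i) t]. Expanding [H] on the generators
    instead shows that [Q i] is a multiple of [E], so that [Q i0 t0 = 0]; but
    [Q i0 t0] is the sum of [b i0 * E^`() t0] over the stabilizer of [t0]. *)
Theorem generators_independent (b : 'I_d -> CC) :
  \sum_i b i *: F i (w i) t0 = 0 -> forall i, b i = 0.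
Proof.
move=> rel i0.
pose f i := F i (w i).
pose beta : CC := uhp_val t0 - cconj t0.
have beta0 : beta != 0 by exact: beta_neq0.
pose S := (\sum_i absz (w i))%N.
(* [W - w i0] is 2 modulo 12: together with the weight of [E], which is 10 modulo
   12, this makes the automorphy factors of [Q i0] on the stabilizer trivial.
   The multiple of [S] makes every [W - w i] at least 9. *)
pose W : int := w i0 + (12 * (2 * S + 1) + 2)%N%:Z.
have Sge i : (absz (w i) <= S)%N by rewrite /S (bigD1 i) //= leq_addr.
pose m i : nat := absz (W - w i - 9%:Z)%R.
have mW i : W = w i + (9 + m i)%N%:Z.
  rewrite /m /W; have := Sge i; have := Sge i0; lia.
have m0 : (9 + m i0 = 12 * (2 * S + 1) + 2)%N.
  have := mW i0; rewrite /W => /addrI [].  by [].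
have [l [E [D [hE D0 dE]]]] := form_with_nonzero_derivative t0.
have E0 : E t0 = 0 by exact: (weight_vanish fix0 j2 hE).
pose k := (12 * l + 10)%N.
pose a i := b i * beta ^+ (8 + m i).
have numE i (v : V) : (a i / beta ^+ (8 + m i)) *: v = b i *: v by rewrite /a mulfK ?expf_neq0.
have relH : polar_numer t0 f a m t0 = 0.
  by rewrite -[RHS]rel; apply: eq_bigr => i _; exact: numE.
have [fill [H [_ hH sH]]] := @polar_poincare V rho rho_rep t0 d w f a m W generator_form mW relH.
have hQ i := @polar_poincare CC^o triv_rep triv_rep_rep t0 1 (fun=> k%:Z) (fun=> E)
  (fun=> a i) (fun=> m i) (k + (9 + m i))%N%:Z (fun=> hE) (fun=> erefl).
have relQ i : polar_numer t0 (fun _ : 'I_1 => E) (fun=> a i) (fun=> m i) t0 = 0.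
  by rewrite /polar_numer big_ord1 E0 scaler0.
have [fillQ hQ1] := choice (fun i => hQ i (relQ i)).
have [Q hQ2] := choice hQ1.
have fillQE i : fillQ i = b i * D.
  have [hf _ _] := hQ2 i; have := hf \1%VF; rewrite [X in isD _ _ X]lfunE /= => h.
  pose r z : CC := a i / (z - cconj t0) ^+ (8 + m i).
  have dr : derC r (uhp_val t0).
    apply: derM; first exact: der_cst.
    apply: derV; first by rewrite expf_neq0.
    by apply: derX; apply: derB; [exact: der_id|exact: der_cst].
  have dr' : isD r (uhp_val t0) ('D_1 (r : CC^o -> CC^o) (uhp_val t0 : CC^o)) by exact/derivableP.
  have h2 := isD_M dr' dE.
  have h3 : isD (fun z => r z * extend0 E z) (uhp_val t0) (fillQ i).
    refine (isD_near _ h); exists (Im t0); first exact: uhp_Im_gt0.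
    by move=> z /uhp_open[t <-]; rewrite !extend0E lfunE /= /polar_numer big_ord1.
  rewrite (isD_uniq h3 h2) extend0E E0 mul0r addr0; congr (_ * _).
  by rewrite /r /a mulfK ?expf_neq0.
have termE (psi : 'Hom(V, CC^o)) t g :
  E t * psi (slash_term rho W (polar_part t0 f a m fill) g t) =
  \sum_i psi (f i t) * slash_term triv_rep (k + (9 + m i))%N%:Z
     (polar_part t0 (fun _ : 'I_1 => E) (fun=> a i) (fun=> m i) (fillQ i)) g t.
    (* Away from the orbit of [t0] both sides are the same finite sum; on the orbit the
     left-hand side is [0] and the right-hand side is a multiple of the relation. *)
have [A0|A0] := eqVneq (tau_form t0 g t) 0; last first.
    rewrite (slash_term_polar_part rho_rep a generator_form mW) // linear_sum mulr_sumr; apply: eq_bigr => i _.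
    rewrite (@slash_term_polar_part CC^o triv_rep triv_rep_rep t0 1 (fun=> k%:Z) (fun=> E) (fun=> a i)
      (fun=> m i) _ (fun=> hE) (fun=> erefl)) // big_ord1.
    rewrite linearZ /=.
    set x := a i / _.
    transitivity (psi (f i t) * (x * (E t : CC))) => //.
    by transitivity (E t * (x * psi (f i t))) => //; rewrite mulrCA [RHS]mulrC mulrA.
  have gt : mobius g t = t0.
    apply: val_inj; apply/eqP; rewrite -subr_eq0; move/eqP: A0.
    by rewrite /tau_form mulf_eq0 (negPf (mob_den_neq0 g t)).
  have Et : E t = 0.
    have [[_ hm] _] := hE; have := hm g t; rewrite gt E0 lfunE /= => /esym/eqP.
    by rewrite scaler_eq0 expfz_eq0 (negPf (mob_den_neq0 g t)) andbF => /eqP.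
  rewrite Et mul0r.
  have ft i : f i t = mob_den g t ^ (- w i) *: rho g^-1%g (f i t0).
    have [[_ hm] _] := generator_form i; have := hm g t; rewrite gt /f => ->.
    rewrite linearZ /= scalerA -expfzDr ?mob_den_neq0 // addNr expr0z scale1r.
    by rewrite -(rhoM rho_rep) mulVg (rho1 rho_rep).
  have pt i : slash_term triv_rep (k + (9 + m i))%N%:Z
     (polar_part t0 (fun _ : 'I_1 => E) (fun=> a i) (fun=> m i) (fillQ i)) g t =
     mob_den g t ^ (- (k + (9 + m i))%N%:Z) * (b i * D).
    by rewrite /slash_term lfunE /= /polar_part gt eqxx fillQE.
  have -> : \sum_i psi (f i t) * slash_term triv_rep (k + (9 + m i))%N%:Z
     (polar_part t0 (fun _ : 'I_1 => E) (fun=> a i) (fun=> m i) (fillQ i)) g t =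
     \sum_i (mob_den g t ^ (- (k%:Z + W)) * D) * psi (rho g^-1%g (b i *: f i t0)).
    apply: eq_bigr => i _; rewrite pt ft !linearZ /=.
    have -> : - (k%:Z + W) = - (k + (9 + m i))%N%:Z + - w i by rewrite (mW i) PoszD; ring.
    rewrite expfzDr ?mob_den_neq0 //.
    set x := mob_den g t ^ _; set y := mob_den g t ^ _; set z := psi _.
    transitivity ((x * z) * (y * (b i * D))) => //.
    by transitivity (y * x * D * (b i * z)) => //; ring.
  rewrite -mulr_sumr.
  have -> : \sum_i psi (rho g^-1%g (b i *: f i t0)) = psi (rho g^-1%g (\sum_i b i *: f i t0)).
    by rewrite !linear_sum.
  by rewrite (_ : \sum_i _ = 0) ?linear0 ?mulr0 //; exact: rel.
have EH t : E t *: H t = \sum_i Q i t *: f i t.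
  apply: functional_ext => psi.
  have h1 := has_sumZ (E t) (sH psi t).
  have h2 : has_sum (fun g => E t * psi (slash_term rho W (polar_part t0 f a m fill) g t)) (\sum_i psi (f i t) * Q i t).
    have hs i : has_sum (fun g => psi (f i t) * slash_term triv_rep (k + (9 + m i))%N%:Z
     (polar_part t0 (fun _ : 'I_1 => E) (fun=> a i) (fun=> m i) (fillQ i)) g t) (psi (f i t) * Q i t).
      have [_ _ hs] := hQ2 i; have := hs \1%VF t; rewrite lfunE /=.
      by move=> h; apply: has_sumZ; apply: eq_has_sum h => g; rewrite lfunE.
    by apply: eq_has_sum (has_sum_sum (index_enum 'I_d) hs) => g; rewrite termE.
  rewrite linearZ linear_sum [LHS](has_sum_unique h1 h2).
  by apply: eq_bigr => i _; rewrite linearZ /= [RHS]mulrC.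
have [hF free] := F_free.
have [c0 [[c0ring c0E] _]] := free _ (single_mod hH).
pose h i : uhp -> CC^o := if odd (9 + m i) then 0 else c0 i (9 + m i)./2.
have hh i : hol_vvmf triv_rep (9 + m i)%N%:Z (h i).
  rewrite /h; case: ifPn => oe; first exact: hol_vvmf0.
  by have [hc _] := c0ring i; have := hc (9 + m i)./2; rewrite even_halfK.
have Hh t : H t = \sum_i h i t *: f i t.
  have := congr1 (fun X => X W t) c0E; rewrite {1}/single eqxx => ->.
  rewrite !fct_sumE; apply: eq_bigr => i _; rewrite /h.
  have far j : w i + j.*2%:Z != W -> F i (W - j.*2%:Z) = 0.
    by move=> jW; apply: F_weight; apply: contra jW => /eqP <-; rewrite subrK.
  case: ifPn => oe.
    rewrite modact0 ?scale0r // => j; right; apply: far; apply/eqP.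
    by rewrite (mW i) => /addrI [] jm; move: oe; rewrite -jm odd_double.
  rewrite (@modact_support _ _ _ _ (9 + m i)./2) => [|j je].
    by rewrite even_halfK // {1}(mW i) addrK.
  right; apply: far; apply: contra je => /eqP; rewrite (mW i) => /addrI [] <-.
  by rewrite doubleK.
have pq : (fun i t => E t * h i t) = Q.
  apply: (@free_generators_cancel (k%:Z + W) (fun i => k + (9 + m i))%N).
  - by move=> i; rewrite (mW i) PoszD; ring.
  - move=> i; rewrite PoszD; exact: (hol_vvmf_mul hE (hh i)).
  - by move=> i; have [_ hq _] := hQ2 i.
  - have -> : (fun t => \sum_i (E t * h i t) *: F i (w i) t) = (fun t => E t *: H t).
      apply/funext => t; rewrite Hh scaler_sumr; apply: eq_bigr => i _.
      by rewrite scalerA.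
    exact: hol_vvmf_mul.
  - move=> t; rewrite -EH Hh scaler_sumr; apply: eq_bigr => i _.
    by rewrite scalerA.
have Q0 : Q i0 t0 = 0 by rewrite -pq E0 mul0r.
have sQ : has_sum (fun g => if `[< mobius g t0 = t0 >] then b i0 * D else 0) 0.
  have [_ _ hs] := hQ2 i0; have := hs \1%VF t0; rewrite lfunE /= Q0.
  apply: eq_has_sum => g; rewrite lfunE /=; case: ifPn => [/asboolP fg|/asboolPn nf].
    rewrite /slash_term lfunE /= /polar_part fg eqxx fillQE -exprnN.
    have -> : (k + (9 + m i0) = 12 * (l + 2 * S + 2))%N by rewrite m0 /k; ring.
    by rewrite exprM (mob_den_fix12 fg) expr1n invr1 scale1r.
  rewrite (@slash_term_polar_part CC^o triv_rep triv_rep_rep t0 1 (fun=> k%:Z) (fun=> E) (fun=> a i0)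
    (fun=> m i0) _ (fun=> hE) (fun=> erefl)) ?big_ord1 ?E0 ?scaler0 //.
  rewrite mulf_neq0 ?mob_den_neq0 // subr_eq0; apply/eqP => e; apply: nf; exact: val_inj.
have /eqP := has_sum_stabilizer sQ; rewrite mulf_eq0 (negPf D0) orbF => /eqP //.
Qed.
End independence.

(** * The trace formulas *)

Lemma lftrace_eigen (V : vectType CC) (d : nat) (f : 'End(V)) (v : 'I_d -> V) (lam : 'I_d -> CC) :
  \dim (fullv : {vspace V}) = d ->
  (forall b : 'I_d -> CC, \sum_i b i *: v i = 0 -> forall i, b i = 0) ->
  (forall i, f (v i) = lam i *: v i) -> lftrace f = \sum_i lam i.
Proof.
move=> dV; subst d => ind eig.
set e := vbasis (fullv : {vspace V}).
have eb : basis_of fullv e by exact: vbasisP.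
pose M := passmx.mxof e e f.
pose P := \matrix_i passmx.rVof e (v i).
pose D := diag_mx (\row_i lam i).
have PM : P *m M = D *m P.
  apply/row_matrixP => i; rewrite !row_mul rowK row_diag_mx mxE -scalemxAl -rowE rowK.
  by rewrite -passmx.rVof_app // eig; apply/rowP => j; rewrite !mxE linearZ.
have Pu : P \in unitmx.
  rewrite -row_free_unit -kermx_eq0; apply/eqP/row_matrixP => i; rewrite row0.
  set u := row i _; have uP : u *m P = 0 by rewrite /u -row_mul mulmx_ker row0.
  apply/rowP => j; rewrite [RHS]mxE; apply: (ind (fun j => u 0 j)).
  apply/eqP; rewrite -(passmx.rVof_eq0 eb); apply/eqP/rowP => l.
  have : (u *m P) 0 l = 0 by rewrite uP mxE.
  rewrite !mxE linear_sum => {2}<-.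
  by apply: eq_bigr => k _; rewrite linearZ !mxE.
have ME : M = invmx P *m (D *m P) by rewrite -PM mulKmx.
rewrite /lftrace -/e -/M ME mxtrace_mulC -mulmxA mulmxV // mulmx1 mxtrace_diag.
by apply: eq_bigr => i _; rewrite mxE.
Qed.

(** At a point fixed by [h], a form of weight [w i] takes its values in the eigenspace
    of [rho h] for [z ^ w i], where [z^-1 = mob_den h t0]. The element [g0] may differ
    from [h]; it serves to prove the independence of the values. *)
Lemma trace_at_fixed_point (d : nat) (V : vectType CC) (rho : SL2Z -> 'End(V))
    (F : 'I_d -> int -> uhp -> V) (w : 'I_d -> int) (t0 : uhp) (g0 h : SL2Z) (z : CC) :
  \dim (fullv : {vspace V}) = d -> representation rho -> free_generators rho F ->
  (forall i : 'I_d, homogeneous (w i) (F i)) ->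
  mobius g0 t0 = t0 -> mob_den g0 t0 ^+ 2 != 1 ->
  mobius h t0 = t0 -> mob_den h t0 = z^-1 ->
  lftrace (rho h) = hilbert_poly w z.
Proof.
move=> dV rr free hom fix0 j2 fixh jh.
rewrite (lftrace_eigen (v := fun i => F i (w i) t0) (lam := fun i => z ^ w i) dV) //.
  exact: (generators_independent rr free hom fix0 j2).
move=> i; have [[_ hm] _] := generator_form w free i.
have z0 : z != 0 by rewrite -invr_eq0 -jh mob_den_neq0.
have := hm h t0; rewrite fixh jh => {2}->.
by rewrite scalerA -expfzMl mulfV // exp1rz scale1r.
Qed.

Fact iC_Im : 0 < Im iC. Proof. by rewrite /= ltr01. Qed.
Definition uhp_i : uhp := MkUhp iC_Im.

Lemma sqr_iC : iC * iC = -1. Proof. by apply: complexP => /=; ring. Qed.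

Lemma mob_den_S : mob_den matS uhp_i = iC.
Proof. by rewrite /mob_den !mxE /= addr0 mul1r. Qed.

Lemma mobius_S : mobius matS uhp_i = uhp_i.
Proof.
apply: val_inj; apply: (mulIf (mob_den_neq0 matS uhp_i)).
rewrite [LHS]mobiusE mob_den_S /mob_num !mxE /= mul0r add0r.
by rewrite sqr_iC rmorphN.
Qed.

Lemma zetaE : zeta = Complex (- 2^-1) (Num.sqrt 3 / 2).
Proof.
rewrite /zeta /cexp /= exp_0 !mul1r.
have e3 : IZR 3 = 3%:R :> R by rewrite IZRposE INRE.
have e2 : IZR 2 = 2%:R :> R by rewrite IZRposE INRE.
have e : 2 * PI / 3 = Rmult (IZR 2) (Rdiv PI (IZR 3)) :> R by rewrite RmultE RdivE e3 e2 mulrA.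
have eN : IZR (Zneg xH) = -1 :> R by [].
by rewrite e cos_2PI3 sin_2PI3 !RdivE RsqrtE e3 e2 eN mulN1r.
Qed.

(** [zeta] is a primitive cube root of unity, so that [1 + zeta] is fixed by [matU]. *)
Lemma zeta_rel : zeta * zeta + zeta + 1 = 0.
Proof.
have s3 : Num.sqrt (3 : R) * Num.sqrt 3 = 3 by rewrite -expr2 sqr_sqrtr.
rewrite zetaE; apply: complexP => /=; last by field.
have -> : - 2^-1 * - 2^-1 - Num.sqrt 3 / 2 * (Num.sqrt 3 / 2) + - 2^-1 + 1 =
   (3 - Num.sqrt (3 : R) * Num.sqrt 3) / 4 by field.
by rewrite s3 subrr mul0r.
Qed.

Fact rho_Im : 0 < Im (1 + zeta).
Proof. by rewrite zetaE /= add0r divr_gt0 // sqrtr_gt0. Qed.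
Definition uhp_rho : uhp := MkUhp rho_Im.

Lemma mob_den_U : mob_den matU uhp_rho = zeta.
Proof. by rewrite /mob_den !mxE /= mul1r rmorphN /= addrAC subrr add0r. Qed.

Lemma mobius_U : mobius matU uhp_rho = uhp_rho.
Proof.
apply: val_inj; apply: (mulIf (mob_den_neq0 matU uhp_rho)).
rewrite [LHS]mobiusE mob_den_U /mob_num !mxE /= mul0r add0r rmorphN /=.
apply/eqP; rewrite eq_sym -subr_eq0 opprK -zeta_rel; apply/eqP; ring.
Qed.

Theorem theorem3 (d : nat) (V : vectType CC) (rho : SL2Z -> 'End(V))
    (eps : bool) (F : 'I_d -> int -> uhp -> V) (w : 'I_d -> int)
    (dimV : \dim {:V} = d)
    (rho_rep : representation rho)
    (rho_negI : rho negI = (-1) ^+ eps *: \1%VF)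
    (F_free : free_generators rho F)
    (F_weight : forall i : 'I_d, homogeneous (w i) (F i)) :
  hilbert_poly w (- iC) = lftrace (rho matS) /\
  hilbert_poly w zeta = lftrace (rho matU^-1%g) /\
  hilbert_poly w zeta^-1 = lftrace (rho matU).
Proof.
have i2 : mob_den matS uhp_i ^+ 2 != 1.
  by rewrite mob_den_S expr2 sqr_iC; apply/eqP => /(congr1 (fun z : CC => Re z)) /=; lra.
have z0 : zeta != 0.
  by apply: contra_eq_neq zeta_rel => ->; rewrite !mul0r !add0r oner_eq0.
have z2 : mob_den matU uhp_rho ^+ 2 != 1.
  rewrite mob_den_U; apply/eqP => z2.
  have e : zeta = - 2%:R by apply/eqP; rewrite -subr_eq0 opprK -zeta_rel -expr2 z2; apply/eqP; ring.
  have s0 : 0 < Num.sqrt (3 : R) / 2 by rewrite divr_gt0 // sqrtr_gt0.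
  by move/(congr1 (fun z : CC => Im z)): e; rewrite zetaE /=; lra.
have tr := trace_at_fixed_point dimV rho_rep F_free F_weight.
split; last split; apply/esym.
- apply: (tr uhp_i matS) mobius_S i2 mobius_S _; rewrite mob_den_S.
  have ni : - iC != 0 by rewrite -cabs_gt0 cabsN cabs_i.
  by apply: (mulIf ni); rewrite mulVf // mulrN sqr_iC opprK.
- apply: (tr uhp_rho matU) mobius_U z2 _ _.
    by rewrite -{1}mobius_U mobiusV.
  by rewrite -{1}mobius_U mob_denV mob_den_U.
- apply: (tr uhp_rho matU) mobius_U z2 mobius_U _.
  by rewrite mob_den_U invrK.
Qed.
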